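(* Let $G=G_1\cup G_2$ be a connected closed graph with $V(G_1)\cap V(G_2)=\{v\}$, where $v$ is a cut point of $G$ and $G_1,G_2$ are subgraphs of $G$ without cut point. Let $R:=\Bbbk[x_k,y_k\mid k\in V(G)]$ and $R_i:=\Bbbk[x_k,y_k\mid k\in V(G_i)]$, and let $p_i:=\mathrm{pd}(R_i/\mathrm{in}(J_{G_i}))$ and $r_i:=\mathrm{reg}(R_i/\mathrm{in}(J_{G_i}))$ for $i=1,2$. If $\beta_{p_i,p_i+r_i}(R_i/\mathrm{in}(J_{G_i}))\neq0$ for $i=1,2$, then $$\beta_{p,p+r}(R/J_G)=\beta_{p,p+r}(R/\mathrm{in}(J_G))\neq0,$$ where $p=p_1+p_2$ and $r=r_1+r_2$. In particular, $\mathrm{reg}(R/J_G)=\mathrm{reg}(R/\mathrm{in}(J_G))=r$ and $\mathrm{pd}(R/J_G)=\mathrm{pd}(R/\mathrm{in}(J_G))=p$.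
   Context: Graphs are finite and simple; $\Bbbk$ is a field. A graph $G$ on $\{1,\ldots,n\}$ is closed with respect to the given labelling if whenever $\{i,j\},\{i,k\}$ ($j\ne k$) are edges and either $i<j,\ i<k$ or $i>j,\ i>k$, then $\{j,k\}$ is an edge; a closed graph is always taken with a fixed labelling for which this holds, and subgraphs carry the labels of $G$. A vertex $v$ of a connected graph $G$ is a cut point if $G\setminus v$ is disconnected. The union $G_1\cup G_2$ has vertex set $V(G_1)\cup V(G_2)$ and edge set $E(G_1)\cup E(G_2)$. The binomial edge ideal is $J_G=(x_iy_j-x_jy_i\mid\{i,j\}\in E(G),\ i<j)$; $\mathrm{in}(J_G)$ is its initial ideal for the lexicographic order induced by $x_1>\cdots>x_n>y_1>\cdots>y_n$ (and for $G_i$, by the restriction of this order). $\beta_{i,j}$ are graded Betti numbers, $\mathrm{pd}=\max\{i\mid\beta_{i,j}\ne0\}$, $\mathrm{reg}=\max\{j-i\mid\beta_{i,j}\neq0\}$. *)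

(* Defs.v *)
From HB Require Import structures.
From mathcomp Require Import all_boot all_order all_algebra.
From mathcomp Require Import mpoly.
From Stdlib Require Import ClassicalEpsilon.

Set Implicit Arguments.
Unset Strict Implicit.
Unset Printing Implicit Defensive.

Import GRing.Theory.

Local Open Scope ring_scope.

(* The labels 1, ..., n of the mathematical text are the ordinals 0, ..., n-1. *)
Record lgraph (n : nat) := LGraph {
  vset : {set 'I_n};
  edge : rel 'I_n;
  edge_sym : ssrbool.symmetric edge;
  edge_irr : irreflexive edge;
  edge_vset : forall u w, edge u w -> u \in vset
}.

Section Graphs.
Variable n : nat.
Implicit Types (G H : lgraph n) (v : 'I_n).

Section DeleteVertex.
Variables (G : lgraph n) (v : 'I_n).

Definition del_edge : rel 'I_n :=
  fun u w => [&& edge G u w, u != v & w != v].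

Lemma del_edge_sym : ssrbool.symmetric del_edge.
Proof. by move=> u w; rewrite /del_edge edge_sym [(_ != v) && _]andbC. Qed.

Lemma del_edge_irr : irreflexive del_edge.
Proof. by move=> u; rewrite /del_edge edge_irr. Qed.

Lemma del_edge_vset u w : del_edge u w -> u \in vset G :\ v.
Proof. by case/and3P=> /edge_vset uG uv _; rewrite !inE uv. Qed.

Definition del_vertex : lgraph n :=
  LGraph del_edge_sym del_edge_irr del_edge_vset.

End DeleteVertex.

Definition connected G : Prop :=
  {in vset G &, forall u w, connect (edge G) u w}.

Definition cut_point G v : Prop :=
  [/\ connected G, v \in vset G & ~ connected (del_vertex G v)].

Definition closed_graph G : Prop :=
  forall i j k : 'I_n, j != k -> edge G i j -> edge G i k ->
    (i < j)%N && (i < k)%N || (j < i)%N && (k < i)%N -> edge G j k.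

Definition is_union G H1 H2 : Prop :=
  vset G = vset H1 :|: vset H2 /\
  (forall u w, edge G u w = edge H1 u w || edge H2 u w).

End Graphs.

Section Ideals.
Variables (K : fieldType) (N : nat).
Local Notation R := {mpoly K[N]}.

Definition ideal_gen (S : R -> Prop) : R -> Prop := fun f =>
  exists s : seq (R * R),
    (forall p, p \in s -> S p.2) /\ f = \sum_(p <- s) p.1 * p.2.

(* Pure lexicographic order, the variable of index 0 being the largest (the    *)
(* order on monomials provided by mpoly compares total degrees first).         *)
Definition lex_lt (m1 m2 : 'X_{1..N}) : bool :=
  [exists i : 'I_N,
    (m1 i < m2 i)%N && [forall j : 'I_N, (j < i)%N ==> (m1 j == m2 j)]].

Definition lex_lead (f : R) (m : 'X_{1..N}) : Prop :=
  m \in msupp f /\ {in msupp f, forall m', m' != m -> lex_lt m' m}.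

Definition initial_ideal (I : R -> Prop) : R -> Prop :=
  ideal_gen (fun g => exists f m, [/\ I f, lex_lead f m & g = 'X_[m]]).

(* A sequence of graded free modules F_i = \bigoplus_a R(- gdeg i a), with     *)
(* elements the row vectors of length [rk i]; matrices act on the right, and   *)
(* [aug] lists the images in R of the basis of F_0.                            *)
Record free_complex := FreeComplex {
  rk : nat -> nat;
  gdeg : forall i, 'I_(rk i) -> nat;
  aug : 'cV[R]_(rk 0);
  dif : forall i, 'M[R]_(rk i.+1, rk i)
}.

(* F is a minimal graded free resolution of the cyclic module R / I: the maps  *)
(* preserve degrees, the augmented sequence                                    *)
(*     ... -> F_1 -> F_0 -> R / I -> 0                                         *)
(* is exact, and the image of F_{i+1} lies in (variables) F_i.                 *)
Definition min_graded_free_res (I : R -> Prop) (F : free_complex) : Prop :=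
  [/\ [/\ forall a, aug F a 0 \is (gdeg (i := 0) a).-homog
        & forall i a b, {in msupp (dif F i a b), forall m,
                          (mdeg m + gdeg b)%N = gdeg a}],
      [/\ forall f : R, exists u : 'rV[R]_(rk F 0), I (f - (u *m aug F) 0 0),
          forall u : 'rV[R]_(rk F 0),
            I ((u *m aug F) 0 0) <-> exists w, u = w *m dif F 0
        & forall i (u : 'rV[R]_(rk F i.+1)),
            u *m dif F i = 0 <-> exists w, u = w *m dif F i.+1]
    & forall i a b, (dif F i a b)@_0%MM = 0].

(* betti I i j is the graded Betti number beta_{i,j}(R / I), for I a           *)
(* homogeneous ideal: the number of summands R(-j) in the i-th module of a     *)
(* minimal graded free resolution, which exists and is unique up to            *)
(* isomorphism.                                                                *)
Definition betti (I : R -> Prop) (i j : nat) : nat :=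
  epsilon (inhabits 0%N) (fun b => exists F : free_complex,
    min_graded_free_res I F /\ b = #|[set a : 'I_(rk F i) | gdeg a == j]|).

Definition is_pd (I : R -> Prop) (p : nat) : Prop :=
  (exists j, betti I p j <> 0%N) /\
  (forall i j, betti I i j <> 0%N -> (i <= p)%N).

(* j - i = r and j - i <= r are written without truncated subtraction.         *)
Definition is_reg (I : R -> Prop) (r : nat) : Prop :=
  (exists i, betti I i (i + r) <> 0%N) /\
  (forall i j, betti I i j <> 0%N -> (j <= i + r)%N).

End Ideals.

(* The polynomial ring of G has two variables for each vertex of G. The vertex *)
(* enum_val a is the a-th one for the increasing order of the labels, so the   *)
(* variables come in the order x_1, x_2, ..., y_1, y_2, ..., and lex_lt is the *)
(* lexicographic order induced by x_1 > x_2 > ... > y_1 > y_2 > ...            *)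
Section BinomialEdgeIdeal.
Variables (K : fieldType) (n : nat) (G : lgraph n).

Definition nvar : nat := (#|vset G| + #|vset G|)%N.

Definition xvar (a : 'I_#|vset G|) : {mpoly K[nvar]} := 'X_(lshift _ a).
Definition yvar (a : 'I_#|vset G|) : {mpoly K[nvar]} := 'X_(rshift _ a).

Definition binom_edge_ideal : {mpoly K[nvar]} -> Prop :=
  ideal_gen (fun g => exists a b : 'I_#|vset G|,
    [/\ edge G (enum_val a) (enum_val b),
        (enum_val a < enum_val b)%N
      & g = xvar a * yvar b - xvar b * yvar a]).

End BinomialEdgeIdeal.

Arguments binom_edge_ideal K {n} G _.

(* Main.v *)
From HB Require Import structures.
Require Import Defs.
From mathcomp Require Import all_boot all_order all_algebra.
From mathcomp Require Import mpoly ssrcomplements zify.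
From Stdlib Require Import ClassicalEpsilon FunctionalExtensionality.
From Stdlib Require Import PropExtensionality.

Set Implicit Arguments.
Unset Strict Implicit.
Unset Printing Implicit Defensive.

Import GRing.Theory.

(** Graded Betti numbers are the dimensions of the graded pieces of Tor with the
    residue field, and only two facts about them are used. Whether a Betti number
    vanishes can be tested on the Koszul complex instead of a resolution
    ([minres_Koszul]); and their alternating sum over the homological degrees, in
    a fixed internal degree, depends only on the Hilbert function of the quotient
    ([minres_euler]). As Betti numbers are read off from some minimal graded free
    resolution, its existence is part of the argument
    ([min_graded_free_res_exists]); it rests on Hilbert's basis theorem.

    For a closed graph the quadratic generators of the binomial edge ideal form a
    Groebner basis. The reason is combinatorial: replacing [x_a y_b] by [x_b y_a]
    along edges [a < b] is a terminating and, by closedness, confluent rewriting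
    of monomials, so that every monomial has one normal form modulo the ideal
    ([closed_graph_lead_set]). The initial ideal is therefore generated by the
    products [x_a y_b] over the edges [a < b].

    At the cut point [v], each part has an edge: otherwise it would be a single
    vertex and [v] would cut the other part. Closedness forces neighbours of [v]
    in different parts to lie on different sides of [v]; so, up to exchanging the
    parts, [v] is above its neighbours in [G1] and below those in [G2]
    ([cut_point_order]). Then the generators of the initial ideal that come from
    [G1] involve [y_v] but not [x_v], and those from [G2] involve [x_v] but not
    [y_v]: the initial ideal of [G] is the sum of two monomial ideals in disjoint
    sets of variables ([graph_red_split]). In each multidegree its Koszul complex
    is the tensor product of those of the two summands, and over a field the
    homology of a tensor product is nonzero in some degree exactly when that of
    both factors is ([betti_sum_neq0], [betti_sum_neq0_conv]). Hence all Betti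
    numbers of the initial ideal lie in the rectangle of homological degrees at
    most [p = p1 + p2] and regularities at most [r = r1 + r2], and the corner
    [(p, p + r)] is not zero.

    Passing from an ideal to its initial ideal can only create Betti numbers
    ([Kvan_of_initial]), so those of the binomial edge ideal lie in the same
    rectangle. In internal degree [p + r] the corner is then the only possibly
    nonzero Betti number of either ideal; since the two ideals have the same
    Hilbert function, the corner values agree ([betti_corner]). *)

(** * Homogeneous parts *)

Section HomogeneousParts.
Local Open Scope ring_scope.
Variables (K : fieldType) (N : nat).
Local Notation R := {mpoly K[N]}.
Implicit Types (p q : R) (m k : 'X_{1..N}).

Lemma mcoeffMXif p m k :
  (p * 'X_[m])@_k = if (m <= k)%MM then p@_(k - m)%MM else 0.
Proof.
case: ifP => [le_mk|/negP nle].
  by rewrite -{1}(submK le_mk) addmC mcoeffMX.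
apply: memN_msupp_eq0; rewrite (perm_mem (msuppMX p m)).
by apply/mapP => -[m' _ def_k]; apply: nle; rewrite def_k lem_addr.
Qed.

Definition mrestr (A : pred 'X_{1..N}) p : R :=
  \sum_(m <- msupp p | A m) p@_m *: 'X_[m].

Lemma mcoeff_sumX (A : pred 'X_{1..N}) p (f : 'X_{1..N} -> 'X_{1..N}) k :
  (\sum_(m <- msupp p | A m) p@_m *: 'X_[f m])@_k =
  \sum_(m <- msupp p | A m && (f m == k)) p@_m.
Proof.
rewrite raddf_sum /= (bigID (fun m => f m == k)) /= [X in _ + X]big1 ?addr0.
  by apply: eq_bigr => m /andP[_ /eqP <-]; rewrite mcoeffZ mcoeffX eqxx mulr1.
by move=> m /andP[_ /negPf h]; rewrite mcoeffZ mcoeffX h mulr0.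
Qed.

Lemma sum_msupp1 (A : pred 'X_{1..N}) p k :
  \sum_(m <- msupp p | A m && (m == k)) p@_m = if A k then p@_k else 0.
Proof.
case: (boolP (k \in msupp p)) => [k_p|k_p].
  rewrite -big_filter; case: ifP => Ak.
    rewrite (_ : [seq m <- _ | _] = [seq m <- msupp p | pred1 k m]); last first.
      by apply: eq_filter => m /=; case: eqP => [->|]; rewrite ?Ak ?andbF.
    by rewrite filter_pred1_uniq ?msupp_uniq // big_seq1.
  rewrite big_filter big_pred0 // => m.
  by case: eqP => [->|]; rewrite ?Ak ?andbF.
rewrite (memN_msupp_eq0 k_p) if_same big_seq_cond big_pred0 // => m.
by case: eqP => [->|]; rewrite ?(negPf k_p) ?andbF.
Qed.

Lemma mcoeff_mrestr (A : pred 'X_{1..N}) p m : (mrestr A p)@_m = if A m then p@_m else 0.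
Proof. by rewrite mcoeff_sumX sum_msupp1. Qed.

Lemma mrestrD (A : pred 'X_{1..N}) : {morph mrestr A : p q / p + q}.
Proof.
move=> p q; apply/mpolyP => m; rewrite mcoeffD !mcoeff_mrestr mcoeffD.
by case: (A m); rewrite ?addr0.
Qed.

Lemma mrestr_sum (A : pred 'X_{1..N}) (I : Type) (r : seq I) (P : pred I) (F : I -> R) :
  mrestr A (\sum_(i <- r | P i) F i) = \sum_(i <- r | P i) mrestr A (F i).
Proof.
apply: (big_morph _ (mrestrD A)); apply/mpolyP => m.
by rewrite mcoeff_mrestr mcoeff0 if_same.
Qed.

(** Restricting the support commutes with multiplication by a polynomial that
    shifts the restriction, as multiplication by a homogeneous polynomial
    shifts the degree. *)
Lemma mrestrM (A B : pred 'X_{1..N}) p q :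
  (forall m k, q@_k != 0 -> A (m + k)%MM = B m) ->
  mrestr A (p * q) = mrestr B p * q.
Proof.
move=> h; apply/mpolyP => m; rewrite mcoeff_mrestr.
rewrite !mcoeffM; case: ifP => Am.
  apply: eq_bigr => k /eqP def_m; rewrite mcoeff_mrestr.
  have [->|nz] := eqVneq q@_k.2 0; first by rewrite !mulr0.
  by rewrite -(h k.1 k.2 nz) -def_m Am.
rewrite big1 // => k /eqP def_m; rewrite mcoeff_mrestr.
have [->|nz] := eqVneq q@_k.2 0; first by rewrite !mulr0.
by rewrite -(h k.1 k.2 nz) -def_m Am mul0r.
Qed.

Lemma mrestr_id (A : pred 'X_{1..N}) p : (forall m, p@_m != 0 -> A m) -> mrestr A p = p.
Proof.
move=> h; apply/mpolyP => m; rewrite mcoeff_mrestr; case: ifP => // Am.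
by have [->|/h] := eqVneq p@_m 0; rewrite ?Am.
Qed.

(** The quotient by ['X_i] of the sum of the terms of [p] that it divides. *)
Definition mdivX (i : 'I_N) p : R :=
  \sum_(m <- msupp p | m i != 0%N) p@_m *: 'X_[(m - U_(i))%MM].

Lemma mcoeff_mdivX i p m : (mdivX i p)@_m = p@_(m + U_(i))%MM.
Proof.
rewrite mcoeff_sumX.
rewrite (eq_bigl (fun k => (k i != 0%N) && (k == (m + U_(i))%MM))).
  by rewrite sum_msupp1 mnmDE mnm1E eqxx addn1.
move=> k; apply: andb_id2l => ki; apply/eqP/eqP => [<-|->]; last by rewrite addmK.
by rewrite submK // lep1mP.
Qed.

(** Rows of length [s] are the elements of the graded free module with one
    basis vector of degree [deg b] for each [b]. *)
Section GradedRows.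
Variables (s : nat) (deg : 'I_s -> nat).
Implicit Types (u : 'rV[R]_s).

Definition vpart d u : 'rV[R]_s :=
  \row_b mrestr (fun m => mdeg m + deg b == d)%N (u 0 b).

Definition vhom d u := forall b m, (u 0 b)@_m != 0 -> (mdeg m + deg b)%N = d.

Lemma mcoeff_vpart d u b m :
  (vpart d u 0 b)@_m = if (mdeg m + deg b == d)%N then (u 0 b)@_m else 0.
Proof. by rewrite mxE mcoeff_mrestr. Qed.

Lemma vpart_hom d u : vhom d (vpart d u).
Proof.
by move=> b m; rewrite mcoeff_vpart; case: ifP => [/eqP //|_]; rewrite eqxx.
Qed.

Lemma vpart_id d u : vhom d u -> vpart d u = u.
Proof.
by move=> h; apply/rowP => b; rewrite mxE mrestr_id // => m /h ->.
Qed.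

Lemma vpartD d : {morph vpart d : u v / u + v}.
Proof. by move=> u v; apply/rowP => b; rewrite !mxE mrestrD. Qed.

Lemma vpartN d : {morph vpart d : u / - u}.
Proof.
move=> u; apply/rowP => b; rewrite !mxE; apply/mpolyP => m.
by rewrite mcoeffN !mcoeff_mrestr mcoeffN; case: ifP; rewrite ?oppr0.
Qed.

(** Graded submodules of the graded free module with degrees [deg]. *)
Definition gsub (P : 'rV[R]_s -> Prop) :=
  [/\ P 0, forall u v, P u -> P v -> P (u + v),
      forall f u, P u -> P (f *: u) & forall d u, P u -> P (vpart d u)].

Lemma gsubN P u : gsub P -> P u -> P (- u).
Proof. by case=> _ _ PZ _ Pu; rewrite -scaleN1r; apply: PZ. Qed.

Lemma gsubB P u v : gsub P -> P u -> P v -> P (u - v).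
Proof. by move=> gP Pu Pv; case: (gP) => _ PD _ _; apply: PD; last exact: gsubN. Qed.

Lemma gsub_sum P : gsub P -> forall (I : Type) (r : seq I) (Q : pred I) F,
  (forall i, Q i -> P (F i)) -> P (\sum_(i <- r | Q i) F i).
Proof.
case=> P0 PD _ _ I r Q F hF; elim/big_ind: _; first exact: P0.
  exact: PD.
exact: hF.
Qed.

End GradedRows.

(** Homogeneous maps of degree zero between graded free modules. *)
Definition mhom s s' (deg' : 'I_s' -> nat) (deg : 'I_s -> nat)
    (A : 'M[R]_(s', s)) :=
  forall a b m, (A a b)@_m != 0 -> (mdeg m + deg b)%N = deg' a.

Section GradedMatrix.
Variables (s s' : nat) (deg' : 'I_s' -> nat) (deg : 'I_s -> nat).
Variable (A : 'M[R]_(s', s)).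
Hypothesis A_hom : mhom deg' deg A.

Lemma vpartM d u : vpart deg d (u *m A) = vpart deg' d u *m A.
Proof.
apply/rowP => b; rewrite !mxE mrestr_sum; apply: eq_bigr => a _.
rewrite mxE; apply: mrestrM => m k /A_hom <-.
by rewrite mdegD addnA.
Qed.

Lemma vhomM d u : vhom deg' d u -> vhom deg d (u *m A).
Proof. by move/vpart_id => <-; rewrite -vpartM; apply: vpart_hom. Qed.

Lemma gsub_im : gsub deg (fun u => exists w, u = w *m A).
Proof.
split=> [|_ _ [w ->] [w' ->]|f _ [w ->]|d _ [w ->]].
- by exists 0; rewrite mul0mx.
- by exists (w + w'); rewrite mulmxDl.
- by exists (f *: w); rewrite scalemxAl.
by exists (vpart deg' d w); rewrite vpartM.
Qed.

Lemma gsub_ker : gsub deg' (fun u => u *m A = 0).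
Proof.
split=> [|u v hu hv|f u hu|d u hu]; first by rewrite mul0mx.
- by rewrite mulmxDl hu hv addr0.
- by rewrite -scalemxAl hu scaler0.
rewrite -vpartM hu; apply/rowP => b; rewrite !mxE.
by apply/mpolyP => m; rewrite mcoeff_mrestr mcoeff0 if_same.
Qed.

End GradedMatrix.

(** Homogeneous ideals. *)
Definition gideal (I : R -> Prop) :=
  [/\ I 0, forall f g, I f -> I g -> I (f + g), forall f g, I g -> I (f * g)
    & forall d f, I f -> I (mrestr (fun m => mdeg m == d) f)].

Lemma gideal_gsub I : gideal I ->
  gsub (fun _ : 'I_1 => 0%N) (fun u => I (u 0 0)).
Proof.
case=> I0 ID IM Ih; split=> [|u v hu hv|f u hu|d u hu]; rewrite !mxE //.
- exact: ID.
- exact: IM.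
suff ->: mrestr (fun m => mdeg m + 0 == d)%N (u 0 0) =
         mrestr (fun m => mdeg m == d) (u 0 0) by apply: Ih.
by apply/mpolyP => m; rewrite !mcoeff_mrestr addn0.
Qed.

Lemma ideal_gen_gideal (S : R -> Prop) :
  (forall f, S f -> exists d, f \is d.-homog) -> gideal (ideal_gen S).
Proof.
move=> hS; split.
- by exists [::]; rewrite big_nil.
- move=> _ _ [r [hr ->]] [t [ht ->]]; exists (r ++ t); rewrite big_cat.
  by split=> // p; rewrite mem_cat => /orP[/hr|/ht].
- move=> f _ [r [hr ->]]; exists [seq (f * x.1, x.2) | x <- r]; split.
    by move=> _ /mapP[p /hr hp ->].
  by rewrite big_map mulr_sumr; apply: eq_bigr => p _; rewrite mulrA.
move=> d _ [r [hr ->]].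
elim: r hr => [|p r IHr] hr.
  exists [::]; rewrite !big_nil; split=> //; apply/mpolyP => m.
  by rewrite mcoeff_mrestr mcoeff0 if_same.
have [q q_r|t [ht e_t]] := IHr; first by apply: hr; rewrite inE q_r orbT.
have S_p : S p.2 by apply: hr; rewrite mem_head.
have [e /dhomogP p_e] := hS _ S_p.
exists ((mrestr (fun m => mdeg m + e == d)%N p.1, p.2) :: t); split.
  by move=> q; rewrite inE => /predU1P[->|/ht].
rewrite !big_cons mrestrD e_t; congr (_ + _) => /=.
by apply: mrestrM => m k; rewrite -mcoeff_msupp => /p_e /= <-; rewrite mdegD.
Qed.

End HomogeneousParts.

(** * The Koszul complex *)

Section Signs.
Local Open Scope ring_scope.
Variables (N : nat) (rho : 'I_N -> nat).
Implicit Types (k l : 'I_N) (S : {set 'I_N}).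

(** The sign that sorts the exterior product of the basis vector [k] with those
    in [S]. The order of the variables is a parameter [rho] because the Koszul
    complex of a sum of ideals in disjoint variables is split in an order adapted
    to the two sets of variables. *)
Definition sgn k S : bool := odd #|[set l in S | (rho l < rho k)%N]|.

Lemma sgnU k l S : l \notin S -> sgn k (l |: S) = (rho l < rho k)%N (+) sgn k S.
Proof.
move=> lS; rewrite /sgn; case: (ltnP (rho l) (rho k)) => h /=.
  rewrite (_ : [set _ in _ | _] = l |: [set i in S | (rho i < rho k)%N]).
    by rewrite cardsU1 inE (negPf lS).
  by apply/setP => i; rewrite !inE andb_orl; case: eqP => [->|]; rewrite ?h.
congr (odd #|pred_of_set _|); apply/setP => i; rewrite !inE andb_orl.
by case: eqP => [->|]; rewrite // ltnNge h.
Qed.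

Hypothesis rho_inj : injective rho.

Lemma sgn_antib k l S : k != l -> k \notin S -> l \notin S ->
  sgn l (k |: S) = ~~ (sgn k S (+) sgn l S (+) sgn k (l |: S)).
Proof.
move=> kl kS lS; rewrite !sgnU //.
have -> : (rho k < rho l)%N = ~~ (rho l < rho k)%N.
  by rewrite -leqNgt ltn_neqAle (inj_eq rho_inj) kl.
by case: (_ < _)%N; case: (sgn k S); case: (sgn l S).
Qed.

Lemma sgn_anti (A : pzRingType) k l S : k != l -> k \notin S -> l \notin S ->
  (-1) ^+ sgn k S * (-1) ^+ sgn l (k |: S) =
  - ((-1) ^+ sgn l S * (-1) ^+ sgn k (l |: S)) :> A.
Proof.
move=> kl kS lS; rewrite (sgn_antib kl) // -!signr_addb -signrN.
by congr ((-1) ^+ _); case: (sgn k S); case: (sgn l S); case: sgn.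
Qed.

End Signs.

Section Koszul.
Local Open Scope ring_scope.
Variables (K : fieldType) (N : nat) (rho : 'I_N -> nat).
Hypothesis rho_inj : injective rho.
Local Notation R := {mpoly K[N]}.
Local Notation sgn := (sgn rho).
Implicit Types (c b : {set 'I_N} -> R) (S T : {set 'I_N}) (k l : 'I_N).

(** The chain [c] stands for the sum of the [c S] times the exterior product of
    the basis vectors indexed by [S], in the order given by [rho]. *)
Definition kd c S : R :=
  \sum_(k | k \notin S) (-1) ^+ sgn k S *: (c (k |: S) * 'X_k).

Lemma mcoeff_kd c S m :
  (kd c S)@_m = \sum_(k | k \notin S) (-1) ^+ sgn k S *
    (if m k != 0%N then (c (k |: S))@_(m - U_(k))%MM else 0).
Proof.
rewrite raddf_sum; apply: eq_bigr => k _ /=.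
by rewrite mcoeffZ mcoeffMXif lep1mP.
Qed.

Lemma eq_kd c b S : (forall k, k \notin S -> c (k |: S) = b (k |: S)) ->
  kd c S = kd b S.
Proof. by move=> h; apply: eq_bigr => k /h ->. Qed.

Lemma kd_gideal (I : R -> Prop) c S : gideal I -> (forall T, I (c T)) ->
  I (kd c S).
Proof.
move=> [I0 ID IM _] Ic; rewrite /kd; apply: (big_ind I) => // k _.
by rewrite -mul_mpolyC [c _ * _]mulrC; apply/IM/IM.
Qed.

Lemma kdB c b S : kd (fun T => c T - b T) S = kd c S - kd b S.
Proof. by rewrite -sumrB; apply: eq_bigr => k _; rewrite mulrBl scalerBr. Qed.

Lemma kdD c b S : kd (fun T => c T + b T) S = kd c S + kd b S.
Proof.
by rewrite -big_split; apply: eq_bigr => k _ /=; rewrite mulrDl scalerDr.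
Qed.

(** The two ways to remove a pair of indices come with opposite signs. *)
Lemma kd_kd c S : kd (kd c) S = 0.
Proof.
rewrite /kd.
pose F k l := (-1) ^+ sgn k S *:
  ((-1) ^+ sgn l (k |: S) *: (c (l |: (k |: S)) * 'X_l) * 'X_k) : R.
transitivity (\sum_(k | k \notin S) \sum_(l | l \notin k |: S) F k l).
  apply: eq_bigr => k _; rewrite mulr_suml scaler_sumr.
  by apply: eq_bigr => l _.
have antiF k l : k != l -> k \notin S -> l \notin S -> F k l = - F l k.
  move=> kl kS lS; rewrite /F -!scalerAl !scalerA (sgn_anti rho_inj) // scaleNr.
  by rewrite setUCA -!mulrA ['X_k * _]mulrC.
pose G k l := if [&& k \notin S, l \notin S & k != l] then F k l else 0.
transitivity (\sum_k \sum_l G k l).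
  rewrite [LHS]big_mkcond; apply: eq_bigr => k _; rewrite /G; case: ifP => kS /=.
    rewrite big_mkcond; apply: eq_bigr => l _; rewrite !inE negb_or eq_sym.
    by rewrite andbC.
  by rewrite big1.
rewrite (eq_bigr (fun k => \sum_(l : 'I_N | (l < k)%N) G k l +
                           \sum_(l : 'I_N | (k < l)%N) G k l)); last first.
  move=> k _; rewrite (bigID (fun l : 'I_N => (l < k)%N)) /=; congr (_ + _).
  rewrite (bigID (fun l => l == k)) /= big1 ?add0r; last first.
    by move=> l /andP[_ /eqP ->]; rewrite /G eqxx !andbF.
  by apply: eq_bigl => l; rewrite -leqNgt ltn_neqAle eq_sym andbC.
rewrite big_split /= [X in _ + X](exchange_big_dep xpredT) //= -big_split big1 //.
move=> k _ /=; rewrite -big_split big1 // => l lk; rewrite /G /= [l == k]eq_sym.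
case: (boolP [&& k \notin S, l \notin S & k != l]) => [/and3P[kS lS kl]|].
  by rewrite kS lS kl /= antiF // addNr.
by rewrite andbCA => /negPf ->; rewrite addr0.
Qed.

Definition mset S : 'X_{1..N} := [multinom nat_of_bool (i \in S) | i < N].

Lemma msetU1 k S : k \notin S -> mset (k |: S) = (U_(k) + mset S)%MM.
Proof.
move=> kS; apply/mnmP => i; rewrite mnmDE mnm1E !mnmE in_setU1 eq_sym.
by case: eqP => [<-|]; rewrite ?(negPf kS).
Qed.

Lemma mdeg_mset S : mdeg (mset S) = #|S|.
Proof.
by rewrite mdegE -sum1_card [RHS]big_mkcond; apply: eq_bigr => i _; rewrite mnmE.
Qed.

(** A cone vertex in each multidegree. In multidegree [a] the Koszul complex of
    the polynomial ring is the chain complex of the full simplex on the support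
    of [a], which is contracted onto the chosen vertex. *)
Definition apex (a : 'X_{1..N}) := [pick k | a k != 0%N].

Definition contr c T : R :=
  \sum_(k in T) (-1) ^+ sgn k (T :\ k) *:
    mdivX k (mrestr (fun m => apex (m + mset (T :\ k))%MM == Some k) (c (T :\ k))).

Lemma mcoeff_contr c T m :
  (contr c T)@_m = \sum_(k in T) if apex (m + mset T)%MM == Some k
    then (-1) ^+ sgn k (T :\ k) * (c (T :\ k))@_(m + U_(k))%MM else 0.
Proof.
rewrite raddf_sum; apply: eq_bigr => k kT /=.
rewrite mcoeffZ mcoeff_mdivX mcoeff_mrestr -addmA -msetU1 ?setD1K //.
  by case: ifP; rewrite ?mulr0.
by rewrite !inE eqxx.
Qed.

(** The contraction is a homotopy from the identity to zero in every multidegree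
    but zero, which has no cone vertex: there a cycle is a scalar. *)
Lemma koszul_acyclic c : (forall S, kd c S = 0) -> (c set0)@_0%MM = 0 ->
  forall S, c S = kd (contr c) S.
Proof.
move=> cyc c0 S; apply/mpolyP => m; rewrite mcoeff_kd.
case def_k: (apex (m + mset S)%MM) => [k|]; last first.
  have a0 i : (m + mset S)%MM i = 0%N.
    by move: def_k; rewrite /apex; case: pickP => // h _; apply/eqP/negbFE/h.
  have -> : S = set0.
    apply/setP => i; rewrite inE; move: (a0 i); rewrite mnmDE !mnmE.
    by case: (i \in S); rewrite // addn1.
  have -> : m = 0%MM.
    by apply/mnmP => i; move: (a0 i); rewrite mnmDE mnm0E; case: (m i).
  by rewrite c0 big1 // => i _; rewrite mnm0E eqxx mulr0.
have ak : (m + mset S)%MM k != 0%N.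
  by move: def_k; rewrite /apex; case: pickP => // i hi [<-].
have eq_apex l : l \notin S -> m l != 0%N ->
    apex (m - U_(l) + mset (l |: S))%MM = Some k.
  by move=> lS ml; rewrite msetU1 // addmA submK ?lep1mP.
have [kS|kS] := boolP (k \in S); last first.
  have mk : m k != 0%N by move: ak; rewrite mnmDE mnmE (negPf kS) addn0.
  rewrite (bigD1 k) //= mk mcoeff_contr eq_apex // (bigD1 k) ?setU11 //= eqxx.
  rewrite setU1K // submK ?lep1mP // mulrDr mulrA -expr2 sqrr_sign mul1r.
  rewrite big1 ?mulr0 ?addr0 => [|i /andP[_ ik]]; last first.
    by case: ifP => // /eqP[e]; rewrite e eqxx in ik.
  rewrite big1 ?addr0 // => l /andP[lS lk]; case: ifP => [ml|]; last by rewrite mulr0.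
  rewrite mcoeff_contr eq_apex // big1 ?mulr0 // => i.
  rewrite in_setU1 => i_lS; case: eqP => // -[def_i]; move: i_lS.
  by rewrite -def_i (negPf kS) eq_sym (negPf lk).
have kT : k \notin S :\ k by rewrite !inE eqxx.
have {cyc} := congr1 (mcoeff (m + U_(k))%MM) (cyc (S :\ k)).
rewrite mcoeff0 mcoeff_kd (bigD1 k) //= setD1K //.
rewrite mnmDE mnm1E eqxx addn1 /= addmK => /eqP; rewrite addr_eq0 => /eqP cS.
rewrite -[LHS](signrMK (sgn k (S :\ k))) cS.
rewrite mulrN mulr_sumr -sumrN; apply/esym.
apply: eq_big => [l|l lS].
  by rewrite !inE; case: (eqVneq l k) => [->|]; rewrite ?andbT ?kS ?andbF.
have lk : l != k by apply: contraNneq lS => ->.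
rewrite mnmDE mnm1E [k == l]eq_sym (negPf lk) addn0; case: ifP => ml; last first.
  by rewrite !mulr0 oppr0.
rewrite -/sgn mcoeff_contr eq_apex // (bigD1 k) ?in_setU1 ?kS ?orbT //= eqxx.
rewrite big1 ?addr0 => [|i /andP[_ ik]]; last first.
  by case: ifP => // /eqP[e]; rewrite e eqxx in ik.
have -> : (l |: S) :\ k = l |: (S :\ k).
  by apply/setP => i; rewrite !inE; case: eqP => // ->; rewrite eq_sym (negPf lk).
have lT : l \notin S :\ k by rewrite !inE negb_and lS orbT.
have -> : sgn l S = sgn l (k |: (S :\ k)) by rewrite setD1K.
rewrite (sgn_antib rho_inj _ kT lT) 1?eq_sym // !mulrA -!signr_addb -mulNr -signrN.
congr ((-1) ^+ _ * _); last first.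
  congr (_@__); apply/mnmP => i; rewrite !(mnmDE, mnmBE, mnm1E).
  by case: (eqVneq l i) ml => [<- ml|//]; rewrite ?addnBAC ?lt0n // subn0.
by case: (sgn k _); case: (sgn l _); case: sgn.
Qed.

End Koszul.

(** * Koszul homology and minimal resolutions *)

Lemma choice_fun (A B : Type) (Q : A -> B -> Prop) :
  (forall x, exists y, Q x y) -> exists f, forall x, Q x (f x).
Proof.
move=> h; exists (fun x => proj1_sig (constructive_indefinite_description _ (h x))).
by move=> x; case: constructive_indefinite_description.
Qed.

Section KoszulRows.
Local Open Scope ring_scope.
Variables (K : fieldType) (N : nat) (rho : 'I_N -> nat).
Hypothesis rho_inj : injective rho.
Local Notation R := {mpoly K[N]}.

Section Rows.
Variables (s : nat) (deg : 'I_s -> nat).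
Implicit Types (c b : {set 'I_N} -> 'rV[R]_s) (S T : {set 'I_N}).

Definition kdv c S : 'rV[R]_s := \row_i kd rho (fun T => c T 0 i) S.

Lemma kdvE c S : kdv c S =
  \sum_(k | k \notin S) ((-1) ^+ sgn rho k S *: 'X_k) *: c (k |: S).
Proof.
apply/rowP => i; rewrite mxE summxE; apply: eq_bigr => k _.
by rewrite mxE -scalerAl mulrC.
Qed.

Lemma eq_kdv c b S : (forall T, c T = b T) -> kdv c S = kdv b S.
Proof. by move=> h; rewrite !kdvE; apply: eq_bigr => k _; rewrite h. Qed.

Lemma kdvB c b S : kdv (fun T => c T - b T) S = kdv c S - kdv b S.
Proof.
apply/rowP => i; rewrite !mxE -kdB.
by apply: eq_bigr => k _; rewrite !mxE.
Qed.

Lemma kdv_kdv c S : kdv (kdv c) S = 0.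
Proof.
apply/rowP => i; rewrite !mxE -[RHS](kd_kd rho_inj (fun T => c T 0 i) S).
by apply: eq_bigr => k _; rewrite !mxE.
Qed.

Lemma kdv0 c S : (forall T, c T = 0) -> kdv c S = 0.
Proof. by move=> h; rewrite kdvE big1 // => k _; rewrite h scaler0. Qed.

Lemma mcoeff0_kdv c S i : (kdv c S 0 i)@_0%MM = 0.
Proof.
by rewrite mxE mcoeff_kd big1 // => k _; rewrite mnm0E eqxx mulr0.
Qed.

Lemma gsub_kdv (P : 'rV[R]_s -> Prop) c S : gsub deg P ->
  (forall T, P (c T)) -> P (kdv c S).
Proof.
move=> gP h; rewrite kdvE; apply: (gsub_sum gP) => k _.
by case: (gP) => _ _ PZ _; apply: PZ.
Qed.

Definition contrv c T : 'rV[R]_s := \row_i contr rho (fun T => c T 0 i) T.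

Lemma koszul_rows_acyclic c : (forall S, kdv c S = 0) ->
  (forall i, (c set0 0 i)@_0%MM = 0) -> forall S, c S = kdv (contrv c) S.
Proof.
move=> cyc c0 S; apply/rowP => i; rewrite mxE.
rewrite {1}(@koszul_acyclic _ _ _ rho_inj (fun T => c T 0 i)) //.
  by apply: eq_bigr => k _; rewrite mxE.
by move=> T; have /rowP/(_ i) := cyc T; rewrite !mxE.
Qed.

Definition chain l d c := forall S i m, (c S 0 i)@_m != 0 ->
  #|S| = l /\ (mdeg m + deg i + l)%N = d.

Lemma chain_eq0 l d c S : chain l d c -> #|S| <> l -> c S = 0.
Proof.
move=> hc hS; apply/rowP => i; rewrite mxE; apply/mpolyP => m; rewrite mcoeff0.
by apply/eqP/negP => /negP/hc[].
Qed.

Lemma chain_kdv l d c : chain l.+1 d c -> chain l d (kdv c).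
Proof.
move=> hc S i m; rewrite mxE mcoeff_kd => h.
case: (pickP (fun k => (k \notin S) && (m k != 0%N) &&
   ((c (k |: S) 0 i)@_(m - U_(k))%MM != 0))) => [k /andP[/andP[kS mk] nz]|no].
  have [] := hc _ _ _ nz; rewrite cardsU1 kS add1n => -[->] <-; split=> //.
  by rewrite -{1}(@submK _ U_(k)%MM m) ?lep1mP // mdegD mdeg1 addn1 addnS !addSn.
case/eqP: h; rewrite big1 // => k kS; move: (no k); rewrite kS /=.
by case: ifP => [_ /= /negbFE/eqP ->|]; rewrite mulr0.
Qed.

Lemma chain0_kdv d c S : chain 0 d c -> kdv c S = 0.
Proof.
move=> hc; rewrite kdvE big1 // => k kS; rewrite (chain_eq0 hc) ?scaler0 //.
by rewrite cardsU1 kS.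
Qed.

Lemma chain_contrv l d c : chain l d c -> chain l.+1 d (contrv c).
Proof.
move=> hc S i m; rewrite mxE mcoeff_contr => h.
case: (pickP (fun k => (k \in S) &&
   ((c (S :\ k) 0 i)@_(m + U_(k))%MM != 0))) => [k /andP[kS nz]|no].
  have [] := hc _ _ _ nz; rewrite mdegD mdeg1 => eS e; split.
    by rewrite (cardsD1 k) kS eS.
  by rewrite -e addn1 !addSn addnS.
case/eqP: h; rewrite big1 // => k kS; move: (no k); rewrite kS /=.
by move=> /negbFE/eqP ->; rewrite mulr0 if_same.
Qed.

(** Vanishing of the part of degree [d] of the [l]-th Koszul homology of the
    free module modulo [P], that is, of Tor_l with the residue field. *)
Definition Kvan (P : 'rV[R]_s -> Prop) l d := forall c, chain l d c ->
  (forall S, P (kdv c S)) ->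
  exists b, forall S, P (c S - kdv b S).

Lemma Kvan_ext (P Q : 'rV[R]_s -> Prop) l d : (forall u, P u <-> Q u) ->
  Kvan P l d <-> Kvan Q l d.
Proof.
move=> PQ; split=> van c hc cyc.
  have [S|b hb] := van c hc; first exact/PQ.
  by exists b => S; apply/PQ.
have [S|b hb] := van c hc; first exact/PQ.
by exists b => S; apply/PQ.
Qed.

(** In level zero every chain is a cycle and boundaries have no constant terms,
    so the homology has the basis vectors of degree [d] as a basis. *)
Lemma Kvan0 (P : 'rV[R]_s -> Prop) d : gsub deg P ->
  (forall u i, P u -> (u 0 i)@_0%MM = 0) ->
  Kvan P 0 d <-> forall a, deg a <> d.
Proof.
move=> gP Pm; have P0 : P 0 by case: gP.
split=> [van a deg_a|no c hc _]; last first.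
  exists (contrv c) => S.
  rewrite -koszul_rows_acyclic ?subrr // => [T|i].
    exact: (chain0_kdv T hc).
  apply/eqP/negP => /negP/hc[_]; rewrite mdeg0 add0n addn0; exact: no.
have [|S|b hb] := van (fun S => if S == set0 then delta_mx 0 a else 0).
- move=> S i m; case: (S =P set0) => [->|_]; rewrite !mxE; last first.
    by rewrite mcoeff0 eqxx.
  rewrite cards0 /=; case: (i =P a) => [->|_]; last by rewrite mcoeff0 eqxx.
  by rewrite mcoeff1; case: (m =P _) => [->|_]; rewrite ?eqxx // mdeg0 addn0.
- rewrite kdvE big1 // => k _; case: eqP => [e|]; last by rewrite scaler0.
  by have := setU11 k S; rewrite e inE.
have := Pm _ a (hb set0); move: (mcoeff0_kdv b set0 a).
move: (kdv b set0) => B; rewrite eqxx !mxE !eqxx mcoeffB mcoeff1 eqxx => ->.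
by rewrite subr0 => /eqP; rewrite oner_eq0.
Qed.

End Rows.

Lemma kdvM s s' (A : 'M[R]_(s', s)) (c : {set 'I_N} -> 'rV[R]_s') S :
  kdv (fun T => c T *m A) S = kdv c S *m A.
Proof.
rewrite !kdvE mulmx_suml; apply: eq_bigr => k _.
by rewrite scalemxAl.
Qed.

Section Lift.
Variables (s s' : nat) (deg : 'I_s -> nat) (deg' : 'I_s' -> nat).
Variable (A : 'M[R]_(s', s)).
Hypothesis A_hom : mhom deg' deg A.

Lemma chain_vhom t (dg : 'I_t -> nat) l d (c : {set 'I_N} -> 'rV[R]_t) S :
  (l <= d)%N -> chain dg l d c -> vhom dg (d - l) (c S).
Proof. by move=> le_ld hc i m /hc[_ <-]; rewrite addnK. Qed.

Lemma chain_gt t (dg : 'I_t -> nat) l d (c : {set 'I_N} -> 'rV[R]_t) S :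
  (d < l)%N -> chain dg l d c -> c S = 0.
Proof.
move=> lt_dl hc; apply/rowP => i; rewrite mxE; apply/mpolyP => m.
rewrite mcoeff0; apply/eqP/negP => /negP/hc[_ e].
by move: lt_dl; rewrite -e ltnNge leq_addl.
Qed.

Lemma chainM l d c : chain deg' l d c -> chain deg l d (fun S => c S *m A).
Proof.
move=> hc S i m nz; have [eS|/eqP/(chain_eq0 hc) c0] := eqVneq #|S| l; last first.
  by move: nz; rewrite c0 mul0mx mxE mcoeff0 eqxx.
split=> //; case: (leqP l d) => [le_ld|/chain_gt/(_ hc) c0]; last first.
  by move: nz; rewrite c0 mul0mx mxE mcoeff0 eqxx.
by rewrite (vhomM A_hom (chain_vhom le_ld hc) nz) subnK.
Qed.

Lemma chain_lift (P : 'rV[R]_s -> Prop) l d c : gsub deg P ->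
  chain deg l d c -> (forall S, exists w, P (c S - w *m A)) ->
  exists2 c', chain deg' l d c' & forall S, P (c S - c' S *m A).
Proof.
move=> gP hc /choice_fun[w hw].
have P0 : P 0 by case: gP.
exists (fun S : {set 'I_N} => if (#|S| == l) && (l <= d)%N then vpart deg' (d - l)%N (w S) else 0).
  move=> S i m; case: ifP => [/andP[/eqP eS le_ld]|_]; last first.
    by rewrite mxE mcoeff0 eqxx.
  by move=> /(@vpart_hom _ _ _ deg') ->; rewrite subnK.
move=> S; case: ifP => [/andP[/eqP eS le_ld]|].
  rewrite -(vpart_id (chain_vhom le_ld hc)) -(vpartM A_hom) -[- _]scaleN1r.
  case: gP => _ _ PZ Ph; rewrite scaleN1r.
  have -> : vpart deg (d - l)%N (c S) - vpart deg (d - l)%N (w S *m A) =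
            vpart deg (d - l)%N (c S - w S *m A); last by apply: Ph.
  by rewrite -[w S *m A in RHS]opprK vpartD [in RHS]vpartN opprK.
move=> /negbT; rewrite negb_and mul0mx subr0 => /orP[/eqP/(chain_eq0 hc) ->//|].
by rewrite -ltnNge => /chain_gt/(_ hc) ->.
Qed.

(** The connecting isomorphism of the long exact sequence of Koszul homology:
    the free module in the middle is acyclic. *)
Lemma Kvan_shift l d : (forall (u : 'rV[R]_s') i, ((u *m A) 0 i)@_0%MM = 0) ->
  Kvan deg (fun u => exists w, u = w *m A) l.+1 d <->
  Kvan deg' (fun u => u *m A = 0) l d.
Proof.
move=> im0; have gi := gsub_im A_hom; have gk := gsub_ker A_hom.
split=> van c hc cyc.
  have zc := chainM hc.
  have z_acyclic S : c S *m A = kdv (contrv (fun S => c S *m A)) S.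
    by apply: koszul_rows_acyclic => // T; rewrite kdvM.
  have [S|b /choice_fun[g hg]] := van _ (chain_contrv zc).
    by rewrite -z_acyclic; exists (c S).
  exists g => S; rewrite mulmxBl z_acyclic -kdvM -kdvB.
  rewrite (@eq_kdv _ _ (kdv b)) ?kdv_kdv // => T.
  by rewrite -hg opprB addrCA subrr addr0.
have g0 : gsub deg (fun u : 'rV[R]_s => u = 0).
  split=> //.
  - by move=> u v -> ->; rewrite addr0.
  - by move=> f u ->; rewrite scaler0.
  - move=> e u ->; apply/rowP => i; rewrite !mxE; apply/mpolyP => m.
    by rewrite mcoeff_mrestr mcoeff0 if_same.
have [S|c' hc' ec] := chain_lift g0 (chain_kdv hc).
  by have [w ->] := cyc S; exists w; rewrite subrr.
have {}ec S : kdv c S = c' S *m A by apply/eqP; rewrite -subr_eq0 ec.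
have [S|b hb] := van _ hc'.
  by rewrite -kdvM -(kdv_kdv c S); apply: eq_kdv => T; rewrite ec.
pose b1 S := if S == set0 then 0 else b S.
have kb1 S : kdv b1 S = kdv b S.
  rewrite !kdvE; apply: eq_bigr => k _; rewrite /b1; case: eqP => // e.
  by have := setU11 k S; rewrite e inE.
pose x S := c S - b1 S *m A.
have x_acyclic S : x S = kdv (contrv x) S.
  apply: koszul_rows_acyclic => [T|i].
    rewrite kdvB kdvM kb1 ec -mulmxBl; exact: hb.
  by rewrite /x /b1 eqxx mul0mx subr0 (chain_eq0 hc) ?cards0 // mxE mcoeff0.
exists (contrv x) => S; exists (b1 S).
by rewrite -x_acyclic /x opprB addrCA subrr addr0.
Qed.

(** Koszul homology of a quotient module does not depend on its presentation. *)
Lemma Kvan_cover (P : 'rV[R]_s -> Prop) (Q : 'rV[R]_s' -> Prop) l d :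
  gsub deg P -> (forall u, exists w, P (u - w *m A)) ->
  (forall w, P (w *m A) <-> Q w) ->
  Kvan deg P l d <-> Kvan deg' Q l d.
Proof.
move=> gP surj hQ; split=> van c hc cyc.
  have [S|b hb] := van _ (chainM hc); first by rewrite kdvM; apply/hQ.
  have [w hw] := choice_fun (fun S => surj (b S)).
  exists w => S; apply/hQ; rewrite mulmxBl -kdvM.
  rewrite -(subrK (kdv b S) (c S *m A)) -addrA -kdvB.
  by case: (gP) => _ PD _ _; apply: PD => //; apply: (gsub_kdv _ gP).
have [c' hc' ec] := chain_lift gP hc (fun S => surj (c S)).
have [S|b hb] := van _ hc'.
  apply/hQ; rewrite -kdvM -(subKr (kdv c S) (kdv _ S)) -kdvB.
  by apply: (gsubB gP) => //; apply: (gsub_kdv _ gP).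
exists (fun S => b S *m A) => S.
rewrite -(subrK (c' S *m A) (c S)) -addrA kdvM -mulmxBl.
by case: (gP) => _ PD _ _; apply: PD => //; apply/hQ.
Qed.

End Lift.

Definition KvanI (I : R -> Prop) l d :=
  Kvan (fun _ : 'I_1 => 0%N) (fun u => I (u 0 0)) l d.

Lemma dif_hom (I : R -> Prop) F i : min_graded_free_res I F ->
  mhom (gdeg (i := i.+1)) (gdeg (i := i)) (dif F i).
Proof. by case=> [[_ h] _ _] a b m; rewrite -mcoeff_msupp => /h. Qed.

Lemma aug_hom (I : R -> Prop) F : min_graded_free_res I F ->
  mhom (gdeg (i := 0)) (fun _ => 0%N) (aug F).
Proof.
case=> [[h _] _ _] a b m; rewrite (ord1 b) addn0 -mcoeff_msupp.
by have /dhomogP := h a; apply.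
Qed.

Lemma dif_im0 (I : R -> Prop) F i : min_graded_free_res I F ->
  forall (u : 'rV[R]_(rk F i.+1)) b, ((u *m dif F i) 0 b)@_0%MM = 0.
Proof.
case=> _ _ h u b; rewrite mxE raddf_sum big1 // => a _ /=.
by rewrite rmorphM /= h mulr0.
Qed.

Lemma Kvan_dif (I : R -> Prop) F i l d : min_graded_free_res I F ->
  Kvan (gdeg (i := i)) (fun u => exists w, u = w *m dif F i) l.+1 d <->
  Kvan (gdeg (i := i.+1)) (fun u => exists w, u = w *m dif F i.+1) l d.
Proof.
move=> hF; case: (hF) => _ [_ _ ex] _.
refine (iff_trans (Kvan_shift (dif_hom (i := i) hF) l d (dif_im0 hF)) _).
by apply: Kvan_ext => u; apply: ex.
Qed.

(** The basis vectors of degree [j] in the [i]-th module of a minimal resolution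
    are seen by Tor_i with the residue field, computed with the Koszul complex. *)
Theorem minres_Koszul (I : R -> Prop) F i j : gideal I ->
  min_graded_free_res I F -> KvanI I i j <-> forall a : 'I_(rk F i), gdeg a <> j.
Proof.
move=> gI hF; case: (hF) => [_ [aug_surj aug_ker _] _].
have aug_mhom := aug_hom hF.
have main k l : Kvan (gdeg (i := k)) (fun u => exists w, u = w *m dif F k) l j <->
    forall a : 'I_(rk F (k + l)), gdeg a <> j.
  elim: l k => [|l IHl] k.
    rewrite addn0; apply: Kvan0; first exact: (gsub_im (dif_hom hF)).
    by move=> _ i0 [w ->]; apply: (dif_im0 hF).
  by apply: iff_trans (Kvan_dif _ _ _ hF) _; rewrite addnS -addSn; apply: IHl.
apply: iff_trans (main 0%N i).
refine (Kvan_cover aug_mhom i j (gideal_gsub gI) _ aug_ker).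
move=> u; have [w hw] := aug_surj (u 0 0); exists w.
by rewrite !mxE in hw *.
Qed.

End KoszulRows.

(** * Existence of minimal graded free resolutions *)

Lemma nat_min (P : nat -> Prop) : (exists n, P n) ->
  exists2 n, P n & forall k, P k -> (n <= k)%N.
Proof.
move=> [n]; elim/ltn_ind: n => n IHn Pn.
case: (classic (exists2 k, P k & (k < n)%N)) => [[k Pk /IHn]|no]; first exact.
by exists n => // k Pk; rewrite leqNgt; apply/negP => lt_kn; apply: no; exists k.
Qed.

Section Dickson.

Definition increasing (g : nat -> nat) := {homo g : i j / (i < j)%N}.

Lemma nat_mono_subseq (f : nat -> nat) :
  exists2 g, increasing g & {homo f \o g : i j / (i <= j)%N}.
Proof.
have /choice_fun[a ha] n : exists m,
    (n <= m)%N /\ forall k, (n <= k)%N -> (f m <= f k)%N.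
  have [|_ [m le_nm ->] hm] := @nat_min (fun v => exists2 m, (n <= m)%N & v = f m).
    by exists (f n), n.
  by exists m; split=> // k le_nk; apply: hm; exists k.
pose g := fix g n := if n is n'.+1 then a (g n').+1 else a 0%N.
have g_step n : (g n < g n.+1)%N by case: (ha (g n).+1).
exists g; first exact: homo_ltn (@ltn_trans) g_step.
apply: homo_leq => [//|? ? ?|[|n]]; [exact: leq_trans| |] => /=.
  by case: (ha 0%N) => _; apply.
case: (ha (g n).+1) => _; apply.
by apply: (leq_trans (g_step n)); case: (ha (a (g n).+1).+1) => /ltnW.
Qed.

(** Dickson's lemma, in the form that componentwise order on monomials is a well
    quasi-order; one subsequence is extracted for each variable. *)
Lemma dickson N (f : nat -> 'X_{1..N}) :
  exists i j, (i < j)%N /\ (f i <= f j)%MM.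
Proof.
have main k : exists2 g, increasing g &
    forall l : 'I_N, (l < k)%N -> {homo (fun n => f (g n) l) : i j / (i <= j)%N}.
  elim: k => [|k [g g_inc g_mono]]; first by exists id.
  case: (ltnP k N) => [lt_kN|le_Nk]; last first.
    by exists g => // l _; apply/g_mono/(leq_trans (ltn_ord l)).
  have [h h_inc h_mono] := nat_mono_subseq (fun n => f (g n) (Ordinal lt_kN)).
  exists (g \o h) => [i j lt_ij|l]; first exact/g_inc/h_inc.
  rewrite ltnS leq_eqVlt => /predU1P[e|lt_lk].
    have -> : l = Ordinal lt_kN by apply/val_inj.
    exact: h_mono.
  by move=> i j le_ij; apply: g_mono => //; apply: (ltnW_homo h_inc).
have [g g_inc g_mono] := main N.
exists (g 0%N), (g 1%N); split; first exact: g_inc.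
by apply/mnm_lepP => l; apply: (g_mono l (ltn_ord l) 0%N 1%N).
Qed.

End Dickson.

Section HilbertBasis.
Local Open Scope ring_scope.
Variables (K : fieldType) (N : nat).
Local Notation R := {mpoly K[N]}.

Definition rspan s (gs : seq 'rV[R]_s) (u : 'rV[R]_s) :=
  exists2 t : seq (R * 'rV[R]_s), (forall p, p \in t -> p.2 \in gs) &
    u = \sum_(p <- t) p.1 *: p.2.

Definition submod s (P : 'rV[R]_s -> Prop) :=
  [/\ P 0, forall u v, P u -> P v -> P (u + v) & forall f u, P u -> P (f *: u)].

Lemma rspan_submod s (gs : seq 'rV[R]_s) : submod (rspan gs).
Proof.
split=> [|_ _ [t ht ->] [t' ht' ->]|f _ [t ht ->]].
- by exists [::]; rewrite ?big_nil.
- exists (t ++ t'); rewrite ?big_cat // => p.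
  by rewrite mem_cat => /orP[/ht|/ht'].
exists [seq (f * x.1, x.2) | x <- t] => [_ /mapP[p /ht hp ->]//|].
by rewrite big_map scaler_sumr; apply: eq_bigr => p _; rewrite scalerA.
Qed.

Lemma im_submod s k (A : 'M[R]_(k, s)) : submod (fun u => exists w, u = w *m A).
Proof.
split=> [|_ _ [w ->] [w' ->]|f _ [w ->]]; first by exists 0; rewrite mul0mx.
  by exists (w + w'); rewrite mulmxDl.
by exists (f *: w); rewrite scalemxAl.
Qed.

Lemma rspan_mem s (gs : seq 'rV[R]_s) g : g \in gs -> rspan gs g.
Proof.
move=> gs_g; exists [:: (1, g)]; last by rewrite big_seq1 scale1r.
by move=> p; rewrite inE => /eqP ->.
Qed.

Lemma rspan_sub s (gs : seq 'rV[R]_s) (P : 'rV[R]_s -> Prop) u : submod P ->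
  (forall g, g \in gs -> P g) -> rspan gs u -> P u.
Proof.
move=> [P0 PD PZ] hgs [t ht ->]; rewrite big_seq; apply: (big_ind P) => //.
by move=> p /ht/hgs; apply: PZ.
Qed.

Definition finitely_generated s (P : 'rV[R]_s -> Prop) :=
  exists2 gs : seq 'rV[R]_s, (forall g, g \in gs -> P g) &
    forall u, P u -> rspan gs u.

Lemma mlead_minimal (Q : R -> Prop) : (exists f, Q f) ->
  exists2 f, Q f & forall g, Q g -> ~~ (mlead g < mlead f)%O.
Proof.
move=> [f]; move: {2}(mlead f) (erefl (mlead f)) => m; elim/(@ltmwf N): m f => m IHm f def_m Qf.
case: (classic (exists2 g, Q g & (mlead g < mlead f)%O)) => [[g Qg lt_gf]|no].
  by apply: (IHm (mlead g)) Qg => //; rewrite -def_m.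
by exists f => // g Qg; apply/negP => lt_gf; apply: no; exists g.
Qed.

Lemma mlead_reduce (f g : R) : f != 0 -> (mlead f <= mlead g)%MM ->
  let h := g - (mleadc g / mleadc f) *: 'X_[mlead g - mlead f] * f in
  h = 0 \/ (mlead h < mlead g)%O.
Proof.
move=> nz_f le_fg h; have [->|nz_h] := eqVneq h 0; [by left|right].
have cf : mleadc f != 0 by rewrite mleadc_eq0.
have coef m : h@_m = g@_m - mleadc g / mleadc f *
    (if (mlead g - mlead f <= m)%MM then f@_(m - (mlead g - mlead f))%MM else 0).
  by rewrite mcoeffB -scalerAl mcoeffZ ['X_[_] * _]mulrC mcoeffMXif.
have := mlead_supp nz_h; rewrite mcoeff_msupp => nz.
rewrite Order.POrderTheory.lt_neqAle; apply/andP; split.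
  apply: contraNneq nz => ->; rewrite coef lem_subr.
  rewrite submBA ?lepm_refl // addmC addmK.
  by rewrite divfK // subrr.
rewrite Order.TotalTheory.leNgt; apply/negP => lt_gh.
case/eqP: nz; rewrite coef (mcoeff_gt_mlead lt_gh) sub0r.
case: ifP => [le_m|]; last by rewrite mulr0 oppr0.
rewrite [X in _ * X]mcoeff_gt_mlead ?mulr0 ?oppr0 //.
by rewrite -(ltmc_add2l _ _ (mlead g - mlead f)%MM) submK // addmC submK.
Qed.

(** Hilbert's basis theorem. If an ideal were not finitely generated, elements
    with the smallest possible leading monomial outside the span of the previous
    ones could be chosen forever; by Dickson's lemma one of these leading
    monomials divides a later one, whose element could then be reduced. *)
Lemma ideal_fg (P : 'rV[R]_1 -> Prop) : submod P -> finitely_generated P.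
Proof.
move=> subP; have [P0 PD PZ] := subP; apply: NNPP => not_fg.
have /choice_fun[nxt hnxt] (gs : seq 'rV[R]_1) : exists f0,
    (forall g, g \in gs -> P g) ->
    [/\ P f0%:M, ~ rspan gs f0%:M &
        forall f, P f%:M -> ~ rspan gs f%:M -> ~~ (mlead f < mlead f0)%O].
  case: (classic (forall g, g \in gs -> P g)) => [hgs|no]; last by exists 0.
  have [|f [Pf nf] fmin] := @mlead_minimal (fun f => P f%:M /\ ~ rspan gs f%:M).
    apply: NNPP => no; apply: not_fg; exists gs => // u Pu; apply: NNPP => nu.
    by apply: no; exists (u 0 0); rewrite -mx11_scalar.
  by exists f => _; split=> // g Pg ng; apply: fmin.
pose gs := fix gs n : seq 'rV[R]_1 :=
  if n is n'.+1 then rcons (gs n') (nxt (gs n'))%:M else [::].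
pose f n := nxt (gs n).
have Pgs n : forall g, g \in gs n -> P g.
  elim: n => //= n IHn g; rewrite mem_rcons inE => /predU1P[->|/IHn//].
  by case: (hnxt _ IHn).
have f_gs i j : (i < j)%N -> (f i)%:M \in gs j.
  elim: j => //= j IHj; rewrite ltnS leq_eqVlt mem_rcons inE.
  by case/predU1P=> [->|/IHj ->]; rewrite ?eqxx ?orbT.
have [i [j [lt_ij le_ij]]] := dickson (fun n => mlead (f n)).
have [Pj nj minj] := hnxt _ (Pgs j).
have [Pi ni _] := hnxt _ (Pgs i).
have [s0 sD sZ] := rspan_submod (gs j).
have nz_fi : f i != 0.
  apply/eqP => e; apply: ni; rewrite -/(f i) e raddf0.
  by case: (rspan_submod (gs i)).
have := mlead_reduce nz_fi le_ij.
set c := _ *: 'X_[_]; move=> red.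
have split_fj : (f j)%:M = (f j - c * f i)%:M + c *: (f i)%:M :> 'rV[R]_1.
  by rewrite scale_scalar_mx -raddfD subrK.
have nh : ~ rspan (gs j) (f j - c * f i)%:M.
  move=> sh; apply: nj; rewrite -/(f j) split_fj; apply: sD => //.
  by apply/sZ/rspan_mem/f_gs.
have Ph : P (f j - c * f i)%:M.
  have -> : (f j - c * f i)%:M = (f j)%:M + (- c) *: (f i)%:M :> 'rV[R]_1.
    by rewrite scale_scalar_mx -raddfD mulNr.
  by apply: PD => //; apply: PZ.
case: red => [e|lt_h]; first by apply: nh; rewrite e raddf0.
by have := minj _ Ph nh; rewrite -/(f j) lt_h.
Qed.

(** By induction on the rank: the first coordinates form an ideal, and the
    elements with first coordinate zero a submodule of smaller rank. *)
Lemma submod_fg s (P : 'rV[R]_s -> Prop) : submod P -> finitely_generated P.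
Proof.
elim: s P => [|s IHs] P [P0 PD PZ].
  by exists [::] => // u _; rewrite [u]thinmx0; case: (rspan_submod (@nil 'rV[R]_0)).
pose I (f : 'rV[R]_1) := exists2 u, P u & f 0 0 = u 0 0.
have [|fs fsI fs_span] := @ideal_fg I.
  split=> [|f g [u Pu ef] [v Pv eg]|a f [u Pu ef]].
  - by exists 0; rewrite ?mxE.
  - by exists (u + v); [apply: PD|rewrite !mxE ef eg].
  - by exists (a *: u); [apply: PZ|rewrite !mxE ef].
pose Q (v : 'rV[R]_s) := P (row_mx (0 : 'rV_1) v).
have [|vs vsQ vs_span] := IHs Q.
  split=> [|v w Qv Qw|a v Qv]; first by rewrite /Q row_mx0.
  - by rewrite /Q -[0]addr0 -add_row_mx; apply: PD.
  - by rewrite /Q -(scaler0 _ a) -scale_row_mx; apply: PZ.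
have /choice_fun[L hL] (f : 'rV[R]_1) : exists g : 'rV[R]_s.+1, f \in fs ->
    P g /\ f 0 0 = g 0 0.
  case: (boolP (f \in fs)) => [/fsI[u Pu e]|_].
    by exists u.
  by exists 0.
pose gs := [seq L f | f <- fs] ++ [seq (row_mx (0 : 'rV_1) v : 'rV[R]_s.+1) | v <- vs].
have [s0 sD sZ] := rspan_submod gs.
exists gs => [g|u Pu].
  rewrite mem_cat => /orP[/mapP[f /hL[Pf _] ->]//|/mapP[v /vsQ Qv ->]//].
have [|t ht et] := fs_span (u 0 0)%:M; first by exists u => //; rewrite mxE.
pose w := \sum_(p <- t) p.1 *: L p.2.
have w_span : rspan gs w.
  rewrite /w big_seq; apply: (big_ind (rspan gs)) => // p /ht p_fs.
  by apply/sZ/rspan_mem; rewrite mem_cat map_f.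
have Pw : P w.
  rewrite /w big_seq; apply: (big_ind P) => // p /ht/hL[PL _]; exact: PZ.
have uw0 : lsubmx (u - w : 'rV[R]_(1 + s)) = 0.
  apply/rowP => i; rewrite (ord1 i) !mxE /=.
  have -> : lshift s (0 : 'I_1) = 0 by apply/val_inj.
  have /rowP/(_ 0) := et; rewrite mxE eqxx mulr1n => ->.
  rewrite /w !summxE -sumrB big_seq big1 // => p /ht/hL[_ e].
  by rewrite !mxE e subrr.
pose v : 'rV[R]_s := rsubmx (u - w : 'rV[R]_(1 + s)).
have uw : u - w = row_mx (0 : 'rV_1) v.
  by rewrite -uw0 (hsubmxK (u - w : 'rV[R]_(1 + s))).
have /vs_span : Q v.
  by rewrite /Q -uw -scaleN1r; apply: PD => //; apply: PZ.
case=> t' ht' ev.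
have -> : u = w + (u - w) by rewrite addrC subrK.
apply: (sD) => //; rewrite uw ev.
have -> : row_mx (0 : 'rV_1) (\sum_(p <- t') p.1 *: p.2) =
    \sum_(p <- t') p.1 *: (row_mx (0 : 'rV_1) p.2 : 'rV[R]_s.+1).
  have rZ a (x : 'rV[R]_s) :
      a *: (row_mx (0 : 'rV_1) x : 'rV[R]_s.+1) = row_mx (0 : 'rV_1) (a *: x).
    by have := scale_row_mx a (0 : 'M[R]_(1, 1)) x; rewrite scaler0.
  elim: (t') => [|p r IHr]; first by rewrite !big_nil row_mx0.
  by rewrite !big_cons -IHr rZ -[in LHS](addr0 (0 : 'rV[R]_1)) -add_row_mx.
rewrite big_seq; apply: (big_ind (rspan gs)) => [|x y|p /ht' p_vs].
- exact: s0.
- exact: sD.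
by apply/sZ/rspan_mem; rewrite mem_cat map_f ?orbT.
Qed.

(** Homogeneous generators, as the rows of a matrix. *)
Definition hom_generators s (deg : 'I_s -> nat) (P : 'rV[R]_s -> Prop) k
    (deg' : 'I_k -> nat) (A : 'M[R]_(k, s)) :=
  mhom deg' deg A /\ forall u, P u <-> exists w, u = w *m A.

Lemma vpart_sum s (deg : 'I_s -> nat) (u : 'rV[R]_s) :
  exists D, u = \sum_(d < D) vpart deg d u.
Proof.
exists (\max_(b < s) (msize (u 0%R b) + deg b))%N; apply/rowP => b.
rewrite summxE; apply/mpolyP => m; rewrite raddf_sum /=.
have [u0|nz] := eqVneq (u 0 b)@_m 0.
  by rewrite u0 big1 // => d _; rewrite mcoeff_vpart u0 if_same.
have lt_D : (mdeg m + deg b < \max_(c < s) (msize (u 0%R c) + deg c))%N.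
  apply: (leq_trans _ (leq_bigmax b)); rewrite ltn_add2r.
  by apply: msize_mdeg_lt; rewrite mcoeff_msupp.
rewrite (bigD1 (Ordinal lt_D)) //= mcoeff_vpart eqxx big1 ?addr0 // => d.
by rewrite mcoeff_vpart -val_eqE /= eq_sym => /negPf ->.
Qed.

(** The homogeneous parts of finitely many generators are generators too. *)
Lemma hom_generators_exist s (deg : 'I_s -> nat) (P : 'rV[R]_s -> Prop) :
  gsub deg P -> exists k deg' A, @hom_generators s deg P k deg' A.
Proof.
move=> gP; have [P0 PD PZ Ph] := gP.
have [|gs gsP gs_span] := @submod_fg s P; first by split.
have /choice_fun[D hD] := vpart_sum deg.
pose ds := [seq (vpart deg d g, d) | g <- gs, d <- iota 0 (D g)].
have ds_hom i : (i < size ds)%N ->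
    vhom deg (nth (0, 0%N) ds i).2 (nth (0, 0%N) ds i).1.
  move/(mem_nth (0, 0%N)) => /allpairsPdep[g [d [_ _ ->]]]; exact: vpart_hom.
pose A : 'M[R]_(size ds, s) := \matrix_(i, j) (nth (0, 0%N) ds i).1 0 j.
exists (size ds), (fun i => (nth (0, 0%N) ds i).2), A; split.
  by move=> a b m; rewrite mxE; apply: ds_hom.
have rowA i : row i A = (nth (0, 0%N) ds i).1 by apply/rowP => j; rewrite !mxE.
have A_rows u : (exists w, u = w *m A) <-> exists w : 'I_(size ds) -> R,
    u = \sum_i w i *: row i A.
  split=> [[w ->]|[w ->]]; first by exists (fun i => w 0 i); rewrite mulmx_sum_row.
  by exists (\row_i w i); rewrite mulmx_sum_row; apply: eq_bigr => i _; rewrite mxE.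
move=> u; split=> [/gs_span|/A_rows[w ->]]; last first.
  apply: (gsub_sum gP) => i _; apply: PZ; rewrite rowA.
  have /(mem_nth (0, 0%N)) := ltn_ord i.
  by move=> /allpairsPdep[g [d [/gsP Pg _ ->]]]; apply: Ph.
apply: (rspan_sub (im_submod A)) => g gs_g.
have [im0 imD _] := im_submod A.
rewrite (hD g).
apply: (big_ind (fun x => exists w, x = w *m A)) => [|x y|d _].
- exact: im0.
- exact: imD.
have ds_d : (vpart deg d g, val d) \in ds.
  by apply/allpairsPdep; exists g, (val d); rewrite mem_iota add0n ltn_ord.
have lt_i : (index (vpart deg d g, val d) ds < size ds)%N by rewrite index_mem.
exists (delta_mx 0 (Ordinal lt_i)).
by rewrite -rowE rowA /= nth_index.
Qed.

(** A smallest system of homogeneous generators has only relations without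
    constant terms: a relation in which a generator has a nonzero constant
    coefficient has a homogeneous part that expresses this generator by the
    others. *)
Lemma min_generators s (deg : 'I_s -> nat) (P : 'rV[R]_s -> Prop) : gsub deg P ->
  exists k deg' A, @hom_generators s deg P k deg' A /\
    forall u : 'rV[R]_k, u *m A = 0 -> forall a, (u 0 a)@_0%MM = 0.
Proof.
move=> gP; have [k [deg' [A hA]] kmin] := nat_min (hom_generators_exist gP).
exists k, deg', A; split=> // u uA a; apply/eqP/negPn/negP => nz.
have [A_hom A_gen] := hA.
case: k => [|k] in deg' A hA kmin u uA a nz A_hom A_gen *; first by case: a nz.
have [v vA va] : exists2 v : 'rV[R]_k.+1, v *m A = 0 & v 0 a = ((u 0 a)@_0%MM)%:MP.
  exists (vpart deg' (deg' a) u).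
    by have [_ _ _] := gsub_ker A_hom; exact.
  apply/mpolyP => m; rewrite mcoeff_vpart mcoeffC -[X in _ == X]add0n eqn_add2r.
  by rewrite mdeg_eq0; case: eqP => [->|]; rewrite ?mulr1 ?mulr0.
suff: (k.+1 <= k)%N by rewrite ltnn.
apply: kmin; exists (fun i => deg' (lift a i)), (row' a A); split.
  by move=> i b m; rewrite mxE => /A_hom.
have drop_a (y : 'rV[R]_k.+1) : y 0 a = 0 -> y *m A = col' a y *m row' a A.
  move=> ya; apply/rowP => b; rewrite !mxE (bigD1_ord a) //= ya mul0r add0r.
  by apply: eq_bigr => i _; rewrite !mxE.
move=> w; split=> [/A_gen[x ->]|[x ->]]; last first.
  apply/A_gen; exists (\row_j if unlift a j is Some i then x 0 i else 0).
  rewrite drop_a ?mxE ?unlift_none //; congr (_ *m _); apply/rowP => i.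
  by rewrite !mxE liftK.
pose c : R := ((u 0 a)@_0%MM)^-1%:MP.
exists (col' a (x - (x 0 a * c) *: v)); rewrite -drop_a.
  by rewrite mulmxBl -scalemxAl vA scaler0 subr0.
by rewrite !mxE va -mulrA -mpolyCM mulVf // mpolyC1 mulr1 subrr.
Qed.

(** ** Assembling the resolution *)

(** One stage of the construction: generators of degrees [st_deg] for the last
    free module, and the graded submodule of it that is still to be resolved. *)
Record stage := Stage {
  st_rk : nat;
  st_deg : 'I_st_rk -> nat;
  st_mod : 'rV[R]_st_rk -> Prop;
  st_gsub : gsub st_deg st_mod;
  st_min : forall u a, st_mod u -> (u 0 a)@_0%MM = 0
}.

Lemma next_stage (x : stage) : exists (y : stage) (A : 'M[R]_(st_rk y, st_rk x)),
  hom_generators (@st_deg x) (@st_mod x) (@st_deg y) A /\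
  forall u, st_mod u <-> u *m A = 0.
Proof.
have [k [deg' [A [gA minA]]]] := min_generators (@st_gsub x).
by exists (Stage (gsub_ker (proj1 gA)) (fun u a uA => minA u uA a)), A.
Qed.

Theorem min_graded_free_res_exists (I : R -> Prop) : gideal I ->
  (forall f, I f -> f@_0%MM = 0) -> exists F, min_graded_free_res I F.
Proof.
move=> gI I0.
pose nx x := constructive_indefinite_description _ (next_stage x).
pose nxt x := proj1_sig (nx x).
pose nA x := constructive_indefinite_description _ (proj2_sig (nx x)).
have I0' (u : 'rV[R]_1) a : I (u 0 0) -> (u 0 a)@_0%MM = 0.
  by rewrite (ord1 a); apply: I0.
pose x0 := Stage (gideal_gsub gI) I0'.
pose st := fix st i := if i is i'.+1 then nxt (st i') else x0.
pose F := @FreeComplex K N (fun i => st_rk (st i)) (fun i => @st_deg (st i))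
  1%:M (fun i => proj1_sig (nA (st i))).
have gen i : hom_generators (@st_deg (st i)) (@st_mod (st i))
    (@st_deg (st i.+1)) (dif F i) by case: (proj2_sig (nA (st i))).
have ker i (u : 'rV[R]_(rk F i.+1)) : @st_mod (st i.+1) u <-> u *m dif F i = 0.
  by case: (proj2_sig (nA (st i))).
exists F; split; first split.
- move=> a; apply/dhomogP => m; rewrite (ord1 a) mxE eqxx msupp1 inE => /eqP ->.
  exact: mdeg0.
- by move=> i a b m; rewrite mcoeff_msupp; apply: (proj1 (gen i)).
- split=> [f|u|i u].
  + by exists f%:M; rewrite mulmx1 mxE eqxx subrr; case: (gI).
  + by rewrite mulmx1; apply: (proj2 (gen 0%N)).
  by rewrite -ker; apply: (proj2 (gen i.+1)).
move=> i a b; have := @st_min (st i) (row a (dif F i)) b; rewrite mxE; apply.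
by apply/(proj2 (gen i)); exists (delta_mx 0 a); rewrite rowE.
Qed.

End HilbertBasis.

(** * Leading monomials *)

Section LexOrder.
Variable N : nat.
Implicit Types m : 'X_{1..N}.

Lemma lex_ltP m1 m2 : reflect
  (exists2 i : 'I_N, (m1 i < m2 i)%N & forall j : 'I_N, (j < i)%N -> m1 j = m2 j)
  (lex_lt m1 m2).
Proof.
apply: (iffP existsP) => [[i /andP[lt_i /forallP h]]|[i lt_i h]]; exists i => //.
  by move=> j lt_ji; apply/eqP/(implyP (h j)).
by rewrite lt_i; apply/forallP => j; apply/implyP => /h ->.
Qed.

Lemma lex_lt_irr m : lex_lt m m = false.
Proof. by apply/lex_ltP => -[i]; rewrite ltnn. Qed.

Lemma lex_lt_trans : transitive (@lex_lt N).
Proof.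
move=> m2 m1 m3 /lex_ltP[i lt_i hi] /lex_ltP[j lt_j hj]; apply/lex_ltP.
case: (ltngtP i j) => [lt_ij|lt_ji|/val_inj e].
- exists i => [|k lt_ki]; first by rewrite -hj.
  by rewrite hi // hj // (ltn_trans lt_ki).
- exists j => [|k lt_kj]; first by rewrite hi.
  by rewrite hi ?hj // (ltn_trans lt_kj).
by rewrite -e in lt_j hj; exists i => [|k lt_k]; [apply: ltn_trans lt_j|rewrite hi ?hj].
Qed.

Lemma lex_lt_total m1 m2 : m1 != m2 -> lex_lt m1 m2 || lex_lt m2 m1.
Proof.
move=> ne; have [i0 hi0] : exists i, m1 i != m2 i.
  apply/existsP; apply: contraR ne; rewrite negb_exists => /forallP h.
  by apply/eqP/mnmP => i; apply/eqP/negbNE.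
case: (@arg_minnP _ i0 (fun i => m1 i != m2 i) (fun i : 'I_N => val i) hi0) => i hi imin.
have before (j : 'I_N) : (j < i)%N -> m1 j = m2 j.
  by move=> lt_ji; apply/eqP; apply: contraLR lt_ji => /imin; rewrite -leqNgt.
case: (ltngtP (m1 i) (m2 i)) hi => // lt_i _; apply/orP.
  by left; apply/lex_ltP; exists i.
by right; apply/lex_ltP; exists i => // j /before.
Qed.

Lemma lex_lt_add m m1 m2 : lex_lt (m + m1)%MM (m + m2)%MM = lex_lt m1 m2.
Proof.
apply/lex_ltP/lex_ltP=> -[i lt_i h]; exists i => [|j /h].
- by move: lt_i; rewrite !mnmDE ltn_add2l.
- by rewrite !mnmDE => /addnI.
- by rewrite !mnmDE ltn_add2l.
by rewrite !mnmDE => ->.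
Qed.

Lemma lex_max (r : seq 'X_{1..N}) m0 : m0 \in r ->
  exists2 m, m \in r & {in r, forall m', m' != m -> lex_lt m' m}.
Proof.
elim: r m0 => // m r IHr _ _.
case: (altP (r =P [::])) => [->|]; first by exists m; rewrite ?mem_head // => m';
  rewrite inE => /eqP ->; rewrite eqxx.
case: r IHr => // m0 r IHr _; have [m1 m1_r hm1] := IHr m0 (mem_head _ _).
have [e|ne] := eqVneq m m1.
  exists m => [|m']; first exact: mem_head.
  by rewrite inE => /predU1P[->|/hm1]; rewrite ?eqxx // e.
case/orP: (lex_lt_total ne) => lt_m.
  exists m1 => [|m']; first by rewrite inE m1_r orbT.
  by rewrite inE => /predU1P[->|/hm1].
exists m => [|m']; first exact: mem_head.
rewrite inE => /predU1P[->|m'_r]; first by rewrite eqxx.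
by case: (eqVneq m' m1) => [->//|/(hm1 _ m'_r) lt_m' _]; apply: lex_lt_trans lt_m.
Qed.

(** The position of a monomial among those of degree less than [B]; it turns
    induction on the lexicographic order into induction on natural numbers. *)
Definition lexrank B m := #|[set x : 'X_{1..N < B} | lex_lt x m]|.

Lemma lexrank_lt B m1 m2 : (mdeg m1 < B)%N -> lex_lt m1 m2 ->
  (lexrank B m1 < lexrank B m2)%N.
Proof.
move=> lt_m1B lt_m; apply/proper_card/properP; split.
  by apply/subsetP => x; rewrite !inE => /lex_lt_trans; apply.
by exists (BMultinom lt_m1B); rewrite !inE // lex_lt_irr.
Qed.

End LexOrder.

Section LeadSets.
Local Open Scope ring_scope.
Variables (K : fieldType) (N : nat).
Local Notation R := {mpoly K[N]}.

Lemma lex_lead_exists (f : R) : f != 0 -> exists m, lex_lead f m.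
Proof.
rewrite -msupp_eq0; case def_r: (msupp f) => [//|m0 r] _.
have [|m m_f hm] := @lex_max N (msupp f) m0; first by rewrite def_r mem_head.
by exists m.
Qed.

(** The witnesses are asked to be homogeneous so that division by [I] stays
    within one degree. *)
Definition lead_set (I : R -> Prop) (L : pred 'X_{1..N}) :=
  (forall f m, I f -> lex_lead f m -> L m) /\
  (forall m, L m -> exists f, [/\ I f, lex_lead f m & f \is (mdeg m).-homog]).

(** Division by an ideal: every homogeneous polynomial is congruent to one
    without monomials in [L]. *)
Lemma lead_division (I : R -> Prop) L d (f : R) :
  gideal I -> lead_set I L -> f \is d.-homog ->
  exists g, [/\ I g, g \is d.-homog & forall m, L m -> (f - g)@_m = 0].
Proof.
move=> [I0 ID IM _] [_ hL]; pose rk := @lexrank N d.+1.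
have [k] : exists k, forall m, L m -> f@_m != 0 -> (rk m < k)%N.
  exists (\max_(m <- msupp f) (rk m).+1)%N => m _; rewrite -mcoeff_msupp => m_f.
  by rewrite (big_rem m) //= leq_maxl.
elim: k f => [|k IHk] f f_lt hf.
  by exists 0; split=> // [|m Lm]; [exact: rpred0|]; rewrite subr0;
    apply/eqP/negP => /negP/(f_lt _ Lm).
have [[m [Lm fm em]]|no] :=
    classic (exists m, [/\ L m, f@_m != 0 & rk m = k]); last first.
  apply: IHk => // m Lm fm; rewrite ltn_neqAle -ltnS f_lt // andbT.
  by apply/eqP => e; apply: no; exists m.
have dm : mdeg m = d by move/dhomogP: hf; apply; rewrite mcoeff_msupp.
have [h [Ih [m_h h_lead] hh]] := hL m Lm.
have hm : h@_m != 0 by rewrite -mcoeff_msupp.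
rewrite dm in hh; pose c := f@_m / h@_m.
have [||g [Ig hg eg]] := IHk (f - c *: h).
- move=> m' Lm'; rewrite mcoeffB mcoeffZ => nz.
  have [e|ne] := eqVneq m' m; first by rewrite e divfK // subrr eqxx in nz.
  have dm' : (mdeg m' < d.+1)%N.
    have [e|ne'] := eqVneq f@_m' 0; last first.
      by rewrite ltnS; move/dhomogP: hf => -> //; rewrite mcoeff_msupp.
    rewrite e sub0r oppr_eq0 mulf_eq0 negb_or -mcoeff_msupp in nz.
    by case/andP: nz => _ m'_h; rewrite ltnS; move/dhomogP: hh => ->.
  rewrite -em; case: (boolP (m' \in msupp h)) => [m'_h|m'_h].
    by apply: lexrank_lt => //; apply: h_lead.
  rewrite (memN_msupp_eq0 m'_h) mulr0 subr0 in nz.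
  case/orP: (lex_lt_total ne) => [/(lexrank_lt dm')//|lt_m].
  have := f_lt _ Lm' nz; rewrite ltnS -em leqNgt => /negP[].
  by apply: lexrank_lt => //; rewrite dm.
- by rewrite rpredB // rpredZ.
exists (g + c *: h); split=> [||m' /eg].
- by apply: ID => //; rewrite -mul_mpolyC; apply: IM.
- by rewrite rpredD // rpredZ.
by rewrite opprD addrA addrAC.
Qed.

End LeadSets.

(** * The Hilbert function of a resolution *)

Section HilbertFunction.
Local Open Scope ring_scope.
Variables (K : fieldType) (N B : nat).
Local Notation R := {mpoly K[N]}.

(** A predicate closed under linear combinations is a subspace, although it need
    not be decidable: a subspace of largest dimension on which it holds is all
    of it. *)
Lemma closed_vspace (vT : vectType K) (Q : vT -> Prop) : Q 0 ->
  (forall c u v, Q u -> Q v -> Q (c *: u + v)) ->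
  exists U : {vspace vT}, forall u, u \in U <-> Q u.
Proof.
move=> Q0 QP; pose ok k := exists U : {vspace vT},
  (forall u, u \in U -> Q u) /\ (\dim {:vT} - \dim U)%N = k.
have [|_ [U [UQ <-]] Umin] := @nat_min ok.
  by exists (\dim {:vT} - \dim (0%VS : {vspace vT}))%N, 0%VS; split=> // u;
    rewrite memv0 => /eqP ->.
exists U => u; split=> [/UQ//|Qu]; apply/negPn/negP => nU.
have UuQ v : v \in (U + <[u]>)%VS -> Q v.
  by case/memv_addP=> x /UQ Qx [_ /vlineP[c ->] ->]; rewrite addrC; apply: QP.
have lt_U : (\dim U < \dim (U + <[u]>))%N.
  rewrite ltn_neqAle dimvS ?addvSl // andbT.
  apply: contra nU => e; rewrite memvE.
  have -> : U = (U + <[u]>)%VS by apply/eqP; rewrite eqEdim addvSl -(eqP e) leqnn.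
  exact: addvSr.
have := Umin _ (ex_intro _ (U + <[u]>)%VS (conj UuQ erefl)).
by rewrite leqNgt ltn_sub2l // (leq_trans lt_U) // dimvS // subvf.
Qed.

Section Coordinates.
Variables (s : nat) (deg : 'I_s -> nat) (d : nat).

(** Monomials of degree [d] in a graded free module. Underlying monomials are
    bounded by [B] only to make the type finite; [B] is larger than all degrees
    that are considered. *)
Definition fmon : finType :=
  {x : 'I_s * 'X_{1..N < B} | (mdeg x.2 + deg x.1 == d)%N}.
Local Notation V := {ffun fmon -> K^o}.

Definition vec (u : V) : 'rV[R]_s :=
  \row_b \sum_(t : fmon | (val t).1 == b) u t *: 'X_[(val t).2].

Definition cf (w : 'rV[R]_s) : V := [ffun t : fmon => (w 0 (val t).1)@_(val t).2 : K^o].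

Lemma vecP c u v : vec (c *: u + v) = c%:MP *: vec u + vec v.
Proof.
apply/rowP => b; rewrite !mxE mulr_sumr -big_split; apply: eq_bigr => t _ /=.
by rewrite !ffunE scalerDl mul_mpolyC scalerA.
Qed.

Lemma cfP c w w' : cf (c%:MP *: w + w') = c *: cf w + cf w'.
Proof. by apply/ffunP => t; rewrite !ffunE !mxE mcoeffD mcoeffCM. Qed.

Lemma cf_vec : cancel vec cf.
Proof.
move=> u; apply/ffunP => t; rewrite ffunE mxE raddf_sum /=.
rewrite (bigD1 t) //= mcoeffZ mcoeffX eqxx mulr1 big1 ?addr0 // => t' /andP[e ne].
rewrite mcoeffZ mcoeffX; case: eqP => [e'|]; last by rewrite mulr0.
case/eqP: ne; apply/val_inj; rewrite [LHS]surjective_pairing [RHS]surjective_pairing.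
by rewrite (eqP e) (val_inj e').
Qed.

Lemma vec_hom u : vhom deg d (vec u).
Proof.
move=> b m; rewrite mxE raddf_sum /= => nz; apply/eqP; apply: contraNT nz => ne.
rewrite big1 // => t /eqP tb; rewrite mcoeffZ mcoeffX; case: eqP => [e|]; last first.
  by rewrite mulr0.
by case/negP: ne; rewrite -e -tb; apply: (valP t).
Qed.

Hypothesis lt_dB : (d < B)%N.

Lemma fmon_exists b m : (mdeg m + deg b)%N = d ->
  exists t : fmon, (val t).1 = b /\ (val t).2 = m :> 'X_{1..N}.
Proof.
move=> e; have lt_m : (mdeg m < B)%N by apply: leq_ltn_trans lt_dB; rewrite -e leq_addr.
have h : (mdeg (BMultinom lt_m) + deg b == d)%N by rewrite /= e.
by exists (exist _ (b, BMultinom lt_m) h).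
Qed.

Lemma vec_cf w : vhom deg d w -> vec (cf w) = w.
Proof.
move=> hw; apply/rowP => b; apply/mpolyP => m.
have [e|ne] := eqVneq (mdeg m + deg b)%N d; last first.
  transitivity (0 : K); last apply/esym; apply/eqP; apply: contraNT ne => nz.
    by rewrite (vec_hom nz).
  by rewrite (hw _ _ nz).
have [t [<- <-]] := fmon_exists e.
by have /ffunP/(_ t) := cf_vec (cf w); rewrite !ffunE.
Qed.

Lemma dim_fmon : \dim {: V} = #|fmon|.
Proof. by rewrite dimvf /dim /= muln1. Qed.

End Coordinates.

Definition nmon k := #|[set m : 'X_{1..N < B} | mdeg m == k]|.

Lemma card_fmon s (deg : 'I_s -> nat) d :
  #|fmon deg d| = (\sum_(j < d.+1) #|[set a | deg a == j]| * nmon (d - j))%N.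
Proof.
rewrite card_sig -sum1_card.
rewrite -(pair_big_dep xpredT (fun a (m : 'X_{1..N < B}) => mdeg m + deg a == d)%N
  (fun _ _ => 1%N)) /=.
rewrite (eq_bigr (fun a => \sum_(j < d.+1 | deg a == j) nmon (d - j))%N) => [|a _].
  rewrite (exchange_big_dep xpredT) //=; apply: eq_bigr => j _.
  by rewrite sum_nat_cond_const cardsE.
case: (leqP (deg a) d) => [le_ad|lt_da]; last first.
  rewrite !big_pred0 // => [j|m]; apply/negbTE.
    by rewrite neq_ltn orbC (leq_trans (ltn_ord j)).
  by rewrite neq_ltn orbC (leq_trans lt_da) ?leq_addl.
rewrite -ltnS in le_ad.
rewrite (big_pred1 (Ordinal le_ad)) => [|j]; last by rewrite eq_sym.
rewrite /nmon -sum1_card; apply: eq_bigl => m; rewrite inE /=.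
by rewrite -[RHS](eqn_add2r (deg a)) subnK.
Qed.

Section LinearPieces.
Variables (s s' : nat) (deg' : 'I_s' -> nat) (deg : 'I_s -> nat) (d : nat).
Variable A : 'M[R]_(s', s).

Definition piece (u : {ffun fmon deg' d -> K^o}) : {ffun fmon deg d -> K^o} :=
  cf deg d (vec u *m A).

Lemma piece_linear : linear piece.
Proof. by move=> c u v; rewrite /piece vecP mulmxDl -scalemxAl cfP. Qed.

HB.instance Definition _ :=
  GRing.isLinear.Build K {ffun fmon deg' d -> K^o} {ffun fmon deg d -> K^o} _
    piece piece_linear.

Definition lpiece : 'Hom({ffun fmon deg' d -> K^o}, {ffun fmon deg d -> K^o}) :=
  linfun piece.

Hypothesis lt_dB : (d < B)%N.
Hypothesis A_hom : mhom deg' deg A.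

Lemma vec_lpiece u : vec (lpiece u) = vec u *m A.
Proof. by rewrite lfunE /= vec_cf //; apply: (vhomM A_hom); apply: vec_hom. Qed.

Lemma lpiece_cf w : vhom deg' d w -> lpiece (cf deg' d w) = cf deg d (w *m A).
Proof. by move=> hw; rewrite lfunE /= /piece vec_cf. Qed.

End LinearPieces.

Section Euler.
Variables (I : R -> Prop) (F : free_complex K N).
Hypotheses (gI : gideal I) (hF : min_graded_free_res I F).

Local Notation V i d := {ffun fmon (gdeg (f := F) (i := i)) d -> K^o}.
Local Notation D i d := (lpiece (gdeg (i := i.+1)) (gdeg (i := i)) d (dif F i)).

Lemma lpiece_exact i d : (d < B)%N -> lker (D i d) = limg (D i.+1 d).
Proof.
move=> lt_dB; have [_ [_ _ ex] _] := hF.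
have h k := dif_hom (i := k) hF.
apply/vspaceP => u; rewrite memv_ker; apply/eqP/memv_imgP => [u0|[w _ ->]].
  have : vec u *m dif F i = 0.
    by rewrite -(vec_lpiece lt_dB (h i)) u0; apply/rowP => b; rewrite !mxE
      big1 // => t _; rewrite ffunE scale0r.
  case/ex=> w ew; exists (cf _ d (vpart (gdeg (i := i.+2)) d w)); first exact: memvf.
  rewrite lpiece_cf //; last exact: vpart_hom.
  rewrite -(vpartM (h i.+1)) -ew vpart_id; last exact: vec_hom.
  by rewrite cf_vec.
rewrite -[LHS]cf_vec !vec_lpiece //.
have -> : vec w *m dif F i.+1 *m dif F i = 0 by apply/ex; exists (vec w).
by apply/ffunP => t; rewrite !ffunE mxE mcoeff0.
Qed.

Lemma dim_lpiece_step i d : (d < B)%N ->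
  (#|fmon (gdeg (f := F) (i := i.+1)) d| =
   \dim (limg (D i.+1 d)) + \dim (limg (D i d)))%N.
Proof.
move=> lt_dB; rewrite -dim_fmon -[LHS](limg_ker_dim (D i d)) capfv.
by rewrite -lpiece_exact.
Qed.

End Euler.

Notation deg1 := (fun _ : 'I_1 => 0%N).

Section IdealPiece.
Variables (I : R -> Prop) (L : pred 'X_{1..N}) (d : nat).
Hypotheses (gI : gideal I) (hL : lead_set I L) (lt_dB : (d < B)%N).
Local Notation V1 := {ffun fmon deg1 d -> K^o}.
Local Notation L1 := {t : fmon deg1 d | L (val t).2}.

Definition lead_coords (u : V1) : {ffun L1 -> K^o} := [ffun t => u (val t)].

Lemma lead_coords_linear : linear lead_coords.
Proof. by move=> c u v; apply/ffunP => t; rewrite !ffunE. Qed.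

HB.instance Definition _ :=
  GRing.isLinear.Build K V1 {ffun L1 -> K^o} _ lead_coords lead_coords_linear.

Lemma homog_vhom (f : R) : f \is d.-homog -> vhom deg1 d (f%:M : 'rV_1).
Proof.
move/dhomogP => hf b m; rewrite (ord1 b) mxE eqxx addn0 -mcoeff_msupp; exact: hf.
Qed.

Lemma vec_homog (u : V1) : vec u 0 0 \is d.-homog.
Proof.
apply/dhomogP => m; rewrite mcoeff_msupp => /vec_hom; by rewrite addn0.
Qed.

(** The leading monomials of an ideal count the dimension of its graded
    pieces. *)
Lemma dim_ideal_piece (U : {vspace V1}) : (forall u, u \in U <-> I (vec u 0 0)) ->
  \dim U = #|[set t : fmon deg1 d | L (val t).2]|.
Proof.
move=> hU; have [lead_L lead_ex] := hL.
have ker0 : (U :&: lker (linfun lead_coords))%VS = 0%VS.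
  apply/eqP; rewrite -subv0; apply/subvP => u; rewrite memv_cap memv_ker lfunE /=.
  case/andP=> /hU Iu /eqP/ffunP u0; rewrite memv0 -(cf_vec u).
  have [e|/lex_lead_exists[m hm]] := eqVneq (vec u 0 0) 0.
    apply/eqP/ffunP => t; rewrite !ffunE.
    by rewrite (ord1 (val t).1) e mcoeff0.
  have Lm := lead_L _ _ Iu hm; case: hm => m_u _.
  have dm : (mdeg m + deg1 0%R = d)%N by rewrite addn0; move/dhomogP: (vec_homog u); apply.
  have [t [et1 et2]] := @fmon_exists _ deg1 _ lt_dB 0 m dm.
  rewrite -et2 in Lm; have := u0 (exist _ t Lm); rewrite !ffunE /= => ut.
  have /ffunP/(_ t) := cf_vec u; rewrite ffunE et1 => ut'.
  by move: m_u; rewrite mcoeff_msupp -et2 ut' ut eqxx.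
rewrite -(limg_ker_dim (linfun lead_coords) U) ker0 dimv0 add0n.
have -> : (linfun lead_coords @: U)%VS = fullv.
  apply/eqP; rewrite eqEsubv subvf /=; apply/subvP => v _.
  pose u0 : V1 := [ffun t => if insub t is Some t' then v t' else 0].
  have [g [Ig hg eg]] := lead_division gI hL (vec_homog u0).
  apply/memv_imgP; exists (cf deg1 d g%:M).
    by apply/hU; rewrite vec_cf ?mxE //; apply: homog_vhom.
  apply/ffunP => t; rewrite lfunE !ffunE (ord1 (val (val t)).1) mxE eqxx mulr1n.
  have := eg _ (valP t); rewrite mcoeffB => /eqP; rewrite subr_eq0 => /eqP <-.
  have /ffunP/(_ (val t)) := cf_vec u0.
  by rewrite !ffunE (ord1 (val (val t)).1) valK.
rewrite dimvf /dim /= muln1 card_sig.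
by apply: eq_card => t; rewrite inE.
Qed.

End IdealPiece.

Section Hilbert.
Variables (I : R -> Prop) (F : free_complex K N) (L : pred 'X_{1..N}).
Hypotheses (gI : gideal I) (hF : min_graded_free_res I F) (hL : lead_set I L).
Local Notation D i d := (lpiece (gdeg (f := F) (i := i.+1)) (gdeg (i := i)) d (dif F i)).
Local Notation aug1 d := (lpiece (gdeg (f := F) (i := 0)) deg1 d (aug F)).

(** Exactness at the first free module and at the quotient, in degree [d]; the
    dimension of the quotient is the number of monomials outside [L]. *)
Lemma dim_lpiece_aug d : (d < B)%N ->
  (#|fmon (gdeg (f := F) (i := 0%N)) d| + #|[set t : fmon deg1 d | L (val t).2]| =
   #|fmon deg1 d| + \dim (limg (D 0%N d)))%N.
Proof.
move=> lt_dB; have [_ [aug_surj aug_ker _] _] := hF.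
have aug_mhom := aug_hom hF.
have [I0 ID IM Ih] := gI.
have [|c u v Iu Iv|W hW] := @closed_vspace {ffun fmon deg1 d -> K^o}
    (fun u => I (vec u 0 0)).
- suff -> : vec (0 : {ffun fmon deg1 d -> K^o}) 0 0 = 0 by [].
  by rewrite mxE big1 // => t _; rewrite ffunE scale0r.
- have -> : vec (c *: u + v) 0 0 = c%:MP * vec u 0 0 + vec v 0 0.
    by rewrite vecP; move: (vec u) (vec v) => x y; rewrite !mxE.
  by apply: ID => //; apply: IM.
rewrite -(dim_ideal_piece gI hL lt_dB hW) -!dim_fmon.
have imD : (aug1 d @: limg (D 0%N d))%VS = (limg (aug1 d) :&: W)%VS.
  apply/vspaceP => x; rewrite memv_cap; apply/memv_imgP/andP.
    case=> u /memv_imgP[w _ ->] ->; split; first exact/memv_img/memvf.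
    apply/hW; rewrite !vec_lpiece //; last exact: dif_hom hF.
    by apply/aug_ker; exists (vec w).
  case=> /memv_imgP[u _ ->] /hW; rewrite vec_lpiece // => /aug_ker[w ew].
  exists u => //; apply/memv_imgP; exists (cf _ d (vpart (gdeg (i := 1)) d w)).
    exact: memvf.
  rewrite lpiece_cf //; last exact: vpart_hom.
  rewrite -(vpartM (dif_hom (i := 0) hF)) -ew vpart_id ?cf_vec //; exact: vec_hom.
have sub_ker : (lker (aug1 d) <= limg (D 0%N d))%VS.
  apply/subvP => u; rewrite memv_ker => /eqP au0.
  have /aug_ker[w ew] : I ((vec u *m aug F) 0 0).
    by rewrite -(vec_lpiece lt_dB aug_mhom) au0 mxE big1 // => t _; rewrite ffunE scale0r.
  apply/memv_imgP; exists (cf _ d (vpart (gdeg (i := 1)) d w)); first exact: memvf.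
  rewrite lpiece_cf //; last exact: vpart_hom.
  rewrite -(vpartM (dif_hom (i := 0) hF)) -ew vpart_id ?cf_vec //; exact: vec_hom.
have im_W : (limg (aug1 d) + W)%VS = fullv.
  apply/eqP; rewrite eqEsubv subvf /=; apply/subvP => v _.
  have [u hu] := aug_surj (vec v 0 0).
  pose x := cf (gdeg (f := F) (i := 0%N)) d (vpart (gdeg (i := 0%N)) d u).
  rewrite -(subrKC (aug1 d x) v); apply: memv_add; first exact/memv_img/memvf.
  apply/hW.
  have -> : vec (v - aug1 d x) = vpart deg1 d (vec v - u *m aug F).
    rewrite -scaleN1r addrC vecP vpartD vpartN (vec_lpiece lt_dB aug_mhom).
    rewrite vec_cf ?(vpartM aug_mhom) //; last exact: vpart_hom.
    by rewrite (vpart_id (@vec_hom _ _ _ v)) addrC mpolyCN mpolyC1 scaleN1r.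
  have [_ _ _ Ph] := gideal_gsub gI; apply: Ph.
  by move: hu; move: (vec v) (u *m _) => y z; rewrite !mxE.
have eV := limg_ker_dim (aug1 d) fullv; rewrite capfv in eV.
have eD := limg_ker_dim (aug1 d) (limg (D 0%N d)).
rewrite imD (capv_idPr sub_ker) in eD.
have eW := dimv_sum_cap (limg (aug1 d)) W; rewrite im_W in eW.
by rewrite -eV -addnA -eW addnCA eD.
Qed.

(** The Hilbert function of the quotient as the alternating sum of those of the
    free modules of a resolution. *)
Theorem minres_hilbert d n : (d < B)%N ->
  (forall a : 'I_(rk F n.+1), (d < gdeg a)%N) ->
  \sum_(i < n.+1) (-1) ^+ i * #|fmon (gdeg (f := F) (i := i)) d|%:Z =
  #|fmon deg1 d|%:Z - #|[set t : fmon deg1 d | L (val t).2]|%:Z.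
Proof.
move=> lt_dB n_big; pose r i := \dim (limg (D i d)).
have rn : r n = 0%N.
  apply/eqP; rewrite -leqn0 (@leq_trans #|fmon (gdeg (f := F) (i := n.+1)) d|) //.
    by rewrite -dim_fmon -[leqRHS](limg_ker_dim (D n d)) capfv leq_addl.
  rewrite leqNgt; apply/negP => /card_gt0P[t _].
  have /eqP e : (mdeg (val t).2 + gdeg (val t).1 == d)%N := valP t.
  by have := n_big (val t).1; rewrite ltnNge (leq_trans (leq_addl _ _) (eq_leq e)).
have main k : \sum_(i < k.+1) (-1) ^+ i * #|fmon (gdeg (f := F) (i := i)) d|%:Z =
    #|fmon deg1 d|%:Z - #|[set t : fmon deg1 d | L (val t).2]|%:Z +
    (-1) ^+ k * (r k)%:Z.
  elim: k => [|k IHk].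
    rewrite big_ord1 !expr0 !mul1r addrAC; apply/eqP; rewrite eq_sym subr_eq eq_sym.
    by rewrite -!PoszD (dim_lpiece_aug lt_dB).
  rewrite big_ord_recr /= IHk (dim_lpiece_step hF _ lt_dB) PoszD mulrDr.
  by rewrite exprS mulN1r !mulNr -addrA [_ * _ + (_ + _)]addrCA subrr addr0.
by rewrite main rn mulr0 addr0.
Qed.

End Hilbert.

(** The Hilbert function determines the alternating sums of the numbers of
    generators of a given degree, since there is exactly one monomial of degree
    zero. *)
Theorem minres_euler (I I' : R -> Prop) (F F' : free_complex K N) L n :
  gideal I -> gideal I' -> min_graded_free_res I F -> min_graded_free_res I' F' ->
  lead_set I L -> lead_set I' L ->
  (forall a : 'I_(rk F n.+1), (B <= gdeg a)%N) ->
  (forall a : 'I_(rk F' n.+1), (B <= gdeg a)%N) ->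
  forall d, (d < B)%N ->
  \sum_(i < n.+1) (-1) ^+ i * #|[set a : 'I_(rk F i) | gdeg a == d]|%:Z =
  \sum_(i < n.+1) (-1) ^+ i * #|[set a : 'I_(rk F' i) | gdeg a == d]|%:Z :> int.
Proof.
move=> gI gI' hF hF' hL hL' nF nF'.
pose chi (G : free_complex K N) d : int :=
  \sum_(i < n.+1) (-1) ^+ i * #|[set a : 'I_(rk G i) | gdeg a == d]|%:Z.
have hilb G d : \sum_(i < n.+1) (-1) ^+ i * #|fmon (gdeg (f := G) (i := i)) d|%:Z =
    \sum_(j < d.+1) chi G j * (nmon (d - j)%N)%:Z.
  under eq_bigr => i _ do rewrite card_fmon (big_morph Posz PoszD erefl) mulr_sumr.
  rewrite exchange_big; apply: eq_bigr => j _ /=; rewrite /chi mulr_suml.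
  by apply: eq_bigr => i _; rewrite PoszM mulrA.
have nmon0 d : (d < B)%N -> nmon 0%N = 1%N.
  move=> lt_dB; have lt_0B : (mdeg (0%MM : 'X_{1..N}) < B)%N.
    by rewrite mdeg0; apply: leq_ltn_trans lt_dB.
  rewrite /nmon; apply/eqP/cards1P; exists (BMultinom lt_0B).
  by apply/setP => m; rewrite !inE mdeg_eq0.
move=> d; rewrite -[LHS]/(chi F d) -[RHS]/(chi F' d).
elim/ltn_ind: d => d IHd lt_dB.
have gt_d (G : free_complex K N) : (forall a : 'I_(rk G n.+1), (B <= gdeg a)%N) ->
    forall a : 'I_(rk G n.+1), (d < gdeg a)%N.
  by move=> h a; apply: leq_trans lt_dB (h a).
have := minres_hilbert gI hF hL lt_dB (gt_d _ nF).
rewrite -(minres_hilbert gI' hF' hL' lt_dB (gt_d _ nF')) !hilb !big_ord_recr /=.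
rewrite subnn (nmon0 _ lt_dB) !mulr1 (eq_bigr (fun j : 'I_d => chi F' j * (nmon (d - j)%N)%:Z)).
  by move/addrI.
by move=> j _; congr (_ * _); apply: IHd (ltn_ord j) (ltn_trans (ltn_ord j) lt_dB).
Qed.

End HilbertFunction.

(** * Graded Betti numbers *)

Section Betti.
Local Open Scope ring_scope.
Variables (K : fieldType) (N : nat).
Local Notation R := {mpoly K[N]}.
Implicit Types I : R -> Prop.

Definition proper_gideal I := gideal I /\ (forall f, I f -> f@_0%MM = 0).

(** The value of [betti] is chosen among the counts given by resolutions, so it
    is such a count as soon as a resolution exists. *)
Lemma betti_res I i j : proper_gideal I -> exists2 F, min_graded_free_res I F &
  betti I i j = #|[set a : 'I_(rk F i) | gdeg a == j]|.
Proof.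
case=> gI I0; have [F0 hF0] := min_graded_free_res_exists gI I0.
pose Q b := exists F : free_complex K N,
  min_graded_free_res I F /\ b = #|[set a : 'I_(rk F i) | gdeg a == j]|.
have [|F [hF e]] := @epsilon_spec _ (inhabits 0%N) Q; last by exists F.
by exists #|[set a : 'I_(rk F0 i) | gdeg a == j]|, F0.
Qed.

Lemma card_deg_eq0 s (deg : 'I_s -> nat) j :
  #|[set a | deg a == j]| = 0%N <-> forall a, deg a <> j.
Proof.
split=> [/eqP|h]; first by rewrite cards_eq0 => /eqP/setP e a /eqP;
  have := e a; rewrite !inE => ->.
by apply/eqP; rewrite cards_eq0; apply/eqP/setP => a; rewrite !inE; apply/eqP.
Qed.

Variables (rho : 'I_N -> nat).
Hypothesis rho_inj : injective rho.

Lemma betti_eq0 I i j : proper_gideal I -> betti I i j = 0%N <-> KvanI rho I i j.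
Proof.
move=> pI; have [F hF ->] := betti_res i j pI.
by rewrite card_deg_eq0 (minres_Koszul rho_inj i j (proj1 pI) hF).
Qed.

Lemma KvanI_gt I l d : gideal I -> (d < l)%N -> KvanI rho I l d.
Proof.
move=> [I0 _ _ _] lt_dl c hc cyc; exists (fun=> 0) => S.
by rewrite kdv0 // (chain_gt S lt_dl hc) subrr mxE.
Qed.

(** In degree [p + r], the Betti numbers of [I] and [I'] can only be nonzero in
    homological degree [p], so each of them is, up to sign, the value of an
    alternating sum that only depends on the Hilbert function. *)
Theorem betti_corner I I' L p r :
  proper_gideal I -> proper_gideal I' -> lead_set I L -> lead_set I' L ->
  (forall i j, betti I i j <> 0%N -> (i <= p)%N /\ (j <= i + r)%N) ->
  (forall i j, betti I' i j <> 0%N -> (i <= p)%N /\ (j <= i + r)%N) ->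
  betti I p (p + r) = betti I' p (p + r).
Proof.
move=> pI pI' hL hL' bI bI'; set D := (p + r)%N.
have [F hF eF] := betti_res p D pI; have [F' hF' eF'] := betti_res p D pI'.
have count0 (J : R -> Prop) G i : proper_gideal J -> min_graded_free_res J G ->
    (forall i j, betti J i j <> 0%N -> (i <= p)%N /\ (j <= i + r)%N) ->
    i != p -> #|[set a : 'I_(rk G i) | gdeg a == D]| = 0%N.
  move=> pJ hG bJ ip; apply/card_deg_eq0/(minres_Koszul rho_inj i D (proj1 pJ) hG).
  apply/betti_eq0 => //; apply: NNPP => /bJ[le_ip]; rewrite leq_add2r => le_pi.
  by rewrite eqn_leq le_ip le_pi in ip.
have big (J : R -> Prop) G : proper_gideal J -> min_graded_free_res J G ->
    forall a : 'I_(rk G D.+1), (D.+1 <= gdeg a)%N.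
  move=> pJ hG a; rewrite leqNgt; apply/negP => lt_a.
  have /(minres_Koszul rho_inj _ _ (proj1 pJ) hG)/(_ a) := KvanI_gt (proj1 pJ) lt_a.
  exact.
have E := minres_euler (proj1 pI) (proj1 pI') hF hF' hL hL' (big _ _ pI hF)
  (big _ _ pI' hF') (ltnSn D).
have lt_pD : (p < D.+1)%N by rewrite ltnS leq_addr.
rewrite [LHS](bigD1 (Ordinal lt_pD)) // [RHS](bigD1 (Ordinal lt_pD)) //= in E.
rewrite -eF -eF' in E; move: E.
rewrite !big1 ?addr0 => [/(can_inj (signrMK _)) []//|i ip|i ip].
  by rewrite (count0 I') // mulr0.
by rewrite (count0 I) // mulr0.
Qed.

End Betti.

(** * Passing to the initial ideal *)

Section Semicontinuity.
Local Open Scope ring_scope.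
Variables (K : fieldType) (N : nat) (rho : 'I_N -> nat).
Hypothesis rho_inj : injective rho.
Local Notation R := {mpoly K[N]}.
Local Notation kd := (kd (K := K) rho).
Local Notation mset := (@mset N).
Implicit Types (S T : {set 'I_N}) (a : 'X_{1..N}).

(** The complex with basis the sets in [A], with the simplicial boundary in
    which faces outside [A] are dropped, and the vanishing of its homology. *)
Definition cd (A : pred {set 'I_N}) (u : {set 'I_N} -> K) S : K :=
  \sum_(k | (k \notin S) && A (k |: S)) (-1) ^+ sgn rho k S * u (k |: S).

Definition Cvan (A : pred {set 'I_N}) l := forall u : {set 'I_N} -> K,
  (forall S, #|S| <> l -> u S = 0) -> (forall S, A S -> cd A u S = 0) ->
  exists w, forall S, A S -> u S = cd A w S.

(** Sets indexing the part of multidegree [a] of the Koszul complex of the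
    quotient by the monomial ideal with set of monomials [L]. *)
Definition adm (L : pred 'X_{1..N}) a : pred {set 'I_N} :=
  fun S => (mset S <= a)%MM && ~~ L (a - mset S)%MM.

Definition chain1 l d (c : {set 'I_N} -> R) := forall S m, (c S)@_m != 0 ->
  #|S| = l /\ (mdeg m + l)%N = d.

Lemma KvanIE (I : R -> Prop) l d : KvanI rho I l d <->
  forall c, chain1 l d c -> (forall S, I (kd c S)) ->
    exists b, forall S, I (c S - kd b S).
Proof.
have kdE (c : {set 'I_N} -> 'rV[R]_1) S :
    kdv rho c S 0 0 = kd (fun T => c T 0 0) S by rewrite mxE.
split=> van c hc cyc.
  have [S i m|S|b hb] := van (fun S => (c S)%:M).
  - by rewrite (ord1 i) mxE eqxx addn0; apply: hc.
  - by rewrite kdE; under eq_kd do rewrite mxE eqxx; apply: cyc.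
  exists (fun T => b T 0 0) => S; have := hb S.
  by rewrite -kdE !mxE.
have [S m|S|b hb] := van (fun S => c S 0 0).
- by move/hc; rewrite addn0.
- by rewrite -kdE; apply: cyc.
exists (fun T => (b T)%:M) => S.
have -> : (c S - kdv rho (fun T => (b T)%:M) S) 0 0 = c S 0 0 - kd b S.
  move: (kdE (fun T => (b T)%:M) S); move: (kdv _ _ S) => x ex.
  by rewrite !mxE ex; congr (_ - _); apply: eq_kd => k _; rewrite mxE eqxx.
exact: hb.
Qed.

Lemma mcoeff_kd_multideg c S a : (mset S <= a)%MM ->
  (kd c S)@_(a - mset S)%MM =
  \sum_(k | (k \notin S) && (mset (k |: S) <= a)%MM)
    (-1) ^+ sgn rho k S * (c (k |: S))@_(a - mset (k |: S))%MM.
Proof.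
move=> le_Sa; rewrite mcoeff_kd big_mkcondr; apply: eq_bigr => k kS /=.
rewrite msetU1 // mnmBE mnmE (negPf kS) subn0.
have -> : (U_(k) + mset S <= a)%MM = (a k != 0%N).
  apply/mnm_lepP/idP => [/(_ k)|ak i].
    by rewrite mnmDE mnm1E eqxx mnmE (negPf kS) lt0n.
  rewrite mnmDE mnm1E; case: eqP => [<-|_]; last by move/mnm_lepP: le_Sa; apply.
  by rewrite mnmE (negPf kS) lt0n.
by case: ifP => ak; rewrite ?mulr0 // submDA addmC.
Qed.

Lemma mcoeff_kd_neq0 c S m : (kd c S)@_m != 0 -> exists k,
  [/\ k \notin S, (c (k |: S))@_(m - U_(k))%MM != 0 &
      (m - U_(k) + mset (k |: S) = m + mset S)%MM].
Proof.
rewrite mcoeff_kd => nz; apply: NNPP => no; case/eqP: nz.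
apply: big1 => k kS; case: ifP => mk; last by rewrite mulr0.
have [->|nz] := eqVneq (c (k |: S))@_(m - U_(k))%MM 0; first by rewrite mulr0.
by case: no; exists k; rewrite msetU1 // addmA submK ?lep1mP.
Qed.

Lemma mset_subU a S k : k \notin S -> (mset (k |: S) <= a)%MM ->
  (a - mset S)%MM = (a - mset (k |: S) + U_(k))%MM.
Proof.
move=> kS; rewrite msetU1 // => /mnm_lepP h; apply/mnmP => i; move: (h i).
rewrite !(mnmDE, mnmBE, mnm1E); case: eqP => [<-|_]; last by rewrite addn0 add0n.
by rewrite mnmE (negPf kS) addn0 => ak; rewrite subnK ?subn0.
Qed.

Section Lift.
Variables (I : R -> Prop) (L : pred 'X_{1..N}).
Hypothesis L_up : forall m m', L m -> L (m + m')%MM.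

Lemma adm_up a S k : adm L a S -> k \notin S ->
  adm L a (k |: S) = (mset (k |: S) <= a)%MM.
Proof.
move=> /andP[le_S nL] kS; rewrite /adm andb_idr // => le_kS.
by apply: contra nL; rewrite (mset_subU kS le_kS); apply: L_up.
Qed.

Lemma cd_adm (u : {set 'I_N} -> K) a S : adm L a S -> cd (adm L a) u S =
  \sum_(k | (k \notin S) && (mset (k |: S) <= a)%MM)
    (-1) ^+ sgn rho k S * u (k |: S).
Proof.
move=> aS; apply: eq_bigl => k; case: (boolP (k \in S)) => //= kS.
exact: adm_up.
Qed.

Hypotheses (gI : gideal I) (hL : lead_set I L).

(** A cycle modulo [I] is made smaller, for the lexicographic order of
    multidegrees, by subtracting a boundary and a chain with coefficients in
    [I]: its part of largest multidegree is a cycle modulo the initial ideal. *)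
Theorem Kvan_of_initial l d :
  (forall a, mdeg a = d -> Cvan (adm L a) l) -> KvanI rho I l d.
Proof.
move=> van; apply/KvanIE => c0; pose rk := @lexrank N d.+1.
have [I0 ID IM _] := gI; have [lead_L lead_ex] := hL.
have IN f : I f -> I (- f) by move=> If; rewrite -mulN1r; apply: IM.
have IB f g : I f -> I g -> I (f - g) by move=> If /IN; apply: ID.
have Ikd b S : (forall T, I (b T)) -> I (kd b S) by exact: kd_gideal.
have [k] : exists k, forall S m, (c0 S)@_m != 0 -> (rk (m + mset S)%MM < k)%N.
  exists (\max_S \max_(m <- msupp (c0 S)) (rk (m + mset S)%MM).+1)%N => S m.
  rewrite -mcoeff_msupp => m_c; apply: leq_trans (leq_bigmax S).
  by rewrite (big_rem m) //= leq_maxl.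
elim: k c0 => [|k IHk] c c_lt hc cyc.
  exists (fun=> 0) => S; suff -> : c S = 0.
    by rewrite sub0r; apply/IN/Ikd.
  by apply/mpolyP => m; rewrite mcoeff0; apply/eqP/negP => /negP/c_lt.
have [[S0 [m0 [nz0 e0]]]|no] :=
    classic (exists S m, (c S)@_m != 0 /\ rk (m + mset S)%MM = k); last first.
  apply: IHk => // S m nz; rewrite ltn_neqAle -ltnS c_lt // andbT.
  by apply/eqP => e; apply: no; exists S, m.
have deg_c S m : (c S)@_m != 0 -> mdeg (m + mset S)%MM = d.
  by case/hc=> eS <-; rewrite mdegD mdeg_mset eS.
have [a a_d rk_a] : exists2 a, mdeg a = d & rk a = k.
  by exists (m0 + mset S0)%MM => //; apply: deg_c.
have lt_a S m : (c S)@_m != 0 -> (m + mset S)%MM != a -> lex_lt (m + mset S)%MM a.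
  move=> nz ne; case/orP: (lex_lt_total ne) => // /(lexrank_lt (B := d.+1)).
  rewrite a_d => /(_ (ltnSn d)); rewrite -/rk rk_a => lt_k.
  by have := c_lt _ _ nz; rewrite ltnS leqNgt lt_k.
have lex_sub S m : (mset S <= a)%MM -> lex_lt (m + mset S)%MM a ->
    lex_lt m (a - mset S)%MM.
  by move=> le_S; rewrite -{1}(submK le_S) addmC [X in lex_lt _ X]addmC lex_lt_add.
(* the part of [c] of multidegree [a], the largest one that occurs *)
pose u S := if (mset S <= a)%MM then (c S)@_(a - mset S)%MM else 0.
have [S nS|S aS|w hw] := van a a_d u.
- rewrite /u; case: ifP => // _; apply/eqP/negP => /negP/hc[/nS[]].
- have /andP[le_S nL] := aS; rewrite cd_adm //.
  transitivity (kd c S)@_(a - mset S)%MM.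
    rewrite mcoeff_kd_multideg //; apply: eq_bigr => i /andP[_ le_i].
    by rewrite /u le_i.
  apply: contraNeq nL => nz; apply: lead_L (cyc S) _; split.
    by rewrite mcoeff_msupp.
  move=> m; rewrite mcoeff_msupp => /mcoeff_kd_neq0[i [iS nzi ei]] ne.
  apply: lex_sub le_S _; rewrite -ei; apply: lt_a => //; rewrite ei.
  by apply: contraNneq ne => <-; rewrite addmK.
(* its boundary agrees with [c] in multidegree [a], up to monomials in [L] *)
pose b T := if adm L a T && (#|T| == l.+1) then w T *: 'X_[a - mset T] else 0 : R.
have kd_b S m : (kd b S)@_m = if ((m + mset S)%MM == a) && (#|S| == l)
    then cd (adm L a) w S else 0.
  case: ifP => [/andP[/eqP ea /eqP eS]|ne]; last first.
    apply/eqP/negP => /negP/mcoeff_kd_neq0[i [iS nz ei]]; move: nz ne.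
    rewrite /b; case: ifP => [/andP[/andP[le_iS _]]|_]; last by rewrite mcoeff0 eqxx.
    rewrite cardsU1 iS eqSS => /eqP ->; rewrite mcoeffZ mcoeffX.
    case: (_ =P (m - U_(i))%MM) => [e _|_]; last by rewrite mulr0n mulr0 (eqxx (0 : K)).
    by rewrite -ei -e submK // !eqxx.
  have le_S : (mset S <= a)%MM by rewrite -ea lem_addl.
  have -> : m = (a - mset S)%MM by rewrite -ea addmK.
  rewrite mcoeff_kd_multideg // /cd !big_mkcondr; apply: eq_bigr => i iS.
  rewrite /b cardsU1 iS eS eqxx andbT.
  case: ifP => [le_iS|nle]; last by rewrite /adm nle.
  case: ifP => _; last by rewrite mcoeff0 mulr0.
  by rewrite mcoeffZ mcoeffX eqxx mulr1.
(* the monomials in [L] are then removed with elements of [I] that they lead *)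
have /choice_fun[h hh] m : exists f, L m ->
    [/\ I f, lex_lead f m & f \is (mdeg m).-homog].
  have [/lead_ex[f hf]|nL] := boolP (L m); [by exists f|by exists 0].
pose bad S := [&& #|S| == l, (mset S <= a)%MM & L (a - mset S)%MM].
pose g S := if bad S then ((c S - kd b S)@_(a - mset S)%MM /
  (h (a - mset S)%MM)@_(a - mset S)%MM) *: h (a - mset S)%MM else 0.
have Ig S : I (g S).
  rewrite /g; case: ifP => // /and3P[_ _ /hh[Ih _ _]].
  by rewrite -mul_mpolyC; apply: IM.
have g_deg S m : (g S)@_m != 0 -> #|S| = l /\ mdeg (m + mset S)%MM = d.
  rewrite /g; case: ifP => [/and3P[/eqP eS le_S /hh[_ _ /dhomogP hom]]|_]; last first.
    by rewrite mcoeff0 eqxx.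
  rewrite mcoeffZ mulf_eq0 negb_or -mcoeff_msupp => /andP[_ /hom e].
  by split=> //; rewrite mdegD e -mdegD submK.
have b_deg S m : (kd b S)@_m != 0 -> #|S| = l /\ (m + mset S)%MM = a.
  by rewrite kd_b; case: ifP => [/andP[/eqP -> /eqP ->]//|]; rewrite eqxx.
pose c2 S := c S - kd b S - g S.
have c2_deg S m : (c2 S)@_m != 0 -> #|S| = l /\ mdeg (m + mset S)%MM = d.
  have [e1|/g_deg//] := eqVneq (g S)@_m 0.
  have [e2|/b_deg[eS ->]//] := eqVneq (kd b S)@_m 0.
  rewrite !mcoeffB e1 e2 !subr0 => nz; split; [by case: (hc _ _ nz)|exact: deg_c].
have [S m nz|S m nz|S|b2 hb2] := IHk c2.
- have [eS e_d] := c2_deg _ _ nz.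
  have [e|ne] := eqVneq (m + mset S)%MM a.
    have le_S : (mset S <= a)%MM by rewrite -e lem_addl.
    have em : m = (a - mset S)%MM by rewrite -e addmK.
    case/eqP: nz; rewrite /c2 /g /bad eS eqxx le_S /= -em.
    case: ifP => [/hh[_ [m_h _] _]|nL].
      by rewrite mcoeffB mcoeffZ divfK ?subrr // -mcoeff_msupp.
    rewrite subr0 mcoeffB kd_b e eS !eqxx -(hw S) /adm ?le_S -?em ?nL //.
    by rewrite /u le_S -em subrr.
  suff lt_m : lex_lt (m + mset S)%MM a.
    by rewrite -rk_a; apply: lexrank_lt => //; rewrite e_d.
  have [e1|nz1] := eqVneq (c S)@_m 0; last exact: lt_a.
  have e2 : (kd b S)@_m = 0 by rewrite kd_b (negPf ne).
  move: nz; rewrite /c2 !mcoeffB e1 e2 subr0 sub0r oppr_eq0 /g.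
  case: ifP => [/and3P[_ le_S /hh[_ [_ lead_h] _]]|_]; last by rewrite mcoeff0 eqxx.
  rewrite mcoeffZ mulf_eq0 negb_or -mcoeff_msupp => /andP[_ m_h].
  rewrite -(submK le_S) addmC [X in lex_lt _ X]addmC lex_lt_add.
  by apply: lead_h => //; apply: contraNneq ne => ->; rewrite submK.
- have [eS e_d] := c2_deg _ _ nz; split=> //.
  by rewrite -e_d mdegD mdeg_mset eS.
- by rewrite kdB kdB kd_kd // subr0; apply: IB => //; apply: Ikd.
exists (fun T => b T + b2 T) => S; rewrite kdD.
have -> : c S - (kd b S + kd b2 S) = (c2 S - kd b2 S) + g S.
  by rewrite /c2 opprD addrA [RHS]addrAC subrK.
exact: ID.
Qed.

End Lift.

(** For a monomial ideal the multigraded parts of the Koszul complex are direct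
    summands. *)
Lemma Cvan_of_monomial (I : R -> Prop) (L : pred 'X_{1..N}) l a :
  (forall m m', L m -> L (m + m')%MM) ->
  (forall f, I f <-> forall m, m \in msupp f -> L m) ->
  KvanI rho I l (mdeg a) -> Cvan (adm L a) l.
Proof.
move=> L_up IL /KvanIE van u u_supp cyc.
pose c S := if (mset S <= a)%MM then u S *: 'X_[a - mset S] else 0 : R.
have c_multideg S m : (c S)@_m != 0 ->
    [/\ (mset S <= a)%MM, u S != 0 & m = (a - mset S)%MM].
  rewrite /c; case: ifP => le_S; last by rewrite mcoeff0 eqxx.
  rewrite mcoeffZ mcoeffX mulf_eq0 negb_or => /andP[-> h]; split=> //.
  by have [//|ne] := eqVneq (a - mset S)%MM m; rewrite (negPf ne) eqxx in h.
have c_coef S : (mset S <= a)%MM -> (c S)@_(a - mset S)%MM = u S.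
  by move=> le_S; rewrite /c le_S mcoeffZ mcoeffX eqxx mulr1.
have cdE w S : adm L a S -> (kd w S)@_(a - mset S)%MM =
    cd (adm L a) (fun T => (w T)@_(a - mset T)%MM) S.
  by move=> aS; case/andP: (aS) => le_S _; rewrite mcoeff_kd_multideg // cd_adm.
have [S m|S|b hb] := van c.
- case/c_multideg=> le_S nz ->; have eS : #|S| = l.
    by apply: NNPP => /u_supp e; rewrite e eqxx in nz.
  by split=> //; rewrite -eS -mdeg_mset -mdegD submK.
- apply/IL => m; rewrite mcoeff_msupp => nz.
  have [k [kS /c_multideg[le_kS nzu ek] em]] := mcoeff_kd_neq0 nz.
  have ea : (m + mset S)%MM = a by rewrite -em ek submK.
  have le_S : (mset S <= a)%MM by rewrite -ea lem_addl.
  have e : m = (a - mset S)%MM by rewrite -ea addmK.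
  apply: contraNT nz => nL; rewrite e cdE; last by rewrite /adm le_S -e nL.
  rewrite -[X in _ == X](cyc S); last by rewrite /adm le_S -e nL.
  by apply/eqP/eq_bigr => i /andP[_ /andP[le_i _]]; rewrite c_coef.
exists (fun T => (b T)@_(a - mset T)%MM) => S aS.
rewrite -cdE //; have /andP[le_S nL] := aS.
rewrite -c_coef //; apply/eqP; rewrite -subr_eq0 -mcoeffB.
by apply: contraNT nL; rewrite -mcoeff_msupp; have /IL := hb S; apply.
Qed.

End Semicontinuity.

(** * Tensor products of complexes *)

Section MatrixComplex.
Local Open Scope ring_scope.
Variable K : fieldType.

(** A differential given by a matrix acting on columns, lowering the level [d]
    by one; [mvan D d i] is exactness at level [i]. *)
Definition lowers n (d : 'I_n -> nat) (D : 'M[K]_n) :=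
  forall i j, D i j != 0 -> d j = (d i).+1.

Definition mvan n (D : 'M[K]_n) (d : 'I_n -> nat) l := forall u : 'cV[K]_n,
  (forall i, d i <> l -> u i 0 = 0) -> D *m u = 0 -> exists w, u = D *m w.

(** A map homotopic to the identity that kills every level at which the complex
    is exact. It is [(1 - D S) (1 - S D)] for a generalized inverse [S] of [D]
    that raises the level by one. *)
Lemma exactness_projector n (D : 'M[K]_n) (d : 'I_n -> nat) :
  lowers d D -> D *m D = 0 -> exists H T : 'M[K]_n,
    [/\ H = 1%:M - (D *m T + T *m D),
        forall i j, T i j != 0 -> d i = (d j).+1 &
        forall l (u : 'cV_n), mvan D d l -> (forall i, d i <> l -> u i 0 = 0) ->
          H *m u = 0].
Proof.
move=> D_low DD.
have DSD0 : D *m pinvmx D *m D = D by apply: mulmxKpV.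
pose S : 'M[K]_n := \matrix_(i, j) if d i == (d j).+1 then pinvmx D i j else 0.
have S_up i j : S i j != 0 -> d i = (d j).+1.
  by rewrite mxE; case: ifP => [/eqP //|_]; rewrite eqxx.
have DSD : D *m S *m D = D.
  apply/matrixP => i j; have [dj|dj] := eqVneq (d j) (d i).+1; last first.
    have -> : D i j = 0 by apply/eqP; apply: contraNT dj => /D_low ->.
    rewrite mxE big1 // => k _; have [->|/D_low dk] := eqVneq (D k j) 0.
      by rewrite mulr0.
    rewrite mxE big1 ?mul0r // => p _.
    have [->|/D_low dp] := eqVneq (D i p) 0; first by rewrite mul0r.
    have [->|/S_up] := eqVneq (S p k) 0; first by rewrite mulr0.
    by rewrite dp -dk => e; rewrite e eqxx in dj.
  rewrite -[in RHS]DSD0 !mxE; apply: eq_bigr => k _.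
  have [->|/D_low dk] := eqVneq (D k j) 0; first by rewrite !mulr0.
  congr (_ * _); rewrite !mxE; apply: eq_bigr => p _.
  have [->|/D_low dp] := eqVneq (D i p) 0; first by rewrite !mul0r.
  by rewrite mxE dp -dk dj eqxx.
clearbody S.
exists (1%:M - (D *m (S - S *m S *m D) + (S - S *m S *m D) *m D)), (S - S *m S *m D).
have eH : 1%:M - (D *m (S - S *m S *m D) + (S - S *m S *m D) *m D) =
    (1%:M - D *m S) *m (1%:M - S *m D).
  rewrite [D *m (S - _)]mulmxBr [(S - _) *m D]mulmxBl -(mulmxA (S *m S)) DD.
  rewrite mulmx0 subr0 [RHS]mulmxBl mul1mx [D *m S *m _]mulmxBr mulmx1 !mulmxA.
  by rewrite opprD addrA addrAC.
split=> // [i j|l u van u_supp].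
  rewrite !mxE; have [eS|/S_up//] := eqVneq (S i j) 0.
  rewrite eS sub0r oppr_eq0 => nz; apply/eqP; apply: contraNT nz => ne.
  rewrite big1 // => k _; have [->|/D_low dk] := eqVneq (D k j) 0.
    by rewrite mulr0.
  rewrite mxE big1 ?mul0r // => p _.
  have [->|/S_up ip] := eqVneq (S i p) 0; first by rewrite mul0r.
  have [->|/S_up pk] := eqVneq (S p k) 0; first by rewrite mulr0.
  by rewrite ip pk dk eqxx in ne.
pose v := (1%:M - S *m D) *m u.
have Dv : D *m v = 0 by rewrite mulmxA mulmxBr mulmx1 mulmxA DSD subrr mul0mx.
have [i di|w vw] := van v _ Dv.
  have : (S *m (D *m u)) i 0 = 0.
    rewrite mxE big1 // => k _.
    have [->|/S_up ik] := eqVneq (S i k) 0; first by rewrite mul0r.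
    rewrite mxE big1 ?mulr0 // => p _.
    have [->|/D_low pk] := eqVneq (D k p) 0; first by rewrite mul0r.
    by rewrite u_supp ?mulr0 // pk -ik.
  rewrite /v mulmxBl mul1mx -mulmxA; move: (S *m _) => x x0.
  by rewrite !mxE x0 u_supp // subr0.
by rewrite eH -mulmxA -/v vw mulmxA mulmxBl mul1mx DSD subrr mul0mx.
Qed.

(** The tensor product of the complexes with differentials [D1] and [D2]: its
    elements are matrices, [D1] acts on rows and [D2] on columns, with the
    alternating sign given by the diagonal matrix [Jmx]. Its exponent is the level
    plus one because the level of a set of [k] indices will be [k + 1]. *)
Section Tensor.
Variables (n1 n2 : nat) (D1 : 'M[K]_n1) (D2 : 'M[K]_n2).
Variables (d1 : 'I_n1 -> nat) (d2 : 'I_n2 -> nat).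
Hypotheses (D1_low : lowers d1 D1) (D2_low : lowers d2 D2).
Hypotheses (D1D1 : D1 *m D1 = 0) (D2D2 : D2 *m D2 = 0).

Definition Jmx : 'M[K]_n1 := diag_mx (\row_i (-1) ^+ (d1 i).+1).

Definition tens_d (U : 'M[K]_(n1, n2)) := D1 *m U + Jmx *m U *m D2^T.

Lemma Jmx_sq : Jmx *m Jmx = 1%:M.
Proof.
rewrite mulmx_diag -[1%:M](@diag_const_mx _ n1 1); congr diag_mx.
by apply/rowP => i; rewrite !mxE -expr2 sqrr_sign.
Qed.

Lemma Jmx_anti (A : 'M[K]_n1) :
  (forall i j, A i j != 0 -> d1 j = (d1 i).+1 \/ d1 i = (d1 j).+1) ->
  Jmx *m A = - (A *m Jmx).
Proof.
move=> hA; apply/matrixP => i j; rewrite mul_diag_mx mul_mx_diag !mxE.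
have [->|/hA[->|->]] := eqVneq (A i j) 0; first by rewrite mulr0 mul0r oppr0.
  by rewrite [in RHS]exprS mulN1r mulrN opprK mulrC.
by rewrite exprS mulN1r mulNr mulrC.
Qed.

Lemma tens_dd U : tens_d (tens_d U) = 0.
Proof.
have JD : Jmx *m D1 = - (D1 *m Jmx) by apply: Jmx_anti => i j /D1_low; left.
rewrite /tens_d !mulmxDr !mulmxDl !mulmxA D1D1 mul0mx add0r Jmx_sq mul1mx JD.
rewrite -[U *m _ *m _]mulmxA -trmx_mul D2D2 trmx0 mulmx0 addr0.
by rewrite !mulNmx subrr.
Qed.

Lemma tens_dD U V : tens_d (U + V) = tens_d U + tens_d V.
Proof. by rewrite /tens_d !mulmxDr mulmxDl addrACA. Qed.

Lemma tens_dB U V : tens_d (U - V) = tens_d U - tens_d V.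
Proof. by rewrite /tens_d !mulmxBr mulmxBl opprD addrACA. Qed.

(** Over a field the homology of a tensor product vanishes where one of the
    factors is exact: the projectors of both factors show that a cycle is
    homologous to its image under their tensor product, which is zero. *)
Lemma tensor_exact l (U : 'M[K]_(n1, n2)) :
  (forall i j, U i j != 0 -> (d1 i + d2 j)%N = l /\ 
     (mvan D1 d1 (d1 i) \/ mvan D2 d2 (d2 j))) ->
  tens_d U = 0 -> exists W, U = tens_d W.
Proof.
move=> hU dU.
have [H1 [T1 [eH1 T1_up H1_kill]]] := exactness_projector D1_low D1D1.
have [H2 [T2 [eH2 T2_up H2_kill]]] := exactness_projector D2_low D2D2.
have HUH : H1 *m U *m H2^T = 0.
  pose P p := \matrix_(i, j) (if d1 i == p then U i j else 0) : 'M[K]_(n1, n2).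
  have -> : U = \sum_(p < l.+1) P p.
    apply/matrixP => i j; rewrite summxE; have [e|/hU[e _]] := eqVneq (U i j) 0.
      by rewrite e big1 // => p _; rewrite mxE e if_same.
    have lt_l : (d1 i < l.+1)%N by rewrite ltnS -e leq_addr.
    rewrite (bigD1 (Ordinal lt_l)) //= mxE eqxx big1 ?addr0 // => p ne.
    by rewrite mxE eq_sym; move: ne; rewrite -val_eqE /= => /negPf ->.
  rewrite mulmx_sumr mulmx_suml big1 // => p _.
  have [->|nzP] := eqVneq (P p) 0; first by rewrite mulmx0 mul0mx.
  have /matrix0Pn[i [j]] := nzP.
  rewrite mxE; case: ifP => [/eqP ip /hU[e [van|van]]|_]; last by rewrite eqxx.
    suff -> : H1 *m P p = 0 by rewrite mul0mx.
    apply/matrixP => i' j'; rewrite [RHS]mxE.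
    have -> : (H1 *m P p) i' j' = (H1 *m col j' (P p)) i' 0.
      by rewrite !mxE; apply: eq_bigr => k _; rewrite !mxE.
    rewrite (H1_kill _ _ van) ?mxE // => i'' ne.
    by rewrite !mxE ifF //; apply/eqP => e'; apply: ne; rewrite e' ip.
  suff e0 : P p *m H2^T = 0 by rewrite -mulmxA e0 mulmx0.
  apply/matrixP => i' j'; rewrite [RHS]mxE.
  have -> : (P p *m H2^T) i' j' = (H2 *m (row i' (P p))^T) j' 0.
    by rewrite !mxE; apply: eq_bigr => k _; rewrite !mxE mulrC.
  rewrite (H2_kill _ _ van) ?mxE // => j'' ne.
  rewrite !mxE; case: ifP => // /eqP ip'; apply/eqP/negP => /negP/hU[e' _].
  by apply: ne; apply/eqP; rewrite -(eqn_add2l (d1 i)) e ip -ip' e'.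
have JD : Jmx *m D1 = - (D1 *m Jmx) by apply: Jmx_anti => i j /D1_low; left.
have JT : Jmx *m T1 = - (T1 *m Jmx) by apply: Jmx_anti => i j /T1_up; right.
pose U1 := H1 *m U.
have e1 : U - U1 = tens_d (T1 *m U).
  rewrite /U1 eH1 mulmxBl mul1mx subKr /tens_d mulmxDl -!mulmxA; congr (_ + _).
  rewrite (mulmxA Jmx) JT mulNmx -!mulmxA -mulmxN; congr (_ *m _).
  by move/eqP: dU; rewrite /tens_d -mulmxA addr_eq0 => /eqP.
have dU1 : tens_d U1 = 0.
  have -> : U1 = U - tens_d (T1 *m U) by rewrite -e1 subKr.
  by rewrite tens_dB dU tens_dd subrr.
have HU1 : U1 *m H2^T = 0 := HUH.
clearbody U1.
have e2 : U1 = tens_d (Jmx *m U1 *m T2^T).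
  move: HU1.
  have -> : H2^T = 1%:M - (T2^T *m D2^T + D2^T *m T2^T).
    by rewrite eH2 raddfB raddfD /= trmx1 !trmx_mul.
  rewrite mulmxBr mulmx1 mulmxDr.
  move/eqP; rewrite subr_eq0 => /eqP eU1.
  have JUD : Jmx *m U1 *m D2^T = - (D1 *m U1).
    by apply/eqP; rewrite -addr_eq0 addrC -[X in X == _]/(tens_d U1) dU1.
  have UD : U1 *m D2^T = D1 *m (Jmx *m U1).
    have JDU : Jmx *m (D1 *m U1) = - (D1 *m (Jmx *m U1)).
      by rewrite !mulmxA JD mulNmx.
    by rewrite -[U1 in LHS]mul1mx -Jmx_sq -!mulmxA (mulmxA Jmx U1) JUD mulmxN JDU opprK.
  rewrite [LHS]eU1 /tens_d !mulmxA Jmx_sq mul1mx UD addrC.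
  by rewrite -!mulmxA.
exists (T1 *m U + Jmx *m U1 *m T2^T).
by rewrite tens_dD -e1 -e2 subrK.
Qed.

(** The product of two cycles that are not boundaries is not a boundary: it is
    detected by the product of two functionals that vanish on boundaries. *)
Lemma tensor_not_exact (u1 : 'cV[K]_n1) (u2 : 'cV[K]_n2) :
  ~ (exists w, u1 = D1 *m w) -> ~ (exists w, u2 = D2 *m w) ->
  ~ exists W, u1 *m u2^T = tens_d W.
Proof.
have detect n (D : 'M[K]_n) (u : 'cV[K]_n) : ~ (exists w, u = D *m w) ->
    exists2 f : 'cV[K]_n, D^T *m f = 0 & u^T *m f != 0.
  move=> nu; have : ~~ (u^T <= D^T)%MS.
    apply/negP => /submxP[w ew]; apply: nu; exists w^T.
    by rewrite -[u]trmxK ew trmx_mul trmxK.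
  rewrite submxE => /matrix0Pn[i [j nz]]; exists (col j (cokermx D^T)).
    by rewrite colE mulmxA mulmx_coker mul0mx.
  rewrite colE mulmxA -colE; apply: contraNneq nz => /colP/(_ i).
  by rewrite !mxE => ->.
move=> n1u n2u [W eW].
have [f1 Df1 nz1] := detect _ _ _ n1u; have [f2 Df2 nz2] := detect _ _ _ n2u.
have f1D : f1^T *m D1 = 0 by rewrite -[D1]trmxK -trmx_mul Df1 trmx0.
have : (f1^T *m u1) *m (u2^T *m f2) = 0.
  rewrite -mulmxA (mulmxA u1) eW /tens_d mulmxDl -[_ *m D2^T *m f2]mulmxA Df2 mulmx0.
  by rewrite addr0 !mulmxA f1D !mul0mx.
have -> : f1^T *m u1 = (u1^T *m f1)^T by rewrite trmx_mul trmxK.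
have nz_entry (x : 'M[K]_1) : x != 0 -> x 0 0 != 0.
  by apply: contraNneq => x0; rewrite [x]mx11_scalar x0 raddf0.
move: (u1^T *m f1) (u2^T *m f2) (nz_entry _ nz1) (nz_entry _ nz2) => x y nx ny.
rewrite [x]mx11_scalar [y]mx11_scalar tr_scalar_mx -scalar_mxM.
move/matrixP/(_ 0 0)/eqP; rewrite !mxE mulf_eq0.
by rewrite (negPf nx) (negPf ny).
Qed.

End Tensor.
End MatrixComplex.

Lemma set_ind (T : finType) (P : {set T} -> Prop) : P set0 ->
  (forall k (S : {set T}), k \notin S -> P S -> P (k |: S)) -> forall S, P S.
Proof.
move=> P0 PU S; have [n] := ubnP #|S|; elim: n S => // n IHn S.
rewrite ltnS; have [->//|/set0Pn[k kS]] := eqVneq S set0 => le_S.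
rewrite -(setD1K kS); apply: PU; first by rewrite !inE eqxx.
by apply: IHn; apply: leq_trans le_S; rewrite [X in (_ < X)%N](cardsD1 k) kS.
Qed.

Section ComplexMatrix.
Local Open Scope ring_scope.
Variables (K : fieldType) (N : nat) (rho : 'I_N -> nat).
Hypothesis rho_inj : injective rho.
Variables (L : pred 'X_{1..N}) (a : 'X_{1..N}).
Hypothesis L_up : forall m m', L m -> L (m + m')%MM.
Local Notation A := (adm L a).
Local Notation cd := (cd (K := K) rho A).
Local Notation nS := #|{set 'I_N}|.
Implicit Types (S T : {set 'I_N}).

Definition dcoef S T : K :=
  if A S && A T then \sum_(k | (k \notin S) && (T == k |: S)) (-1) ^+ sgn rho k S
  else 0.

Definition dmx : 'M[K]_nS := \matrix_(i, j) dcoef (enum_val i) (enum_val j).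

(** Sets outside [A] are put on level zero, where the differential vanishes. *)
Definition level (i : 'I_nS) : nat := if A (enum_val i) then #|enum_val i|.+1 else 0.

Lemma cd_dcoef u S : A S -> cd u S = \sum_T dcoef S T * u T.
Proof.
move=> AS; rewrite /dcoef AS /=.
transitivity (\sum_T \sum_(k | [&& k \notin S, A (k |: S) & T == k |: S])
    (-1) ^+ sgn rho k S * u (k |: S)).
  rewrite (exchange_big_dep (fun k => (k \notin S) && A (k |: S))) /=.
    by apply: eq_bigr => k kS; rewrite (big_pred1 (k |: S)) // => T; rewrite andbA kS.
  by move=> T k _ /and3P[-> ->].
apply: eq_bigr => T _; case: ifP => AT; last first.
  rewrite mul0r big_pred0 // => k; case: eqP => [<-|]; rewrite ?andbF //.
  by rewrite AT andbF.
rewrite mulr_suml; apply: eq_big => [k|k /and3P[_ _ /eqP ->]//].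
by case: eqP => [<-|]; rewrite ?andbF // AT.
Qed.

Lemma dcoef_adm S T : dcoef S T != 0 ->
  [/\ A S, A T & exists2 k, k \notin S & T = k |: S].
Proof.
rewrite /dcoef; case: ifP => [/andP[AS AT] nz|_]; last by rewrite eqxx.
split=> //; apply: NNPP => no; case/eqP: nz; rewrite big_pred0 // => k.
by apply/negP => /andP[kS /eqP eT]; apply: no; exists k.
Qed.

Lemma dmx_lowers : lowers level dmx.
Proof.
move=> i j; rewrite mxE /level => /dcoef_adm[-> -> [k kS ->]].
by rewrite cardsU1 kS.
Qed.

Lemma dmx_mul (u : 'cV[K]_nS) i : A (enum_val i) ->
  (dmx *m u) i 0 = cd (fun T => u (enum_rank T) 0) (enum_val i).
Proof.
move=> Ai; rewrite cd_dcoef // mxE.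
rewrite (reindex_onto enum_rank enum_val) /=; last by move=> j _; apply: enum_valK.
apply: eq_big => [T|T _]; first by rewrite enum_rankK eqxx.
by rewrite mxE enum_rankK.
Qed.

Lemma dmx_mul0 (u : 'cV[K]_nS) i : ~~ A (enum_val i) -> (dmx *m u) i 0 = 0.
Proof.
move=> /negPf nA; rewrite mxE big1 // => j _.
by rewrite mxE /dcoef nA mul0r.
Qed.

Lemma eq_cd (u w : {set 'I_N} -> K) S : (forall T, A T -> u T = w T) ->
  cd u S = cd w S.
Proof. by move=> h; apply: eq_bigr => k /andP[_ /h ->]. Qed.

(** The square of the differential is read off from the Koszul complex of the
    polynomial ring. *)
Lemma cd_cd (u : {set 'I_N} -> K) S : A S -> cd (cd u) S = 0.
Proof.
pose c T : {mpoly K[N]} := u T *: 'X_[a - mset T].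
have cdE w T : A T -> (kd rho w T)@_(a - mset T)%MM =
    cd (fun V => (w V)@_(a - mset V)%MM) T.
  by move=> aT; case/andP: (aT) => le_T _; rewrite mcoeff_kd_multideg // cd_adm.
move=> AS; rewrite -[RHS](mcoeff0 K (a - mset S)%MM) -(kd_kd rho_inj c S) cdE //.
apply: eq_cd => T AT; rewrite cdE //; apply: eq_cd => V _.
by rewrite mcoeffZ mcoeffX eqxx mulr1.
Qed.

Lemma dmx_dmx : dmx *m dmx = 0.
Proof.
apply/matrixP => i j; rewrite [RHS]mxE.
have -> : (dmx *m dmx) i j = (dmx *m col j dmx) i 0.
  by rewrite !mxE; apply: eq_bigr => k _; rewrite !mxE.
have [Ai|nAi] := boolP (A (enum_val i)); last exact: dmx_mul0.
rewrite dmx_mul // -[RHS](cd_cd (fun T => (delta_mx j 0 : 'cV_nS) (enum_rank T) 0) Ai).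
by apply: eq_cd => T AT; rewrite colE dmx_mul enum_rankK.
Qed.

Lemma CvanE l : Cvan K rho A l <-> mvan dmx level l.+1.
Proof.
split=> van u u_supp cyc.
  pose f S := u (enum_rank S) 0.
  have f_supp S : A S = false \/ #|S| <> l -> f S = 0.
    by move=> h; apply: u_supp; rewrite /level enum_rankK; case: ifP => // AS [e];
      case: h => //; rewrite AS.
  have [S nS|S AS|w hw] := van f.
  - by apply: f_supp; right.
  - have /matrixP/(_ (enum_rank S) 0) := cyc; rewrite [RHS]mxE => <-.
    by rewrite dmx_mul enum_rankK.
  exists (\col_i w (enum_val i)); apply/colP => i.
  have [Ai|nAi] := boolP (A (enum_val i)).
    rewrite dmx_mul // -[in LHS](enum_valK i) -/(f _) hw //.
    by apply: eq_cd => T _; rewrite mxE enum_rankK.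
  have := f_supp (enum_val i) (or_introl (negbTE nAi)); rewrite /f enum_valK => ->.
  by rewrite dmx_mul0.
pose f : 'cV[K]_nS := \col_i (if A (enum_val i) then u (enum_val i) else 0).
have [i ni||w hw] := van f.
- rewrite mxE; case: ifP => // Ai; apply: u_supp => e; apply: ni.
  by rewrite /level Ai e.
- apply/colP => i; rewrite [RHS]mxE.
  have [Ai|nAi] := boolP (A (enum_val i)); last exact: dmx_mul0.
  rewrite dmx_mul // -[RHS](cyc _ Ai); apply: eq_cd => T AT.
  by rewrite mxE enum_rankK AT.
exists (fun T => w (enum_rank T) 0) => S AS.
have /colP/(_ (enum_rank S)) := hw; rewrite dmx_mul enum_rankK // => <-.
by rewrite mxE enum_rankK AS.
Qed.

End ComplexMatrix.

(** * Monomial ideals in disjoint sets of variables *)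

Section PartialInjection.
Variables (N M : nat) (t : 'I_N -> option 'I_M).
Hypothesis t_inj : forall k l i, t k = Some i -> t l = Some i -> k = l.
Implicit Types (S : {set 'I_N}) (m a : 'X_{1..N}).

(** The exponents of [m] carried along [t], zero outside the image of [t]. *)
Definition pull m : 'X_{1..M} := [multinom \sum_(k | t k == Some i) m k | i < M].

Definition pull_set S : {set 'I_M} := [set i | [exists k in S, t k == Some i]].

Lemma t_image i : (exists k, t k = Some i) \/ (forall k, t k <> Some i).
Proof.
case: (pickP (fun k => t k == Some i)) => [k /eqP|no]; [by left; exists k|right].
by move=> k /eqP; rewrite no.
Qed.

Lemma t_pred1 k i : t k = Some i -> (fun l => t l == Some i) =1 pred1 k.
Proof. by move=> tk l; apply/eqP/eqP => [/t_inj/(_ tk)|->]. Qed.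

Lemma pullE k i m : t k = Some i -> pull m i = m k.
Proof. by move=> tk; rewrite mnmE (big_pred1 k) // => l; apply: t_pred1. Qed.

Lemma pull_out i m : (forall k, t k <> Some i) -> pull m i = 0.
Proof. by move=> no; rewrite mnmE big_pred0 // => k; apply/eqP/no. Qed.

Lemma mem_pull_set k i S : t k = Some i -> (i \in pull_set S) = (k \in S).
Proof.
move=> tk; rewrite inE; apply/existsP/idP => [[l /andP[lS /eqP tl]]|kS].
  by rewrite (t_inj tk tl).
by exists k; rewrite kS tk eqxx.
Qed.

Lemma pull_set_out i S : (forall k, t k <> Some i) -> i \notin pull_set S.
Proof. by move=> no; rewrite inE; apply/existsP => -[k /andP[_ /eqP /no]]. Qed.

Lemma mset_pull_set S : mset (pull_set S) = pull (mset S).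
Proof.
apply/mnmP => i; rewrite [LHS]mnmE; case: (t_image i) => [[k tk]|no].
  by rewrite (pullE _ tk) mnmE (mem_pull_set _ tk).
by rewrite pull_out // (negPf (pull_set_out _ no)).
Qed.

Lemma pullB m a : pull (a - m)%MM = (pull a - pull m)%MM.
Proof.
apply/mnmP => i; rewrite mnmBE; case: (t_image i) => [[k tk]|no].
  by rewrite !(pullE _ tk) mnmBE.
by rewrite !pull_out.
Qed.

Lemma pull_set0 : pull_set set0 = set0.
Proof.
by apply/setP => i; rewrite !inE; apply/existsP => -[k]; rewrite inE.
Qed.

Lemma pull_setU1 k i S : t k = Some i -> pull_set (k |: S) = i |: pull_set S.
Proof.
move=> tk; apply/setP => j; rewrite in_setU1; case: (t_image j) => [[l tl]|no].
  rewrite !(mem_pull_set _ tl) in_setU1; congr (_ || _).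
  apply/eqP/eqP => [e|e]; first by rewrite e tk in tl; case: tl.
  by apply: t_inj tl _; rewrite tk e.
rewrite !(negPf (pull_set_out _ no)) orbF; apply/esym/eqP => e.
by apply: (no k); rewrite tk e.
Qed.

Lemma pull_setU1_none k S : t k = None -> pull_set (k |: S) = pull_set S.
Proof.
move=> tk; apply/setP => j; case: (t_image j) => [[l tl]|no].
  rewrite !(mem_pull_set _ tl) in_setU1; case: eqP => // e.
  by rewrite e tk in tl.
by rewrite !(negPf (pull_set_out _ no)).
Qed.

Lemma pull_set_notin k i S : t k = Some i -> k \notin S -> i \notin pull_set S.
Proof. by move=> tk; rewrite (mem_pull_set _ tk). Qed.

End PartialInjection.

Section DisjointVariables.
Local Open Scope ring_scope.
Variables (K : fieldType) (N N1 N2 : nat) (sigma : 'I_N -> 'I_N1 + 'I_N2).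
Hypothesis sigma_inj : injective sigma.
Implicit Types (S : {set 'I_N}) (X : {set 'I_N1}) (Y : {set 'I_N2}).
Implicit Types (m a : 'X_{1..N}).

Definition left_var k := if sigma k is inl i then Some i else None.
Definition right_var k := if sigma k is inr j then Some j else None.

Lemma left_var_inj k l i : left_var k = Some i -> left_var l = Some i -> k = l.
Proof.
rewrite /left_var => h1 h2; apply: sigma_inj.
by case: (sigma k) (sigma l) h1 h2 => [?|?] [?|?] // [->] [->].
Qed.

Lemma right_var_inj k l j : right_var k = Some j -> right_var l = Some j -> k = l.
Proof.
rewrite /right_var => h1 h2; apply: sigma_inj.
by case: (sigma k) (sigma l) h1 h2 => [?|?] [?|?] // [->] [->].
Qed.

Local Notation pull1 := (pull left_var).
Local Notation pull2 := (pull right_var).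
Local Notation phi1 := (pull_set left_var).
Local Notation phi2 := (pull_set right_var).

Lemma left_or_right k :
  (exists i, left_var k = Some i /\ right_var k = None) \/
  (exists j, left_var k = None /\ right_var k = Some j).
Proof.
by rewrite /left_var /right_var; case: (sigma k) => i; [left|right]; exists i.
Qed.

Lemma mdeg_pull m : mdeg m = (mdeg (pull1 m) + mdeg (pull2 m))%N.
Proof.
have sum_pull M (t : 'I_N -> option 'I_M) :
    mdeg (pull t m) = (\sum_k \sum_(i | t k == Some i) m k)%N.
  rewrite mdegE (exchange_big_dep xpredT) //=; apply: eq_bigr => i _; exact: mnmE.
rewrite !sum_pull -big_split mdegE; apply: eq_bigr => k _ /=.
case: (left_or_right k) => [[i [-> ->]]|[j [-> ->]]].
  by rewrite (big_pred1 i) // big_pred0 ?addn0 // => j; rewrite eq_sym.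
by rewrite [X in (_ + X)%N](big_pred1 j) // big_pred0 // => i; rewrite eq_sym.
Qed.

(** With the left variables before the right ones, the signs of the Koszul
    complex are those of a tensor product. *)
Definition order_lr k : nat :=
  match sigma k with inl i => i | inr j => N1 + j end.

Lemma order_lr_inj : injective order_lr.
Proof.
move=> k l; rewrite /order_lr => e; apply: sigma_inj.
case: (sigma k) (sigma l) e => [i|j] [i'|j'].
- by move=> /val_inj ->.
- by move=> e; have := ltn_ord i; rewrite e ltnNge leq_addr.
- by move=> e; have := ltn_ord i'; rewrite -e ltnNge leq_addr.
by move=> /addnI/val_inj ->.
Qed.

Lemma card_pull_set S : #|S| = (#|phi1 S| + #|phi2 S|)%N.
Proof.
elim/set_ind: S => [|k S kS IHS]; first by rewrite !pull_set0 !cards0.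
rewrite cardsU1 kS IHS; case: (left_or_right k) => [[i [ki ki']]|[j [ki ki']]].
  rewrite (pull_setU1 left_var_inj _ ki) (pull_setU1_none right_var_inj _ ki').
  by rewrite cardsU1 (pull_set_notin left_var_inj ki kS) addnA.
rewrite (pull_setU1_none left_var_inj _ ki) (pull_setU1 right_var_inj _ ki').
by rewrite cardsU1 (pull_set_notin right_var_inj ki' kS) addnCA.
Qed.

Lemma order_left k i : left_var k = Some i -> order_lr k = i.
Proof. by rewrite /left_var /order_lr; case: (sigma k) => // ? [->]. Qed.

Lemma order_right k j : right_var k = Some j -> order_lr k = (N1 + j)%N.
Proof. by rewrite /right_var /order_lr; case: (sigma k) => // ? [->]. Qed.

Lemma sgn_set0 n (r : 'I_n -> nat) k : sgn r k set0 = false.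
Proof.
rewrite /sgn (_ : [set _ in _ | _] = set0) ?cards0 //.
by apply/setP => l; rewrite !inE.
Qed.

Lemma sgn_left k i S : left_var k = Some i ->
  sgn order_lr k S = sgn val i (phi1 S).
Proof.
move=> ki; have ok := order_left ki.
elim/set_ind: S => [|l S lS IHS]; first by rewrite pull_set0 !sgn_set0.
rewrite sgnU // IHS ok; case: (left_or_right l) => [[i' [li li']]|[j [li li']]].
  rewrite (pull_setU1 left_var_inj _ li) sgnU ?(order_left li) //.
  exact: (pull_set_notin left_var_inj li).
rewrite (pull_setU1_none left_var_inj _ li) (order_right li').
by rewrite ltnNge (leq_trans (ltnW (ltn_ord i))) ?leq_addr.
Qed.

Lemma sgn_right k j S : right_var k = Some j ->
  sgn order_lr k S = odd #|phi1 S| (+) sgn val j (phi2 S).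
Proof.
move=> kj; have ok := order_right kj.
elim/set_ind: S => [|l S lS IHS]; first by rewrite !pull_set0 !sgn_set0 cards0.
rewrite sgnU // IHS ok; case: (left_or_right l) => [[i' [li li']]|[j' [li li']]].
  rewrite (pull_setU1 left_var_inj _ li) (pull_setU1_none right_var_inj _ li').
  rewrite (order_left li) cardsU1 (pull_set_notin left_var_inj li lS) oddD.
  by rewrite (leq_trans (ltn_ord i')) ?leq_addr // addbA.
rewrite (pull_setU1_none left_var_inj _ li) (pull_setU1 right_var_inj _ li').
rewrite (order_right li') ltn_add2l sgnU; last exact: (pull_set_notin right_var_inj li').
by rewrite addbCA.
Qed.

Definition glue (X : {set 'I_N1}) (Y : {set 'I_N2}) : {set 'I_N} :=
  [set k | match sigma k with inl i => i \in X | inr j => j \in Y end].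

Lemma glueK S : glue (phi1 S) (phi2 S) = S.
Proof.
apply/setP => k; rewrite inE; case e: (sigma k) => [i|j].
  by apply: (mem_pull_set left_var_inj); rewrite /left_var e.
by apply: (mem_pull_set right_var_inj); rewrite /right_var e.
Qed.

Variables (L : pred 'X_{1..N}) (L1 : pred 'X_{1..N1}) (L2 : pred 'X_{1..N2}).
Hypothesis L_split : forall m, L m = L1 (pull1 m) || L2 (pull2 m).
Hypothesis L1_up : forall m m' : 'X_{1..N1}, L1 m -> L1 (m + m')%MM.
Hypothesis L2_up : forall m m' : 'X_{1..N2}, L2 m -> L2 (m + m')%MM.

Lemma pullD m m' : pull1 (m + m')%MM = (pull1 m + pull1 m')%MM /\
  pull2 (m + m')%MM = (pull2 m + pull2 m')%MM.
Proof.
split; apply/mnmP => i; rewrite mnmDE !mnmE -big_split /=; apply: eq_bigr => k _;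
  exact: mnmDE.
Qed.

Lemma L_up m m' : L m -> L (m + m')%MM.
Proof.
rewrite !L_split; have [-> ->] := pullD m m'.
by case/orP=> [/L1_up ->|/L2_up ->]; rewrite ?orbT.
Qed.

Section Multidegree.
Variable a : 'X_{1..N}.
Local Notation A := (adm L a).
Local Notation A1 := (adm L1 (pull1 a)).
Local Notation A2 := (adm L2 (pull2 a)).

Lemma adm_split S : A S = A1 (phi1 S) && A2 (phi2 S).
Proof.
rewrite /adm !(mset_pull_set left_var_inj) !(mset_pull_set right_var_inj).
rewrite -(pullB left_var_inj) -(pullB right_var_inj) L_split negb_or andbACA.
congr (_ && _); apply/mnm_lepP/andP => [h|[/mnm_lepP h1 /mnm_lepP h2] k].
  split; apply/mnm_lepP => i; rewrite !mnmE; apply: leq_sum => k _; exact: h.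
case: (left_or_right k) => [[i [ki _]]|[j [_ kj]]].
  by move: (h1 i); rewrite !(pullE left_var_inj _ ki).
by move: (h2 j); rewrite !(pullE right_var_inj _ kj).
Qed.

Lemma adm_image1 X i : A1 X -> i \in X -> exists k, left_var k = Some i.
Proof.
move=> /andP[/mnm_lepP h _] iS1; case: (t_image left_var i) => // no.
by have := h i; rewrite mnmE iS1 pull_out.
Qed.

Lemma adm_image2 Y j : A2 Y -> j \in Y -> exists k, right_var k = Some j.
Proof.
move=> /andP[/mnm_lepP h _] jS2; case: (t_image right_var j) => // no.
by have := h j; rewrite mnmE jS2 pull_out.
Qed.

Lemma phi1_glue X Y : A1 X -> phi1 (glue X Y) = X.
Proof.
move=> AS1; apply/setP => i; case: (t_image left_var i) => [[k ki]|no].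
  rewrite (mem_pull_set left_var_inj _ ki) inE; move: ki; rewrite /left_var.
  by case: (sigma k) => // ? [->].
rewrite (negPf (pull_set_out _ no)); apply/esym/negP => /(adm_image1 AS1)[k ki].
exact: no ki.
Qed.

Lemma phi2_glue X Y : A2 Y -> phi2 (glue X Y) = Y.
Proof.
move=> AS2; apply/setP => i; case: (t_image right_var i) => [[k ki]|no].
  rewrite (mem_pull_set right_var_inj _ ki) inE; move: ki; rewrite /right_var.
  by case: (sigma k) => // ? [->].
rewrite (negPf (pull_set_out _ no)); apply/esym/negP => /(adm_image2 AS2)[k ki].
exact: no ki.
Qed.

(** The Koszul complex in multidegree [a] is the tensor product of those of the
    two sets of variables. *)
Lemma cd_split (u : {set 'I_N} -> K) S : A S ->
  cd order_lr A u S =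
  cd val A1 (fun X => u (glue X (phi2 S))) (phi1 S) +
  (-1) ^+ #|phi1 S| * cd val A2 (fun Y => u (glue (phi1 S) Y)) (phi2 S).
Proof.
move=> AS; have := AS; rewrite adm_split => /andP[AS1 AS2].
rewrite /cd; set F := fun k => (-1) ^+ sgn order_lr k S * u (k |: S).
rewrite (eq_bigr (fun k => \sum_(i | left_var k == Some i) F k +
                           \sum_(j | right_var k == Some j) F k)); last first.
  move=> k _; case: (left_or_right k) => [[i [-> ->]]|[j [-> ->]]].
    by rewrite (big_pred1 i) ?big_pred0 ?addr0 // => j; rewrite eq_sym.
  by rewrite [X in _ + X](big_pred1 j) ?big_pred0 ?add0r // => i; rewrite eq_sym.
rewrite big_split /= (exchange_big_dep xpredT) //=.
rewrite [X in _ + X](exchange_big_dep xpredT) //=; congr (_ + _).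
  rewrite [RHS]big_mkcond; apply: eq_bigr => i _.
  case: (t_image left_var i) => [[k ki]|no]; last first.
    rewrite big_pred0 => [|k]; last by rewrite -[_ == _]negbK; have /eqP -> := no k; rewrite andbF.
    case: ifP => // /andP[_ /adm_image1/(_ (setU11 _ _))[k ki]].
    by case: (no k).
  have [ki' ek] : right_var k = None /\ left_var k = Some i.
    by move: ki; rewrite /left_var /right_var; case: (sigma k).
  rewrite (eq_bigl (fun l => (l == k) && ((k \notin S) && A (k |: S)))); last first.
    by move=> l; rewrite (t_pred1 left_var_inj ki) /= andbC; case: eqP => [->|].
  rewrite (mem_pull_set left_var_inj _ ki) adm_split.
  rewrite (pull_setU1 left_var_inj _ ki) (pull_setU1_none right_var_inj _ ki') AS2 andbT.
  case: ifP => h; last by rewrite big_pred0 // => l; rewrite andbF.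
  rewrite (big_pred1 k) => [|l]; last by rewrite andbT.
  rewrite /F (sgn_left _ ki) -[k |: S]glueK.
  by rewrite (pull_setU1 left_var_inj _ ki) (pull_setU1_none right_var_inj _ ki').
rewrite mulr_sumr [RHS]big_mkcond; apply: eq_bigr => j _.
case: (t_image right_var j) => [[k kj]|no]; last first.
  rewrite big_pred0 => [|k]; last by rewrite -[_ == _]negbK; have /eqP -> := no k; rewrite andbF.
  case: ifP => // /andP[_ /adm_image2/(_ (setU11 _ _))[k kj]].
  by case: (no k).
have [kj' ek] : left_var k = None /\ right_var k = Some j.
  by move: kj; rewrite /left_var /right_var; case: (sigma k).
rewrite (eq_bigl (fun l => (l == k) && ((k \notin S) && A (k |: S)))); last first.
  by move=> l; rewrite (t_pred1 right_var_inj kj) /= andbC; case: eqP => [->|].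
rewrite (mem_pull_set right_var_inj _ kj) adm_split.
rewrite (pull_setU1 right_var_inj _ kj) (pull_setU1_none left_var_inj _ kj') AS1 /=.
case: ifP => h; last by rewrite big_pred0 // => l; rewrite andbF.
rewrite (big_pred1 k) => [|l]; last by rewrite andbT.
rewrite /F (sgn_right _ kj) signr_addb signr_odd -mulrA -[k |: S]glueK.
by rewrite (pull_setU1 right_var_inj _ kj) (pull_setU1_none left_var_inj _ kj').
Qed.

Local Notation D1 := (dmx K val L1 (pull1 a)).
Local Notation D2 := (dmx K val L2 (pull2 a)).
Local Notation lev1 := (level L1 (pull1 a)).
Local Notation lev2 := (level L2 (pull2 a)).
Local Notation n1 := #|{set 'I_N1}|.
Local Notation n2 := #|{set 'I_N2}|.

(** A chain as an element of the tensor product of the two complexes. *)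
Definition glue_mx (u : {set 'I_N} -> K) : 'M[K]_(n1, n2) := \matrix_(i, j)
  if A1 (enum_val i) && A2 (enum_val j) then u (glue (enum_val i) (enum_val j))
  else 0.

Lemma tens_d_off (W : 'M[K]_(n1, n2)) i j :
  (forall i j, ~~ (A1 (enum_val i) && A2 (enum_val j)) -> W i j = 0) ->
  ~~ (A1 (enum_val i) && A2 (enum_val j)) -> tens_d D1 D2 lev1 W i j = 0.
Proof.
move=> W_off off; rewrite mxE -mulmxA mul_diag_mx !mxE.
rewrite !big1 ?mulr0 ?addr0 // => k _; rewrite !mxE /dcoef.
  case: (boolP (A2 (enum_val j))) => Aj; last by rewrite mulr0.
  case: (boolP (A2 (enum_val k))) => Ak; last by rewrite mulr0.
  by rewrite W_off ?mul0r //; move: off; rewrite Aj Ak !andbT.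
case: (boolP (A1 (enum_val i))) => Ai; last by rewrite mul0r.
case: (boolP (A1 (enum_val k))) => Ak; last by rewrite mul0r.
by rewrite W_off ?mulr0 //; move: off; rewrite Ai Ak.
Qed.

Lemma tens_d_glue (W : 'M[K]_(n1, n2)) (w : {set 'I_N} -> K) S :
  (forall T, A T -> W (enum_rank (phi1 T)) (enum_rank (phi2 T)) = w T) -> A S ->
  tens_d D1 D2 lev1 W (enum_rank (phi1 S)) (enum_rank (phi2 S)) =
  cd order_lr A w S.
Proof.
move=> eW AS; have := AS; rewrite adm_split => /andP[AX AY].
rewrite cd_split // mxE; congr (_ + _).
  have -> : (D1 *m W) (enum_rank (phi1 S)) (enum_rank (phi2 S)) =
      (D1 *m col (enum_rank (phi2 S)) W) (enum_rank (phi1 S)) 0.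
    by rewrite !mxE; apply: eq_bigr => k _; rewrite !mxE.
  rewrite dmx_mul enum_rankK //; apply: eq_cd => X AX'.
  by rewrite mxE -eW ?adm_split phi1_glue // phi2_glue // AX'.
rewrite -mulmxA mul_diag_mx !mxE /level enum_rankK AX 2!exprS !mulN1r opprK.
congr (_ * _).
transitivity ((D2 *m (row (enum_rank (phi1 S)) W)^T) (enum_rank (phi2 S)) 0).
  by rewrite !mxE; apply: eq_bigr => k _; rewrite !mxE mulrC.
rewrite dmx_mul enum_rankK //; apply: eq_cd => Y AY'.
by rewrite !mxE -eW ?adm_split phi1_glue // phi2_glue // AX.
Qed.

Let val_inj1 : injective (val : 'I_N1 -> nat) := val_inj.
Let val_inj2 : injective (val : 'I_N2 -> nat) := val_inj.
Let D1D1 := dmx_dmx K val_inj1 (pull1 a) L1_up.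
Let D2D2 := dmx_dmx K val_inj2 (pull2 a) L2_up.
Let D1_low := @dmx_lowers K _ val L1 (pull1 a).
Let D2_low := @dmx_lowers K _ val L2 (pull2 a).

Lemma glued i j : A1 (enum_val i) -> A2 (enum_val j) -> exists2 S, A S &
  i = enum_rank (phi1 S) /\ j = enum_rank (phi2 S).
Proof.
move=> Ai Aj; exists (glue (enum_val i) (enum_val j)).
  by rewrite adm_split phi1_glue // phi2_glue // Ai.
by rewrite phi1_glue // phi2_glue // !enum_valK.
Qed.

Lemma glue_mxE (u : {set 'I_N} -> K) S : A S ->
  glue_mx u (enum_rank (phi1 S)) (enum_rank (phi2 S)) = u S.
Proof.
by move=> AS; rewrite mxE !enum_rankK -adm_split AS glueK.
Qed.

Lemma glue_mx_off (u : {set 'I_N} -> K) i j :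
  ~~ (A1 (enum_val i) && A2 (enum_val j)) -> glue_mx u i j = 0.
Proof. by move=> /negPf off; rewrite mxE off. Qed.

Theorem Cvan_product l :
  (forall l1 l2, (l1 + l2)%N = l -> Cvan K val A1 l1 \/ Cvan K val A2 l2) ->
  Cvan K order_lr A l.
Proof.
move=> van u u_supp cyc.
have [i j|| W eW] := tensor_exact D1_low D2_low D1D1 D2D2 (l := l.+2) (U := glue_mx u).
- rewrite mxE; case: ifP => [/andP[Ai Aj] nz|_]; last by rewrite eqxx.
  rewrite /level Ai Aj; set X := enum_val i in Ai nz *; set Y := enum_val j in Aj nz *.
  have e : (#|X| + #|Y|)%N = l.
    apply: NNPP => ne; case/eqP: nz; apply: u_supp => e; apply: ne.
    by rewrite -e card_pull_set phi1_glue // phi2_glue.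
  split; first by rewrite addSn addnS e.
  case: (van _ _ e) => h; [left|right].
    exact/CvanE.
  exact/CvanE.
- apply/matrixP => i j; rewrite [RHS]mxE.
  have [/andP[Ai Aj]|off] := boolP (A1 (enum_val i) && A2 (enum_val j)); last first.
    by apply: tens_d_off => // i' j'; apply: glue_mx_off.
  have [S AS [-> ->]] := glued Ai Aj.
  by rewrite (tens_d_glue (w := u)) ?cyc // => T AT; apply: glue_mxE.
exists (fun S => W (enum_rank (phi1 S)) (enum_rank (phi2 S))) => S AS.
by rewrite -(glue_mxE u AS) eW; apply: tens_d_glue.
Qed.

(** The product of two cycles that are not boundaries is carried back to the
    multidegree [a] by evaluating it at the two parts of each set. *)
Theorem Cvan_product_not l1 l2 : ~ Cvan K val A1 l1 -> ~ Cvan K val A2 l2 ->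
  ~ Cvan K order_lr A (l1 + l2).
Proof.
move=> nv1 nv2 van.
have witness n (D : 'M[K]_n) d l : ~ mvan D d l -> exists u : 'cV[K]_n,
    [/\ forall i, d i <> l -> u i 0 = 0, D *m u = 0 & ~ exists w, u = D *m w].
  move=> nv; apply: NNPP => no; apply: nv => u u_supp Du; apply: NNPP => nw.
  by apply: no; exists u.
have [u1 [u1_supp Du1 nu1]] : exists u1 : 'cV[K]_n1,
    [/\ forall i, lev1 i <> l1.+1 -> u1 i 0 = 0, D1 *m u1 = 0 &
        ~ exists w, u1 = D1 *m w].
  by apply: witness => h; apply: nv1; apply/CvanE.
have [u2 [u2_supp Du2 nu2]] : exists u2 : 'cV[K]_n2,
    [/\ forall i, lev2 i <> l2.+1 -> u2 i 0 = 0, D2 *m u2 = 0 &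
        ~ exists w, u2 = D2 *m w].
  by apply: witness => h; apply: nv2; apply/CvanE.
pose U := u1 *m u2^T; have U_entry i j : U i j = u1 i 0 * u2 j 0.
  by rewrite mxE big_ord1 !mxE.
have U_supp i j : U i j != 0 -> lev1 i = l1.+1 /\ lev2 j = l2.+1.
  rewrite U_entry mulf_eq0 negb_or => /andP[nz1 nz2]; split; apply: NNPP.
    by move=> /u1_supp e; rewrite e eqxx in nz1.
  by move=> /u2_supp e; rewrite e eqxx in nz2.
have dU : tens_d D1 D2 lev1 U = 0.
  by rewrite /tens_d /U -!mulmxA -trmx_mul Du2 trmx0 !mulmx0 mulmxA Du1 mul0mx addr0.
pose u S := U (enum_rank (phi1 S)) (enum_rank (phi2 S)).
have [S nS|S AS|w hw] := van u.
- apply/eqP/negP => /negP/U_supp; rewrite /level !enum_rankK => -[e1 e2].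
  apply: nS; rewrite card_pull_set; move: e1 e2.
  by case: ifP => // _ [->]; case: ifP => // _ [->].
- by rewrite -(tens_d_glue (W := U) (w := u)) // dU mxE.
apply: (tensor_not_exact (d1 := lev1) nu1 nu2); exists (glue_mx w); rewrite -/U.
apply/matrixP => i j.
have [/andP[Ai Aj]|off] := boolP (A1 (enum_val i) && A2 (enum_val j)); last first.
  rewrite tens_d_off //; last by move=> i' j'; apply: glue_mx_off.
  apply/eqP; apply: contraNT off => /U_supp[]; rewrite /level.
  by case: ifP => // _ _; case: ifP.
have [S AS [-> ->]] := glued Ai Aj.
rewrite (tens_d_glue (w := w)) // => [|T AT]; last exact: glue_mxE.
exact: hw.
Qed.

End Multidegree.
End DisjointVariables.

Section Cone.
Local Open Scope ring_scope.
Variables (K : fieldType) (N : nat) (rho : 'I_N -> nat).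
Hypothesis rho_inj : injective rho.
Variables (L : pred 'X_{1..N}) (a : 'X_{1..N}) (v : 'I_N).
Hypothesis L_free : forall m, L (m + U_(v))%MM = L m.
Hypothesis a_v : a v != 0%N.
Local Notation A := (adm L a).
Implicit Types (S T : {set 'I_N}).

Lemma adm_cone S : v \notin S -> A (v |: S) = A S.
Proof.
move=> vS; rewrite /adm; have -> : (mset (v |: S) <= a)%MM = (mset S <= a)%MM.
  rewrite msetU1 //; apply/mnm_lepP/mnm_lepP => h i; move: (h i); rewrite mnmDE mnm1E.
    by apply: leq_trans; apply: leq_addl.
  by case: eqP => // <- _; rewrite mnmE (negPf vS) addn0 lt0n.
case: (boolP (mset S <= a)%MM) => //= le_S.
rewrite (mset_subU vS) ?L_free // msetU1 //.
apply/mnm_lepP => i; rewrite mnmDE mnm1E; case: eqP => [<-|_].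
  by rewrite mnmE (negPf vS) addn0 lt0n.
by move/mnm_lepP: le_S; apply.
Qed.

(** A variable of which the ideal is independent is regular on the quotient: in
    the multidegrees that involve it the complex is a cone. *)
Lemma Cvan_cone l : Cvan K rho A l.
Proof.
move=> u _ cyc.
exists (fun T => if v \in T then (-1) ^+ sgn rho v (T :\ v) * u (T :\ v) else 0).
move=> S AS; rewrite /cd; have [vS|vS] := boolP (v \in S); last first.
  rewrite (bigD1 v) /= ?vS ?adm_cone // setU11 setU1K // mulrA -expr2 sqrr_sign mul1r.
  rewrite big1 ?addr0 // => k /andP[_ kv].
  by rewrite in_setU1 eq_sym (negPf kv) (negPf vS) mulr0.
have vT : v \notin S :\ v by rewrite !inE eqxx.
have AT : A (S :\ v) by rewrite -adm_cone // setD1K.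
move: (cyc _ AT); rewrite /cd (bigD1 v) /= ?vT ?setD1K ?AS //.
move/eqP; rewrite addr_eq0 => /eqP eS.
rewrite -[LHS](signrMK (sgn rho v (S :\ v))) eS mulrN mulr_sumr -sumrN.
apply: eq_big => [k|k].
  rewrite !inE; case: (eqVneq k v) => [->|kv]; first by rewrite vS andbF.
  rewrite andbT; case: (boolP (k \in S)) => //= kS.
  rewrite -[in RHS](setD1K vS) setUCA adm_cone //.
  by rewrite !inE eqxx /= orbF eq_sym.
rewrite !inE => /andP[/andP[/negP kT _] kv].
have kS : k \notin S by apply/negP => kS; apply: kT; rewrite kv kS.
rewrite vS orbT.
have -> : (k |: S) :\ v = k |: (S :\ v).
  by apply/setP => i; rewrite !inE; case: (eqVneq i v) => // ->; rewrite eq_sym (negPf kv).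
have kT' : k \notin S :\ v by rewrite !inE kv (negPf kS).
have -> : sgn rho k S = sgn rho k (v |: (S :\ v)) by rewrite setD1K.
rewrite (sgn_antib rho_inj _ vT kT') 1?eq_sym // !mulrA -!signr_addb -mulNr -signrN.
congr ((-1) ^+ _ * _).
by case: (sgn _ v _); case: (sgn _ k _); case: (sgn _ v _).
Qed.

End Cone.

Section MonomialIdeals.
Local Open Scope ring_scope.
Variables (K : fieldType) (N : nat).
Local Notation R := {mpoly K[N]}.
Variables (I : R -> Prop) (L : pred 'X_{1..N}).

Definition is_monomial_ideal :=
  [/\ forall f, I f <-> forall m, m \in msupp f -> L m,
      forall m m', L m -> L (m + m')%MM & ~~ L 0%MM].

Hypothesis hI : is_monomial_ideal.

Lemma monomial_proper_gideal : proper_gideal I.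
Proof.
have [IL L_up L0] := hI; split; first split.
- by apply/IL => m; rewrite mcoeff_msupp mcoeff0 eqxx.
- move=> f g /IL hf /IL hg; apply/IL => m /msuppD_le.
  by rewrite mem_cat => /orP[/hf|/hg].
- move=> f g /IL hg; apply/IL => m /msuppM_le/allpairsP[[m1 m2] /= [_ /hg Lm2 ->]].
  by rewrite addmC; apply: L_up.
- move=> d f /IL hf; apply/IL => m; rewrite mcoeff_msupp mcoeff_mrestr.
  by case: ifP => _; [rewrite -mcoeff_msupp; apply: hf|rewrite eqxx].
move=> f /IL hf; apply/eqP; apply: contraNT L0 => nz; apply: hf.
by rewrite mcoeff_msupp.
Qed.

Lemma monomial_lead_set : lead_set I L.
Proof.
have [IL L_up _] := hI; split=> [f m /IL hf [m_f _]|m Lm]; first exact: hf.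
exists 'X_[m]; split; last by rewrite dhomogX.
  by apply/IL => m' /mem_msuppXP <-.
by split=> [|m' /mem_msuppXP ->]; [apply/mem_msuppXP|rewrite eqxx].
Qed.

Lemma monomial_betti (rho : 'I_N -> nat) i j : injective rho ->
  betti I i j <> 0%N <-> exists2 a, mdeg a = j & ~ Cvan K rho (adm L a) i.
Proof.
have [IL L_up _] := hI => rho_inj; have pI := monomial_proper_gideal.
split=> [nz|[a <- nv] /(betti_eq0 rho_inj i (mdeg a) pI) van].
  apply: NNPP => no; apply: nz; apply/(betti_eq0 rho_inj) => //.
  apply: (Kvan_of_initial rho_inj L_up (proj1 pI) monomial_lead_set) => a da.
  by apply: NNPP => nv; apply: no; exists a.
by apply: nv; apply: Cvan_of_monomial van.
Qed.

End MonomialIdeals.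

Section Product.
Local Open Scope ring_scope.
Variables (K : fieldType) (N N1 N2 : nat) (sigma : 'I_N -> 'I_N1 + 'I_N2).
Hypothesis sigma_inj : injective sigma.
Variables (L : pred 'X_{1..N}) (L1 : pred 'X_{1..N1}) (L2 : pred 'X_{1..N2}).
Variables (I : {mpoly K[N]} -> Prop) (I1 : {mpoly K[N1]} -> Prop)
  (I2 : {mpoly K[N2]} -> Prop).
Hypotheses (hI : is_monomial_ideal I L) (hI1 : is_monomial_ideal I1 L1)
  (hI2 : is_monomial_ideal I2 L2).
Hypothesis L_split : forall m,
  L m = L1 (pull (left_var sigma) m) || L2 (pull (right_var sigma) m).
Hypothesis L1_free : forall i, (forall k, left_var sigma k <> Some i) ->
  forall m, L1 (m + U_(i))%MM = L1 m.
Hypothesis L2_free : forall j, (forall k, right_var sigma k <> Some j) ->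
  forall m, L2 (m + U_(j))%MM = L2 m.

(** The weak form of the Kuenneth formula for the sum of two monomial ideals in
    disjoint sets of variables. *)
Lemma betti_sum_neq0 i j : betti I i j <> 0%N -> exists i1 i2 j1 j2,
  [/\ betti I1 i1 j1 <> 0%N, betti I2 i2 j2 <> 0%N, i = (i1 + i2)%N
    & j = (j1 + j2)%N].
Proof.
have [_ L1_up _] := hI1; have [_ L2_up _] := hI2.
case/(monomial_betti hI i j (order_lr_inj sigma_inj)) => a <- nv.
apply: NNPP => no; apply: nv; apply: (Cvan_product sigma_inj L_split) => // i1 i2 ei.
apply: NNPP => nor; apply: no.
exists i1, i2, (mdeg (pull (left_var sigma) a)), (mdeg (pull (right_var sigma) a)).
split; last exact: (mdeg_pull sigma).
- apply/(monomial_betti hI1 _ _ val_inj); exists (pull (left_var sigma) a) => // h.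
  by apply: nor; left.
- apply/(monomial_betti hI2 _ _ val_inj); exists (pull (right_var sigma) a) => // h.
  by apply: nor; right.
by [].
Qed.

(** A multidegree with homology does not involve the variables outside the image
    of [sigma], as the ideals are independent of these; so a pair of such
    multidegrees comes from one multidegree in the [N] variables. *)
Lemma betti_sum_neq0_conv i1 i2 j1 j2 : betti I1 i1 j1 <> 0%N ->
  betti I2 i2 j2 <> 0%N -> betti I (i1 + i2) (j1 + j2) <> 0%N.
Proof.
have [_ L1_up _] := hI1; have [_ L2_up _] := hI2.
case/(monomial_betti hI1 _ _ val_inj) => a1 <- nv1.
case/(monomial_betti hI2 _ _ val_inj) => a2 <- nv2.
have a1_free i : (forall k, left_var sigma k <> Some i) -> a1 i = 0%N.
  move=> no; apply: NNPP => nz; apply: nv1.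
  by apply: (Cvan_cone val_inj (v := i)); [apply: L1_free|apply/eqP].
have a2_free i : (forall k, right_var sigma k <> Some i) -> a2 i = 0%N.
  move=> no; apply: NNPP => nz; apply: nv2.
  by apply: (Cvan_cone val_inj (v := i)); [apply: L2_free|apply/eqP].
pose a := [multinom match sigma k with inl i => a1 i | inr j => a2 j end | k < N].
have pull1_a : pull (left_var sigma) a = a1.
  apply/mnmP => i; case: (t_image (left_var sigma) i) => [[k ki]|no].
    rewrite (pullE (left_var_inj sigma_inj) _ ki) mnmE; move: ki; rewrite /left_var.
    by case: (sigma k) => // ? [->].
  by rewrite pull_out // a1_free.
have pull2_a : pull (right_var sigma) a = a2.
  apply/mnmP => i; case: (t_image (right_var sigma) i) => [[k ki]|no].
    rewrite (pullE (right_var_inj sigma_inj) _ ki) mnmE; move: ki; rewrite /right_var.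
    by case: (sigma k) => // ? [->].
  by rewrite pull_out // a2_free.
apply/(monomial_betti hI _ _ (order_lr_inj sigma_inj)); exists a.
  by rewrite (mdeg_pull sigma) pull1_a pull2_a.
by apply: (Cvan_product_not sigma_inj L_split); rewrite ?pull1_a ?pull2_a.
Qed.

End Product.

(** * The Groebner basis of a closed graph *)

Section InitialIdeal.
Local Open Scope ring_scope.
Variables (K : fieldType) (N : nat) (I : {mpoly K[N]} -> Prop) (L : pred 'X_{1..N}).
Hypothesis hL : lead_set I L.
Hypothesis L_up : forall m m', L m -> L (m + m')%MM.

Lemma initial_idealE f : initial_ideal I f <-> forall m, m \in msupp f -> L m.
Proof.
have [lead_L lead_ex] := hL; split=> [[r [hr ->]] m|hf]; last first.
  exists [seq ((f@_x)%:MP, 'X_[x]) | x <- msupp f]; split.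
    by move=> _ /mapP[m /hf/lead_ex[g [Ig gm _]] ->]; exists g, m.
  by rewrite big_map {1}[f]mpolyE; apply: eq_bigr => m _; rewrite mul_mpolyC.
rewrite big_seq => /msupp_sum_le/flattenP[s /mapP[p + ->]].
rewrite mem_filter => /andP[/hr[g [m' [Ig gm ->]]] _].
rewrite (perm_mem (msuppMX _ _)) => /mapP[k _ ->].
by apply: L_up; apply: lead_L gm.
Qed.

End InitialIdeal.

Section Moves.
Variables (c : nat) (E : rel 'I_c).
Local Notation X := (lshift c).
Local Notation Y := (rshift c).
Local Notation mon := ('X_{1..(c + c)}).

(** The oriented edges of a closed graph. *)
Hypothesis E_lt : forall a b, E a b -> (a < b)%N.
Hypothesis E_out : forall a b d, E a b -> E a d -> (b < d)%N -> E b d.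
Hypothesis E_in : forall a b d, E a d -> E b d -> (a < b)%N -> E a b.

Definition edge_mon (a b : 'I_c) : mon := (U_(X a) + U_(Y b))%MM.

Definition reducible (m : mon) :=
  [exists a, [exists b, [&& E a b, m (X a) != 0 & m (Y b) != 0]]].

(** Replacing [x_a y_b] by [x_b y_a] along an edge [a < b]: the binomial edge
    ideal identifies the two sides. *)
Definition move (m p : mon) := exists a b m0,
  [/\ E a b, m = (m0 + edge_mon a b)%MM & p = (m0 + edge_mon b a)%MM].

Lemma reducibleP m : reducible m <-> exists p, move m p.
Proof.
split=> [/existsP[a /existsP[b /and3P[Eab ma mb]]]|[_ [a [b [m0 [Eab -> _]]]]]].
  exists (m - edge_mon a b + edge_mon b a)%MM, a, b, (m - edge_mon a b)%MM.
  split=> //; rewrite submK //; apply/mnm_lepP => i; rewrite mnmDE !mnm1E.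
  case: (X a =P i) => [<-|_]; first by rewrite eq_rlshift addn0 lt0n.
  by case: (Y b =P i) => [<-|//]; rewrite add0n lt0n.
apply/existsP; exists a; apply/existsP; exists b.
by rewrite Eab !mnmDE !mnm1E !eqxx; lia.
Qed.

Lemma move_lex m p : move m p -> lex_lt p m.
Proof.
case=> a [b [m0 [/E_lt lt_ab -> ->]]]; rewrite lex_lt_add; apply/lex_ltP.
have neX (i j : 'I_c) : (X i == X j) = (i == j) by rewrite (inj_eq (@lshift_inj _ _)).
exists (X a) => [|j lt_j]; rewrite !mnmDE !mnm1E.
  by rewrite !neX eqxx !eq_rlshift -val_eqE /= gtn_eqF.
have nj (i : 'I_c) : (a <= i)%N -> (X i == j) = false.
  by move=> le; rewrite -val_eqE /=; move: lt_j => /=; lia.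
have njY (i : 'I_c) : (Y i == j) = false.
  by rewrite -val_eqE /=; move: lt_j (ltn_ord a) => /=; lia.
by rewrite !nj ?njY // ltnW.
Qed.

Lemma move_mdeg m p : move m p -> mdeg p = mdeg m.
Proof. by case=> a [b [m0 [_ -> ->]]]; rewrite !mdegD !mdeg1. Qed.

Lemma move_add m p k : move m p -> move (k + m)%MM (k + p)%MM.
Proof.
by case=> a [b [m0 [Eab -> ->]]]; exists a, b, (k + m0)%MM; rewrite !addmA.
Qed.

Inductive moves (m : mon) : mon -> Prop :=
| moves0 : moves m m
| movesS p q : move m p -> moves p q -> moves m q.

Lemma moves1 m p : move m p -> moves m p.
Proof. by move/movesS; apply; apply: moves0. Qed.

Lemma moves_trans m p q : moves m p -> moves p q -> moves m q.
Proof. by elim=> // {}m r s mr _ IH /IH; apply: movesS. Qed.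

Lemma common_part N (m0 m1 p q : 'X_{1..N}) : (m0 + p = m1 + q)%MM ->
  (forall i, p i = 0 \/ q i = 0) ->
  exists m2, m0 = (m2 + q)%MM /\ m1 = (m2 + p)%MM.
Proof.
move=> /mnmP e d; exists (m0 - q)%MM.
by split; apply/mnmP => i; move: (e i) (d i); rewrite !(mnmDE, mnmBE); lia.
Qed.

(** Two moves out of a monomial that share a variable are reconciled by a move
    along the third edge of the triangle that closedness provides. *)
Lemma move_confluent m p q : move m p -> move m q ->
  exists r, moves p r /\ moves q r.
Proof.
case=> a [b [m0 [Eab -> ->]]] [a' [b' [m1 [Eab' e ->]]]].
have AC (x y z t : mon) : (x + (y + z) + t = x + y + z + t)%MM by rewrite !addmA.
have [ea|na] := eqVneq a a'.
  rewrite -{}ea in Eab' e *; have [eb|nb] := eqVneq b b'.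
    rewrite -eb in e *; exists (m0 + edge_mon b a)%MM.
    by rewrite (addIm e); split; apply: moves0.
  have [|i|m2 [e0 e1]] := @common_part _ m0 m1 U_(Y b)%MM U_(Y b')%MM.
  - by apply: (@addIm _ U_(X a)%MM); rewrite -!addmA ![(U_(Y _) + _)%MM]addmC.
  - rewrite !mnm1E; case: eqP => [<-|_]; [right|by left].
    by rewrite (inj_eq (@rshift_inj _ _)) eq_sym (negPf nb).
  have swap x y (z : mon) d : (z + U_(Y x) + (U_(X y) + U_(Y d)) =
      z + U_(Y d) + (U_(X y) + U_(Y x)))%MM.
    by apply/mnmP => i; rewrite !mnmDE; lia.
  have [lt_b|le_b] := ltnP b b'.
    exists (m1 + edge_mon b' a)%MM; split; last exact: moves0.
    apply: moves1; exists b, b', (m2 + U_(Y a))%MM; split.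
    + exact: E_out Eab Eab' lt_b.
    + by rewrite e0 swap.
    + by rewrite e1 swap.
  have lt_b : (b' < b)%N by rewrite ltn_neqAle le_b eq_sym val_eqE nb.
  exists (m0 + edge_mon b a)%MM; split; first exact: moves0.
  apply: moves1; exists b', b, (m2 + U_(Y a))%MM; split.
  + exact: E_out Eab' Eab lt_b.
  + by rewrite e1 swap.
  + by rewrite e0 swap.
have [eb|nb] := eqVneq b b'.
  rewrite -{}eb in Eab' e *.
  have [|i|m2 [e0 e1]] := @common_part _ m0 m1 U_(X a)%MM U_(X a')%MM.
  - by apply: (@addIm _ U_(Y b)%MM); rewrite -!addmA.
  - rewrite !mnm1E; case: eqP => [<-|_]; [right|by left].
    by rewrite (inj_eq (@lshift_inj _ _)) eq_sym (negPf na).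
  have swap x y (z : mon) d : (z + U_(X x) + (U_(X y) + U_(Y d)) =
      z + U_(X y) + (U_(X x) + U_(Y d)))%MM.
    by apply/mnmP => i; rewrite !mnmDE; lia.
  have [lt_a|le_a] := ltnP a a'.
    exists (m0 + edge_mon b a)%MM; split; first exact: moves0.
    apply: moves1; exists a, a', (m2 + U_(X b))%MM; split.
    + exact: E_in Eab Eab' lt_a.
    + by rewrite e1 swap.
    + by rewrite e0 swap.
  have lt_a : (a' < a)%N by rewrite ltn_neqAle le_a eq_sym val_eqE na.
  exists (m1 + edge_mon b a')%MM; split; last exact: moves0.
  apply: moves1; exists a', a, (m2 + U_(X b))%MM; split.
  + exact: E_in Eab' Eab lt_a.
  + by rewrite e0 swap.
  + by rewrite e1 swap.
have [i|m2 [-> ->]] := common_part e.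
  rewrite !mnmDE !mnm1E.
  case: (X a =P i) => [<-|_].
    by rewrite (inj_eq (@lshift_inj _ _)) [a' == a]eq_sym (negPf na) !eq_rlshift; right.
  case: (Y b =P i) => [<-|_]; last by left.
  by rewrite (inj_eq (@rshift_inj _ _)) [b' == b]eq_sym (negPf nb) !eq_lrshift; right.
exists (m2 + edge_mon b a + edge_mon b' a')%MM; split; apply: moves1.
  by exists a', b', (m2 + edge_mon b a)%MM; split=> //; apply/mnmP => i;
    rewrite !mnmDE; lia.
by exists a, b, (m2 + edge_mon b' a')%MM; split=> //; apply/mnmP => i;
  rewrite !mnmDE; lia.
Qed.

Definition normal_form (m n : mon) := moves m n /\ ~~ reducible n.

Lemma moves_mdeg m n : moves m n -> mdeg n = mdeg m.
Proof. by elim=> // {}m p q /move_mdeg <-. Qed.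

Lemma moves_lex m n : moves m n -> n = m \/ lex_lt n m.
Proof.
elim=> [|{}m p q /move_lex lt_p _ [->|lt_q]]; [by left|by right|right].
exact: lex_lt_trans lt_q lt_p.
Qed.

(** Newman's lemma: moves terminate, because they decrease the monomial, so
    local confluence makes normal forms unique. *)
Lemma normal_form_unique m : exists n, normal_form m n /\
  forall n', normal_form m n' -> n' = n.
Proof.
suff main d k x : mdeg x = d -> (lexrank d.+1 x < k)%N ->
    exists n, normal_form x n /\ forall n', normal_form x n' -> n' = n.
  exact: main erefl (ltnSn _).
elim: k x => // k IHk x dx; rewrite ltnS => le_x.
have next p : move x p -> exists n, normal_form p n /\
    forall n', normal_form p n' -> n' = n.
  move=> xp; apply: IHk; first by rewrite (move_mdeg xp).
  by apply: leq_trans le_x; apply: lexrank_lt (move_lex xp); rewrite (move_mdeg xp) dx.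
have [/reducibleP[p xp]|nx] := boolP (reducible x); last first.
  exists x; split=> [|n [mv nn]]; first by split=> //; apply: moves0.
  case: mv nn => // p q xp _ _; case/negP: nx; apply/reducibleP; by exists p.
have [n [[pn nn] uniq_p]] := next p xp.
exists n; split=> [|n' [xn' nn']]; first by split=> //; apply: movesS xp pn.
case: xn' nn' => [nx|q {}n' xq qn' nn'].
  by case/negP: nx; apply/reducibleP; exists p.
have [r [pr qr]] := move_confluent xp xq.
have [n'' [[qn'' _] uniq_q]] := next q xq.
have [y [[ry ny] _]] : exists y, normal_form r y /\ True.
  have r_d : mdeg r = d by rewrite (moves_mdeg pr) (move_mdeg xp).
  have lt_r : (lexrank d.+1 r < k)%N.
    apply: leq_trans le_x; apply: lexrank_lt; first by rewrite r_d.
    case: (moves_lex pr) => [->|lt_r]; first exact: move_lex xp.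
    exact: lex_lt_trans lt_r (move_lex xp).
  by have [y [hy _]] := IHk r r_d lt_r; exists y.
have ey : y = n by apply: uniq_p; split=> //; apply: moves_trans pr ry.
have ey' : y = n'' by apply: uniq_q; split=> //; apply: moves_trans qr ry.
by rewrite (uniq_q n') // -ey' ey.
Qed.

Lemma nf_exists : exists nf : mon -> mon,
  [/\ forall m, moves m (nf m), forall m, ~~ reducible m -> nf m = m &
      forall m p, move m p -> nf p = nf m].
Proof.
have [nf hnf] := choice_fun normal_form_unique.
exists nf; split=> [m|m nm|m p mp]; first by case: (hnf m) => -[].
  by case: (hnf m) => _ h; apply/esym/h; split=> //; apply: moves0.
case: (hnf m) => _; apply; case: (hnf p) => -[pn nn] _; split=> //.
exact: movesS mp pn.
Qed.

Lemma reducible_up m k : reducible m -> reducible (m + k)%MM.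
Proof.
by move/reducibleP=> [p /(move_add k) mp]; apply/reducibleP; rewrite addmC;
  exists (k + p)%MM.
Qed.

Section Ideal.
Local Open Scope ring_scope.
Variable K : fieldType.
Local Notation R := {mpoly K[c + c]}.

Definition edge_binomial (g : R) := exists a b,
  E a b /\ g = 'X_[edge_mon a b] - 'X_[edge_mon b a].

Local Notation J := (ideal_gen edge_binomial).

Lemma move_ideal m p : move m p -> J ('X_[m] - 'X_[p]).
Proof.
case=> a [b [m0 [Eab -> ->]]].
exists [:: ('X_[m0], 'X_[edge_mon a b] - 'X_[edge_mon b a])]; split.
  by move=> q; rewrite inE => /eqP ->; exists a, b.
by rewrite big_seq1 /= mulrBr -!mpolyXD.
Qed.

(** When [nf] is constant along moves, this is a linear functional that vanishes
    on the ideal of the edge binomials. *)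
Definition class_sum (nf : mon -> mon) n (f : R) : K :=
  \sum_(m <- msupp f | nf m == n) f@_m.

Lemma class_sumE nf n f k : (msize f <= k)%N ->
  class_sum nf n f = \sum_(m : 'X_{1..(c + c) < k} | nf m == n) f@_m.
Proof.
move=> le_fk; pose B : subFinType _ := 'X_{1..(c + c) < k}.
rewrite /class_sum (big_mksub_cond B) //=; first last.
- by move=> x /msize_mdeg_lt/leq_trans/(_ le_fk) ->.
- by rewrite msupp_uniq.
rewrite -big_filter_cond big_rmcond ?big_filter //=.
by move=> m /memN_msupp_eq0 ->.
Qed.

Lemma class_sum_linear nf n a f g :
  class_sum nf n (a *: f + g) = a * class_sum nf n f + class_sum nf n g.
Proof.
pose k := maxn (msize (a *: f + g)) (maxn (msize f) (msize g)).
rewrite !(class_sumE nf n (k := k)) ?leq_max ?leqnn ?orbT //.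
by rewrite mulr_sumr -big_split; apply: eq_bigr => m _; rewrite mcoeffD mcoeffZ.
Qed.

Lemma class_sum0 nf n : class_sum nf n 0 = 0.
Proof. by rewrite /class_sum msupp0 big_nil. Qed.

Lemma class_sumX nf n m : class_sum nf n 'X_[m] = (nf m == n)%:R.
Proof.
rewrite /class_sum msuppX big_mkcond big_seq1 mcoeffX eqxx.
by case: (_ == _).
Qed.

(** The class sums vanish on the ideal, and a monomial in normal form that leads
    [f] is alone in its class within [f]. *)
Theorem closed_graph_lead_set : lead_set J reducible.
Proof.
have [nf [nf_moves nf_id nf_move]] := nf_exists.
have J_class f n : J f -> class_sum nf n f = 0.
  case=> r [hr ->]; elim: r hr => [|p r IHr] hr.
    by rewrite big_nil class_sum0.
  rewrite big_cons -[p.1 * p.2]scale1r class_sum_linear IHr ?addr0 ?mul1r; last first.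
    by move=> q q_r; apply: hr; rewrite inE q_r orbT.
  have [a [b [Eab ->]]] := hr p (mem_head _ _).
  rewrite [p.1]mpolyE mulr_suml; elim: (msupp p.1) => [|m s IHs].
    by rewrite big_nil class_sum0.
  rewrite big_cons -scalerAl class_sum_linear IHs addr0 mulrBr -!mpolyXD.
  rewrite addrC -scaleN1r class_sum_linear !class_sumX.
  rewrite (nf_move (m + edge_mon a b)%MM (m + edge_mon b a)%MM).
    by rewrite mulN1r addNr mulr0.
  by exists a, b, m.
split=> [f m Jf [m_f f_lead]|m /reducibleP[p mp]]; last first.
  exists ('X_[m] - 'X_[p]); split; first exact: move_ideal.
    have pm : p != m by apply: contraTneq (move_lex mp) => ->; rewrite lex_lt_irr.
    split; first by rewrite mcoeff_msupp mcoeffB !mcoeffX eqxx (negPf pm) subr0 oner_eq0.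
    move=> m' /msuppB_le; rewrite mem_cat !msuppX !inE.
    by case/orP=> /eqP ->; rewrite ?eqxx // => _; apply: move_lex.
  by apply: rpredB; rewrite dhomogX //; apply/eqP/move_mdeg.
apply: contraTT (m_f) => nm; rewrite mcoeff_msupp negbK -(J_class f m Jf).
have := sum_msupp1 xpredT f m; rewrite /= => <-.
rewrite /class_sum big_seq_cond [X in _ == X]big_seq_cond; apply/eqP/eq_bigl => m'.
apply: andb_id2l => m'_f; apply/eqP/eqP => [->|e]; first exact: nf_id.
have [//|ne] := eqVneq m' m.
have := nf_moves m'; rewrite e => /moves_lex[em|lt_m]; first by rewrite em eqxx in ne.
by have := lex_lt_trans lt_m (f_lead _ m'_f ne); rewrite lex_lt_irr.
Qed.

Lemma edge_ideal_gideal : gideal J.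
Proof.
apply: ideal_gen_gideal => _ [a [b [_ ->]]]; exists 2.
have e x y : mdeg (edge_mon x y) = 2 by rewrite mdegD !mdeg1.
by apply: rpredB; rewrite dhomogX; apply/eqP/e.
Qed.

Lemma edge_ideal_proper : proper_gideal J.
Proof.
split=> [|_ [r [hr ->]]]; first exact: edge_ideal_gideal.
rewrite raddf_sum big_seq big1 // => p /hr[a [b [_ ->]]] /=.
rewrite rmorphM /= mcoeffB !mcoeffX.
have e (x y : 'I_c) : (edge_mon x y == 0%MM) = false by rewrite mnmD_eq0 !mnm1_eq0.
by rewrite !e subrr mulr0.
Qed.

Lemma initial_edge_ideal : is_monomial_ideal (initial_ideal J) reducible.
Proof.
split; first exact: initial_idealE closed_graph_lead_set reducible_up.
  exact: reducible_up.
by apply/negP => /existsP[a /existsP[b]]; rewrite mnm0E andbF.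
Qed.

End Ideal.
End Moves.

(** * Closed graphs *)

Section InitialCorner.
Local Open Scope ring_scope.
Variables (K : fieldType) (N : nat) (I : {mpoly K[N]} -> Prop) (L : pred 'X_{1..N}).
Hypotheses (pI : proper_gideal I) (hL : lead_set I L)
  (hM : is_monomial_ideal (initial_ideal I) L).

(** Upper semicontinuity of Betti numbers under passing to the initial ideal,
    in its qualitative form. *)
Lemma betti_initial i j : betti I i j <> 0%N -> betti (initial_ideal I) i j <> 0%N.
Proof.
move=> nz; have [_ L_up _] := hM; have val_inj' := val_inj : injective (val : 'I_N -> nat).
apply/(monomial_betti hM i j val_inj'); apply: NNPP => no; apply: nz.
apply/(betti_eq0 val_inj') => //.
apply: (Kvan_of_initial val_inj' L_up (proj1 pI) hL) => a da.
by apply: NNPP => nv; apply: no; exists a.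
Qed.

(** A nonzero corner of the Betti table of the initial ideal cannot cancel, as
    its internal degree contains no other Betti number of either ideal; so it
    is inherited by the ideal, and with it the two extremal invariants. *)
Theorem initial_ideal_corner p r :
  (forall i j, betti (initial_ideal I) i j <> 0%N -> (i <= p)%N /\ (j <= i + r)%N) ->
  betti (initial_ideal I) p (p + r) <> 0%N ->
  [/\ betti I p (p + r) = betti (initial_ideal I) p (p + r) /\
        betti (initial_ideal I) p (p + r) <> 0%N,
      is_reg I r /\ is_reg (initial_ideal I) r &
      is_pd I p /\ is_pd (initial_ideal I) p].
Proof.
move=> bM nzM.
have bI i j : betti I i j <> 0%N -> (i <= p)%N /\ (j <= i + r)%N.
  by move/betti_initial/bM.
have e : betti I p (p + r) = betti (initial_ideal I) p (p + r).
  apply: (betti_corner (rho := val) val_inj pI (monomial_proper_gideal hM) hL) => //.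
  exact: monomial_lead_set.
have nzI : betti I p (p + r) <> 0%N by rewrite e.
do 2!split=> //; split; try (by exists p); try (by exists (p + r)%N).
- by move=> i j /bI[].
- by move=> i j /bM[].
- by move=> i j /bI[].
by move=> i j /bM[].
Qed.

End InitialCorner.

Section ClosedGraphIdeal.
Variables (n : nat) (G : lgraph n).
Local Notation c := #|vset G|.

Definition oriented_edge : rel 'I_c := fun a b =>
  edge G (enum_val a) (enum_val b) && (enum_val a < enum_val b)%N.

(** The enumeration of a set of vertices is increasing. *)
Lemma enum_val_lt (a b : 'I_c) : (enum_val a < enum_val b)%N = (a < b)%N.
Proof.
have mono (x y : 'I_c) : (x < y)%N -> (enum_val x < enum_val y)%N.
  move=> lt_xy; have [v0 _] : exists v0 : 'I_n, true by exists (enum_val x).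
  rewrite !(enum_val_nth v0).
  have tr : transitive (fun i j : 'I_n => (i < j)%N) by move=> ? ? ?; apply: ltn_trans.
  apply: (sorted_ltn_nth tr) => //; rewrite ?inE -?cardE //.
  apply: (sorted_filter tr).
  by have := iota_ltn_sorted 0 n; rewrite -val_enum_ord sorted_map enumT.
apply/idP/idP => [lt_ab|]; last exact: mono.
rewrite ltnNge leq_eqVlt; apply/negP => /predU1P[/val_inj e|/mono].
  by rewrite e ltnn in lt_ab.
by rewrite ltnNge ltnW.
Qed.

Lemma oriented_edge_lt a b : oriented_edge a b -> (a < b)%N.
Proof. by case/andP=> _; rewrite enum_val_lt. Qed.

Hypothesis G_closed : closed_graph G.

Lemma oriented_edge_out a b d : oriented_edge a b -> oriented_edge a d -> (b < d)%N ->
  oriented_edge b d.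
Proof.
case/andP=> eab lab /andP[ead lad] lt_bd; rewrite /oriented_edge enum_val_lt lt_bd andbT.
apply: (G_closed _ eab ead); last by rewrite lab lad.
by apply: contraTneq lt_bd => /enum_val_inj ->; rewrite ltnn.
Qed.

Lemma oriented_edge_in a b d : oriented_edge a d -> oriented_edge b d -> (a < b)%N ->
  oriented_edge a b.
Proof.
case/andP=> ead lad /andP[ebd lbd] lt_ab; rewrite /oriented_edge enum_val_lt lt_ab andbT.
rewrite edge_sym in ead; rewrite edge_sym in ebd.
apply: (G_closed _ ead ebd); last by rewrite lad lbd orbT.
by apply: contraTneq lt_ab => /enum_val_inj ->; rewrite ltnn.
Qed.

Lemma binom_edge_idealE (K : fieldType) :
  binom_edge_ideal K G = ideal_gen (edge_binomial oriented_edge (K := K)).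
Proof.
rewrite /binom_edge_ideal; congr ideal_gen.
apply: functional_extensionality => g; apply: propositional_extensionality.
split=> [[a [b [eab lab ->]]]|[a [b [/andP[eab lab] ->]]]]; exists a, b.
  by rewrite /oriented_edge eab lab !mpolyXD.
by rewrite !mpolyXD.
Qed.

Definition graph_red := reducible oriented_edge.

Lemma binom_edge_lead_set (K : fieldType) : lead_set (binom_edge_ideal K G) graph_red.
Proof.
rewrite binom_edge_idealE.
exact: closed_graph_lead_set oriented_edge_lt oriented_edge_out oriented_edge_in _.
Qed.

Lemma binom_edge_proper (K : fieldType) : proper_gideal (binom_edge_ideal K G).
Proof. rewrite binom_edge_idealE; exact: edge_ideal_proper. Qed.

Lemma binom_edge_initial (K : fieldType) :
  is_monomial_ideal (initial_ideal (binom_edge_ideal K G)) graph_red.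
Proof.
rewrite binom_edge_idealE.
exact: initial_edge_ideal oriented_edge_lt oriented_edge_out oriented_edge_in _.
Qed.

End ClosedGraphIdeal.
Arguments graph_red {n} G _.

(** * Graphs glued at a cut point *)

Section Gluing.
Variables (n : nat) (v : 'I_n).
Implicit Types G : lgraph n.

Lemma edge_vset2 G u w : edge G u w -> u \in vset G /\ w \in vset G.
Proof. by move=> e; split; [|rewrite edge_sym in e]; apply: edge_vset e. Qed.

Lemma edge_neq G u w : edge G u w -> u != w.
Proof. by move=> e; apply: contraTneq e => ->; rewrite edge_irr. Qed.

Definition glued_at G G1 G2 :=
  is_union G G1 G2 /\ vset G1 :&: vset G2 = [set v].

Lemma glued_at_sym G G1 G2 : glued_at G G1 G2 -> glued_at G G2 G1.
Proof.
case=> -[hV hE] hI; split; last by rewrite setIC.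
by split=> [|u w]; rewrite 1?setUC // hE orbC.
Qed.

Section Glued.
Variables G G1 G2 : lgraph n.
Hypothesis hG : glued_at G G1 G2.

Lemma glued_vertex u : u \in vset G1 -> u \in vset G2 -> u = v.
Proof. by move=> u1 u2; apply/set1P; rewrite -(proj2 hG) inE u1. Qed.

Lemma cut_in1 : v \in vset G1.
Proof. by have := set11 v; rewrite -(proj2 hG) inE => /andP[]. Qed.

Lemma cut_in2 : v \in vset G2.
Proof. by have := set11 v; rewrite -(proj2 hG) inE => /andP[]. Qed.

Lemma edge_glued u w : edge G u w = edge G1 u w || edge G2 u w.
Proof. by case: hG => -[_ ->]. Qed.

Lemma vset_glued u : (u \in vset G) = (u \in vset G1) || (u \in vset G2).
Proof. by case: hG => -[-> _] _; rewrite inE. Qed.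

Lemma closed_sub : closed_graph G -> closed_graph G1.
Proof.
move=> Gc i j k jk eij eik lt.
have : edge G j k by apply: (Gc i) => //; rewrite edge_glued ?eij ?eik.
rewrite edge_glued => /orP[//|/edge_vset2[j2 k2]].
have [_ j1] := edge_vset2 eij; have [_ k1] := edge_vset2 eik.
by rewrite (glued_vertex j1 j2) (glued_vertex k1 k2) eqxx in jk.
Qed.

(** Without an edge of [G1] at the cut point, [G1] would be a single point and
    the cut point would already cut [G2]. *)
Lemma cut_neighbour : connected G -> cut_point G v -> ~ cut_point G2 v ->
  exists a, edge G1 v a.
Proof.
move=> Gconn [_ vG Gcut] n2; apply: NNPP => no.
have V1 u : u \in vset G1 -> u = v.
  move=> u1; apply/eqP/negPn/negP => uv.
  have Gsym : connect_sym (edge G) by apply: sym_connect_sym => x y; apply: edge_sym.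
  have V1_closed : closed (edge G) (mem (vset G1 :\ v)).
    apply: (intro_closed Gsym) => x y; rewrite edge_glued !inE => exy /andP[xv x1].
    case/orP: exy => [exy|/edge_vset/(glued_vertex x1) e]; last by rewrite e eqxx in xv.
    have [_ ->] := edge_vset2 exy; rewrite andbT; apply/eqP => e; apply: no.
    by exists x; rewrite edge_sym -e.
  have uG : u \in vset G by rewrite vset_glued u1.
  have := closed_connect V1_closed (Gconn u v uG vG).
  by rewrite !inE eqxx uv u1.
have eE : edge G =2 edge G2.
  move=> x y; rewrite edge_glued; case: (boolP (edge G1 x y)) => // e.
  by have [/V1 x1 /V1 y1] := edge_vset2 e; move: e; rewrite x1 y1 edge_irr.
have eV : vset G = vset G2.
  apply/setP => u; rewrite vset_glued; case: (boolP (u \in vset G1)) => // /V1 ->.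
  by rewrite cut_in2.
apply: n2; split; first by move=> x y x2 y2; rewrite -(eq_connect eE); apply: Gconn; rewrite eV.
  exact: cut_in2.
move=> h; apply: Gcut => x y; rewrite /= eV => x2 y2.
rewrite (@eq_connect _ _ (edge (del_vertex G2 v))); first exact: h.
by move=> a b; rewrite /= /del_edge eE.
Qed.

(** In a closed graph two neighbours of [v] on the same side of [v] are
    adjacent, which neighbours in different parts are not. *)
Lemma opposite_sides x y : closed_graph G -> edge G1 v x -> edge G2 v y ->
  (x < v < y)%N \/ (y < v < x)%N.
Proof.
move=> Gc ex ey; have [_ x1] := edge_vset2 ex; have [_ y2] := edge_vset2 ey.
have xv := edge_neq ex; have yv := edge_neq ey.
have xy : x != y.
  by apply: contraNneq xv => e; rewrite eq_sym -(glued_vertex x1) ?e.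
have nxy : ~ edge G x y.
  rewrite edge_glued => /orP[/edge_vset2[_ y1]|/edge_vset x2].
    by rewrite (glued_vertex y1 y2) eqxx in yv.
  by rewrite (glued_vertex x1 x2) eqxx in xv.
have ex' : edge G v x by rewrite edge_glued ex.
have ey' : edge G v y by rewrite edge_glued ey orbT.
have h := Gc v x y xy ex' ey'.
case: (ltngtP x v) => [lt_x|lt_x|/val_inj e]; last by rewrite e eqxx in xv.
  case: (ltngtP y v) => [lt_y|lt_y|/val_inj e]; last by rewrite e eqxx in yv.
    by case: nxy; apply: h; rewrite lt_x lt_y orbT.
  by left.
case: (ltngtP y v) => [lt_y|lt_y|/val_inj e]; last by rewrite e eqxx in yv.
  by right.
by case: nxy; apply: h; rewrite lt_x lt_y.
Qed.

End Glued.

Definition ordered_at G1 G2 :=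
  (forall w, edge G1 v w -> (w < v)%N) /\ (forall w, edge G2 v w -> (v < w)%N).

(** One neighbour of [v] in each part determines the side of all neighbours in
    the other part. *)
Lemma cut_point_order G G1 G2 : glued_at G G1 G2 -> connected G ->
  closed_graph G -> cut_point G v -> ~ cut_point G1 v -> ~ cut_point G2 v ->
  ordered_at G1 G2 \/ ordered_at G2 G1.
Proof.
move=> hG Gconn Gc Gv n1 n2.
have [a ea] := cut_neighbour hG Gconn Gv n2.
have [b eb] := cut_neighbour (glued_at_sym hG) Gconn Gv n1.
have opp x y := @opposite_sides _ _ _ hG x y Gc.
case: (opp a b ea eb) => /andP[h1 h2]; [left|right]; split=> w ew.
- by case: (opp w b ew eb) => /andP[]; lia.
- by case: (opp a w ea ew) => /andP[]; lia.
- by case: (opp a w ea ew) => /andP[]; lia.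
by case: (opp w b ew eb) => /andP[]; lia.
Qed.

End Gluing.

(** ** Splitting the variables *)

Section SplitVariables.
Variables (n : nat) (v : 'I_n) (G G1 G2 : lgraph n).
Hypotheses (hG : glued_at v G G1 G2) (hv : ordered_at v G1 G2).
Local Notation c := #|vset G|.
Local Notation c1 := #|vset G1|.
Local Notation c2 := #|vset G2|.

Let v1 : v \in vset G1 := cut_in1 hG.
Let v2 : v \in vset G2 := cut_in2 hG.

(** The generators of the two initial ideals involve disjoint sets of variables:
    [y_v] goes with [G1], where [v] is only the larger end of an edge, and [x_v]
    goes with [G2], where it is only the smaller end. *)
Definition split_var (k : 'I_(c + c)) : 'I_(c1 + c1) + 'I_(c2 + c2) :=
  match split k with
  | inl a => let u := enum_val a in
      if (u \in vset G1) && (u != v) then inl (lshift c1 (enum_rank_in v1 u))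
      else inr (lshift c2 (enum_rank_in v2 u))
  | inr a => let u := enum_val a in
      if u \in vset G1 then inl (rshift c1 (enum_rank_in v1 u))
      else inr (rshift c2 (enum_rank_in v2 u))
  end.

Lemma split_lshift a : split (lshift c a : 'I_(c + c)) = inl a.
Proof. exact: (unsplitK (inl a)). Qed.

Lemma split_rshift a : split (rshift c a : 'I_(c + c)) = inr a.
Proof. exact: (unsplitK (inr a)). Qed.

Variant split_var_spec (k : 'I_(c + c)) : 'I_(c1 + c1) + 'I_(c2 + c2) -> Prop :=
| SplitX1 a a1 of k = lshift c a & enum_val a = enum_val a1 & enum_val a != v :
    split_var_spec k (inl (lshift c1 a1))
| SplitX2 a a2 of k = lshift c a & enum_val a = enum_val a2 :
    split_var_spec k (inr (lshift c2 a2))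
| SplitY1 a a1 of k = rshift c a & enum_val a = enum_val a1 :
    split_var_spec k (inl (rshift c1 a1))
| SplitY2 a a2 of k = rshift c a & enum_val a = enum_val a2 & enum_val a != v :
    split_var_spec k (inr (rshift c2 a2)).

Lemma split_varP k : split_var_spec k (split_var k).
Proof.
have in2 (a : 'I_c) : ~~ (enum_val a \in vset G1) -> enum_val a \in vset G2.
  by move=> n1; have := enum_valP a; rewrite (vset_glued hG) (negPf n1).
rewrite -(splitK k) /split_var; case: (split k) => a /=.
  rewrite split_lshift; case: ifP => [/andP[a1 av]|/negbT].
    by apply: (SplitX1 (a := a)); rewrite ?enum_rankK_in.
  rewrite negb_and negbK => h; apply: (SplitX2 (a := a)) => //.
  by rewrite enum_rankK_in //; case/orP: h => [/in2//|/eqP ->].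
rewrite split_rshift; case: ifP => [a1|/negbT n1].
  by apply: (SplitY1 (a := a)); rewrite ?enum_rankK_in.
apply: (SplitY2 (a := a)); rewrite ?enum_rankK_in ?in2 //.
by apply: contraNneq n1 => ->.
Qed.

Lemma split_var_inj : injective split_var.
Proof.
have vG : v \in vset G by rewrite (vset_glued hG) v1.
pose back (s : 'I_(c1 + c1) + 'I_(c2 + c2)) : 'I_(c + c) :=
  let x u := lshift c (enum_rank_in vG u) in let y u := rshift c (enum_rank_in vG u) in
  match s with
  | inl i => match split i with inl a => x (enum_val a) | inr a => y (enum_val a) end
  | inr i => match split i with inl a => x (enum_val a) | inr a => y (enum_val a) end
  end.
apply: (can_inj (g := back)) => k.
have sl m (a : 'I_m) : split (lshift m a) = inl a by exact: (unsplitK (inl a)).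
have sr m (a : 'I_m) : split (rshift m a) = inr a by exact: (unsplitK (inr a)).
by case: split_varP => a b -> e; rewrite /back ?sl ?sr -e enum_valK_in.
Qed.

Local Notation left := (left_var split_var).
Local Notation right := (right_var split_var).

Lemma left_x (a : 'I_c) (b : 'I_c1) : enum_val a = enum_val b -> enum_val b != v ->
  left (lshift c a) = Some (lshift c1 b).
Proof.
move=> e bv; rewrite /left_var /split_var split_lshift e enum_valP bv /=.
by rewrite enum_valK_in.
Qed.

Lemma left_y (a : 'I_c) (b : 'I_c1) : enum_val a = enum_val b ->
  left (rshift c a) = Some (rshift c1 b).
Proof.
by move=> e; rewrite /left_var /split_var split_rshift e enum_valP enum_valK_in.
Qed.

Lemma right_x (a : 'I_c) (b : 'I_c2) : enum_val a = enum_val b ->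
  right (lshift c a) = Some (lshift c2 b).
Proof.
move=> e; rewrite /right_var /split_var split_lshift e ifF ?enum_valK_in //.
by apply/negbTE/negP => /andP[b1]; rewrite (glued_vertex hG b1 (enum_valP b)) eqxx.
Qed.

Lemma right_y (a : 'I_c) (b : 'I_c2) : enum_val a = enum_val b -> enum_val b != v ->
  right (rshift c a) = Some (rshift c2 b).
Proof.
move=> e bv; rewrite /right_var /split_var split_rshift e ifF ?enum_valK_in //.
by apply: contraNF bv => b1; apply/eqP/(glued_vertex hG b1 (enum_valP b)).
Qed.

Lemma left_x_inv k (b : 'I_c1) : left k = Some (lshift c1 b) ->
  exists2 a, k = lshift c a & enum_val a = enum_val b.
Proof.
rewrite /left_var; case: split_varP => a b' // -> e => [_ /Some_inj/lshift_inj <-|/Some_inj h].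
  by exists a.
by have := eq_rlshift b' b; rewrite h eqxx.
Qed.

Lemma left_y_inv k (b : 'I_c1) : left k = Some (rshift c1 b) ->
  exists2 a, k = rshift c a & enum_val a = enum_val b.
Proof.
rewrite /left_var; case: split_varP => a b' // -> e => [_ /Some_inj h|/Some_inj/rshift_inj <-].
  by have := eq_lrshift b' b; rewrite h eqxx.
by exists a.
Qed.

Lemma right_x_inv k (b : 'I_c2) : right k = Some (lshift c2 b) ->
  exists2 a, k = lshift c a & enum_val a = enum_val b.
Proof.
rewrite /right_var; case: split_varP => a b' // -> e => [/Some_inj/lshift_inj <-|_ /Some_inj h].
  by exists a.
by have := eq_rlshift b' b; rewrite h eqxx.
Qed.

Lemma right_y_inv k (b : 'I_c2) : right k = Some (rshift c2 b) ->
  exists2 a, k = rshift c a & enum_val a = enum_val b.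
Proof.
rewrite /right_var; case: split_varP => a b' // -> e => [/Some_inj h|_ /Some_inj/rshift_inj <-].
  by have := eq_lrshift b' b; rewrite h eqxx.
by exists a.
Qed.

Lemma reducible_free m0 (E : rel 'I_m0) i (m : 'X_{1..(m0 + m0)}) :
  (forall a b, E a b -> lshift m0 a != i /\ rshift m0 b != i) ->
  reducible E (m + U_(i))%MM = reducible E m.
Proof.
move=> h; apply: eq_existsb => a; apply: eq_existsb => b; apply: andb_id2l => Eab.
have [na nb] := h a b Eab.
by rewrite !mnmDE !mnm1E ![i == _]eq_sym (negPf na) (negPf nb) !addn0.
Qed.

Lemma index_glued u : u \in vset G -> exists a : 'I_c, enum_val a = u.
Proof. by move=> uG; exists (enum_rank_in uG u); rewrite enum_rankK_in. Qed.

Lemma index1 (b : 'I_c1) : exists a : 'I_c, enum_val a = enum_val b.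
Proof. by apply: index_glued; rewrite (vset_glued hG) enum_valP. Qed.

Lemma index2 (b : 'I_c2) : exists a : 'I_c, enum_val a = enum_val b.
Proof. by apply: index_glued; rewrite (vset_glued hG) enum_valP orbT. Qed.

(** The only such variable of [G1] is [x_v], as [v] is above its neighbours. *)
Lemma graph_red_free1 i : (forall k, left k <> Some i) ->
  forall m, graph_red G1 (m + U_(i))%MM = graph_red G1 m.
Proof.
move=> no m; apply: reducible_free => a b /andP[eab lt_ab]; split; apply/eqP => e.
  have [a' ea] := index1 a; case: (eqVneq (enum_val a) v) => [av|av].
    rewrite av in eab lt_ab; have := proj1 hv _ eab.
    by rewrite ltnNge ltnW.
  by apply: (no (lshift c a')); rewrite -e; apply: left_x.
have [b' eb] := index1 b.
by apply: (no (rshift c b')); rewrite -e; apply: left_y.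
Qed.

(** The only such variable of [G2] is [y_v], as [v] is below its neighbours. *)
Lemma graph_red_free2 i : (forall k, right k <> Some i) ->
  forall m, graph_red G2 (m + U_(i))%MM = graph_red G2 m.
Proof.
move=> no m; apply: reducible_free => a b /andP[eab lt_ab]; split; apply/eqP => e.
  have [a' ea] := index2 a.
  by apply: (no (lshift c a')); rewrite -e; apply: right_x.
have [b' eb] := index2 b; case: (eqVneq (enum_val b) v) => [bv|bv].
  rewrite edge_sym bv in eab; have := proj2 hv _ eab.
  by rewrite bv in lt_ab; rewrite ltnNge ltnW.
by apply: (no (rshift c b')); rewrite -e; apply: right_y.
Qed.

Lemma pull_neq0 M (t : 'I_(c + c) -> option 'I_M) m i :
  (forall k l j, t k = Some j -> t l = Some j -> k = l) ->
  pull t m i != 0 -> exists2 k, t k = Some i & m k != 0.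
Proof.
move=> t_inj; case: (t_image t i) => [[k tk]|no]; last by rewrite pull_out.
by rewrite (pullE t_inj _ tk) => nz; exists k.
Qed.

(** An edge of [G] lies in one of the parts, and both variables of its leading
    monomial go with that part: if the part is [G1] the first of them is not [x_v],
    and if it is [G2] the second is not [y_v]. *)
Lemma graph_red_split m :
  graph_red G m = graph_red G1 (pull left m) || graph_red G2 (pull right m).
Proof.
have linj := left_var_inj split_var_inj; have rinj := right_var_inj split_var_inj.
apply/existsP/orP.
  case=> a /existsP[b /and3P[/andP[eab lt_ab] ma mb]].
  have idx (H : lgraph n) u : u \in vset H ->
      exists x : 'I_#|vset H|, enum_val x = u.
    by move=> uH; exists (enum_rank_in uH u); rewrite enum_rankK_in.
  have := eab; rewrite (edge_glued hG) => /orP[e1|e2]; [left|right].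
    have [/idx[a' ea] /idx[b' eb]] := edge_vset2 e1.
    apply/existsP; exists a'; apply/existsP; exists b'.
    rewrite /oriented_edge ea eb e1 lt_ab /=.
    rewrite (pullE linj _ (left_y (esym eb))) mb andbT.
    rewrite (pullE linj _ (left_x (esym ea) _)) ?ma // ea.
    apply: contraTneq lt_ab => av; rewrite av in e1 *.
    by rewrite -leqNgt ltnW // (proj1 hv).
  have [/idx[a' ea] /idx[b' eb]] := edge_vset2 e2.
  apply/existsP; exists a'; apply/existsP; exists b'.
  rewrite /oriented_edge ea eb e2 lt_ab /=.
  rewrite (pullE rinj _ (right_x (esym ea))) ma /=.
  rewrite (pullE rinj _ (right_y (esym eb) _)) ?mb // eb.
  apply: contraTneq lt_ab => bv; rewrite bv edge_sym in e2 *.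
  by rewrite -leqNgt ltnW // (proj2 hv).
case=> /existsP[a /existsP[b /and3P[/andP[eab lt_ab] ma mb]]].
  have [_ /left_x_inv[a' -> ea] ma'] := pull_neq0 linj ma.
  have [_ /left_y_inv[b' -> eb] mb'] := pull_neq0 linj mb.
  exists a'; apply/existsP; exists b'; rewrite ma' mb' andbT.
  by rewrite /oriented_edge ea eb (edge_glued hG) eab lt_ab.
have [_ /right_x_inv[a' -> ea] ma'] := pull_neq0 rinj ma.
have [_ /right_y_inv[b' -> eb] mb'] := pull_neq0 rinj mb.
exists a'; apply/existsP; exists b'; rewrite ma' mb' andbT.
by rewrite /oriented_edge ea eb (edge_glued hG) eab orbT lt_ab.
Qed.

End SplitVariables.

(** Extremal data of the parts add up: for the initial ideal by the Kuenneth
    formula, and then for the binomial edge ideal itself. *)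
Lemma glued_corner (K : fieldType) (n : nat) (v : 'I_n) (G G1 G2 : lgraph n)
    (p1 p2 r1 r2 : nat) (M := fun H => initial_ideal (binom_edge_ideal K H))
    (J := binom_edge_ideal K G) :
  glued_at v G G1 G2 -> ordered_at v G1 G2 -> closed_graph G ->
  is_pd (M G1) p1 -> is_pd (M G2) p2 -> is_reg (M G1) r1 -> is_reg (M G2) r2 ->
  betti (M G1) p1 (p1 + r1) <> 0 -> betti (M G2) p2 (p2 + r2) <> 0 ->
  let p := p1 + p2 in let r := r1 + r2 in
  [/\ betti J p (p + r) = betti (initial_ideal J) p (p + r)
        /\ betti (initial_ideal J) p (p + r) <> 0,
      is_reg J r /\ is_reg (initial_ideal J) r
    & is_pd J p /\ is_pd (initial_ideal J) p].
Proof.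
move=> hG hv Gc [_ pd1] [_ pd2] [_ reg1] [_ reg2] nz1 nz2 p r.
have Gc1 := closed_sub hG Gc; have Gc2 := closed_sub (glued_at_sym hG) Gc.
have hM := binom_edge_initial Gc K.
have hM1 := binom_edge_initial Gc1 K; have hM2 := binom_edge_initial Gc2 K.
have sinj := @split_var_inj _ _ _ _ _ hG.
apply: (initial_ideal_corner (binom_edge_proper G K) (binom_edge_lead_set Gc K) hM).
  move=> i j /(betti_sum_neq0 sinj hM hM1 hM2 (graph_red_split hG hv)).
  case=> i1 [i2 [j1 [j2 [b1 b2 -> ->]]]].
  have := pd1 _ _ b1; have := pd2 _ _ b2; have := reg1 _ _ b1; have := reg2 _ _ b2.
  by rewrite /p /r; lia.
rewrite /p /r addnACA.
apply: (betti_sum_neq0_conv sinj hM hM1 hM2 (graph_red_split hG hv)) => //.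
  exact: graph_red_free1.
exact: graph_red_free2.
Qed.

Theorem proposition1p8 (K : fieldType) (n : nat) (G G1 G2 : lgraph n) (v : 'I_n)
    (p1 p2 r1 r2 : nat)
    (hV : vset G = [set: 'I_n])
    (hconn : connected G)
    (hclosed : closed_graph G)
    (hunion : is_union G G1 G2)
    (hinter : vset G1 :&: vset G2 = [set v])
    (hv : cut_point G v)
    (hG1 : forall w : 'I_n, ~ cut_point G1 w)
    (hG2 : forall w : 'I_n, ~ cut_point G2 w)
    (hp1 : is_pd (initial_ideal (binom_edge_ideal K G1)) p1)
    (hp2 : is_pd (initial_ideal (binom_edge_ideal K G2)) p2)
    (hr1 : is_reg (initial_ideal (binom_edge_ideal K G1)) r1)
    (hr2 : is_reg (initial_ideal (binom_edge_ideal K G2)) r2)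
    (hb1 : betti (initial_ideal (binom_edge_ideal K G1)) p1 (p1 + r1) <> 0)
    (hb2 : betti (initial_ideal (binom_edge_ideal K G2)) p2 (p2 + r2) <> 0) :
  let p := p1 + p2 in
  let r := r1 + r2 in
  let J := binom_edge_ideal K G in
  [/\ betti J p (p + r) = betti (initial_ideal J) p (p + r)
        /\ betti (initial_ideal J) p (p + r) <> 0,
      is_reg J r /\ is_reg (initial_ideal J) r
    & is_pd J p /\ is_pd (initial_ideal J) p].
Proof.
have hG : glued_at v G G1 G2 by [].
have [ord|ord] := cut_point_order hG hconn hclosed hv (hG1 v) (hG2 v).
  exact: glued_corner hG ord hclosed hp1 hp2 hr1 hr2 hb1 hb2.
move=> p r J; rewrite /p /r [p1 + p2]addnC [r1 + r2]addnC.
exact: glued_corner (glued_at_sym hG) ord hclosed hp2 hp1 hr2 hr1 hb2 hb1.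
Qed.
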